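(* Let $p,q\ge2$ be integers and suppose $(\beta,h)\in\Theta$ is special. Assume $\beta$ is known and $\boldsymbol X\sim\mathbb P_{\beta,h,N}$. Let $\boldsymbol m_*=\boldsymbol x_s$ be the unique maximizer of $H_{\beta,h}$, and let $\hat h_N$ be the maximum likelihood estimator of $h$. (1) If $(\beta,h)$ is type-I special then, as $N\to\infty$, $N^{3/4}(\hat h_N-h)\xrightarrow{D}G_1$, where the distribution function of $G_1$ is $$G_1(t)=R_{0,0}\left(-\int_{-\infty}^\infty u\,\mathrm dR_{0,t}(u)\right),$$ and $R_{\bar\beta,\bar h}$ denotes the distribution function of the random variable $T_{\bar\beta,\bar h}$ with density at $x$ proportional to $\exp\left(\frac{x^4}{24}q^4f^{(4)}_{\beta,h}(s)+\left(\bar\beta p\langle\boldsymbol m_*^{p-1},\boldsymbol u\rangle+\bar h(1-q)\right)x\right)$, with $\boldsymbol u=(1-q,1,\dots,1)$. (2) If $(\beta,h)$ is type-II special then, as $N\to\infty$, $N^{5/6}(\hat h_N-h)\xrightarrow{D}G_2$, where the distribution function of $G_2$ is $$G_2(t)=H_0\left(-\int_{-\infty}^\infty u\,\mathrm dH_t(u)\right),$$ and $H_{\bar h}$ denotes the distribution function of the random variable $F_{\bar h}$ with density at $x$ proportional to $\exp\left(-\frac{32}{15}x^6-\bar hx\right)$.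
   Context: For real $\beta,h$ and $N\ge1$, $\mathbb P_{\beta,h,N}$ is the probability measure on $\{1,\dots,q\}^N$ with $\mathbb P_{\beta,h,N}(\boldsymbol X)\propto\exp\left(\beta N\sum_{r=1}^q\bar X_{\cdot r}^p+Nh\bar X_{\cdot1}\right)$, where $\bar X_{\cdot r}=N^{-1}\#\{i:X_i=r\}$; $\mathbb E_{\beta,h,N}$ is its expectation. $\Theta=(0,\infty)\times[0,\infty)$. For known $\beta$ and one sample $\boldsymbol X$, $\hat h_N$ maximizes the likelihood $h'\mapsto\mathbb P_{\beta,h',N}(\boldsymbol X)$ over $h'\in\mathbb R$; equivalently it is the solution in $h'$ of $\mathbb E_{\beta,h',N}(\bar X_{\cdot1})=\bar X_{\cdot1}$ (the left side is strictly increasing in $h'$; if there is no finite solution, $\hat h_N=\pm\infty$ according to where the supremum of the likelihood is approached). On the set $\mathcal P_q$ of probability vectors in $\mathbb R^q$, $H_{\beta,h}(\boldsymbol t)=\beta\sum_r t_r^p+ht_1-\sum_r t_r\log t_r$ (not to be confused with the distribution functions $H_{\bar h}$ with a single subscript). For $s\in[0,1]$, $\boldsymbol x_s=\left(\frac{1+(q-1)s}{q},\frac{1-s}{q},\dots,\frac{1-s}{q}\right)$ and $f_{\beta,h}(s)=H_{\beta,h}(\boldsymbol x_s)$. A unique global maximizer of $H_{\beta,h}$ is of the form $\boldsymbol x_s$, $s\in[0,1)$. With $\boldsymbol Q_{\boldsymbol v,\beta}(\boldsymbol t)=\sum_{r=1}^q\left(\beta p(p-1)v_r^{p-2}-\frac1{v_r}\right)t_r^2$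 and $\mathcal H_q=\{\boldsymbol t\in\mathbb R^q:\sum_r t_r=0\}$, the point $(\beta,h)$ is special if $H_{\beta,h}$ has a unique global maximizer $\boldsymbol m_*=\boldsymbol x_s$ and $\boldsymbol Q_{\boldsymbol m_*,\beta}$ is singular on $\mathcal H_q$ (there is a nonzero $\boldsymbol t\in\mathcal H_q$ with $\boldsymbol Q_{\boldsymbol m_*,\beta}(\boldsymbol t)=0$); it is type-I special if $f^{(4)}_{\beta,h}(s)<0$ and type-II special if $f^{(4)}_{\beta,h}(s)=0$. Powers of vectors are coordinatewise. *)

(* Defs.v *)
From HB Require Import structures.
From mathcomp Require Import all_boot all_order all_algebra.
From mathcomp Require Import all_classical all_reals all_analysis.
From mathcomp Require Import measurable_realfun.

Set Implicit Arguments.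
Unset Strict Implicit.
Unset Printing Implicit Defensive.

Import Order.TTheory GRing.Theory Num.Theory.
Import numFieldNormedType.Exports.

Local Open Scope classical_set_scope.
Local Open Scope ring_scope.

(* The q colours are the elements of 'I_q; color1 is the one that carries the
   magnetic field h. *)
Definition color1 (q : nat) (q_gt1 : (1 < q)%N) : 'I_q := Ordinal (ltnW q_gt1).

Section potts_model.
Context {R : realType} (p q : nat) (q_gt1 : (1 < q)%N).
Local Notation c1 := (color1 q_gt1).

Definition xbar (N : nat) (X : {ffun 'I_N -> 'I_q}) : 'rV[R]_q :=
  \row_r (#|[set i | X i == r]%SET|%:R / N%:R).

Definition potts_weight (beta h : R) (N : nat) (X : {ffun 'I_N -> 'I_q}) : R :=
  expR (beta * N%:R * \sum_(r < q) xbar X 0 r ^+ p + N%:R * h * xbar X 0 c1).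

Definition potts_pmf (beta h : R) (N : nat) (X : {ffun 'I_N -> 'I_q}) : R :=
  potts_weight beta h X /
    \sum_(Y : {ffun 'I_N -> 'I_q}) potts_weight beta h Y.

Definition potts_prob (beta h : R) (N : nat)
    (A : pred {ffun 'I_N -> 'I_q}) : R :=
  \sum_(X | A X) potts_pmf beta h X.

(* e is a maximum likelihood estimate of the field from the sample X: a finite
   maximizer of the likelihood, or, when there is none, the end of the real line
   at which the supremum of the likelihood is approached. *)
Definition is_mle (beta : R) (N : nat) (X : {ffun 'I_N -> 'I_q})
    (e : \bar R) : Prop :=
  let L (h' : R) := potts_pmf beta h' X in
  let maximizes (h' : R) := forall h'', L h'' <= L h' in
  match e with
  | h'%:E => maximizes h'
  | +oo%E => (~ exists h', maximizes h') /\ L h' @[h' --> +oo] --> sup (range L)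
  | -oo%E => (~ exists h', maximizes h') /\ L h' @[h' --> -oo] --> sup (range L)
  end.

(* For N >= 1 there is exactly one e such that is_mle beta X e; the default
   value 0 is never used then. *)
Definition mle (beta : R) (N : nat) (X : {ffun 'I_N -> 'I_q}) : \bar R :=
  xget 0%E [set e | is_mle beta X e].

Definition prob_vectors : set 'rV[R]_q :=
  [set t | (forall r, 0 <= t 0 r) /\ \sum_(r < q) t 0 r = 1].

(* ln 0 = 0, so that t log t = 0 at t = 0. *)
Definition Hfun (beta h : R) (t : 'rV[R]_q) : R :=
  beta * \sum_(r < q) t 0 r ^+ p + h * t 0 c1
  - \sum_(r < q) t 0 r * ln (t 0 r).

Definition xs (s : R) : 'rV[R]_q :=
  \row_r (if r == c1 then (1 + (q%:R - 1) * s) / q%:R else (1 - s) / q%:R).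

(* This formula makes sense and is smooth for s in ]-1/(q-1), 1[, so the
   two-sided derivatives of f at a point of [0, 1[ (0 included) are the
   derivatives of its restriction to [0, 1]. *)
Definition f (beta h : R) (s : R) : R := Hfun beta h (xs s).

Definition f4 (beta h s : R) : R := derive1n 4 (f beta h) s.

Definition unique_maximizer (beta h : R) (m : 'rV[R]_q) : Prop :=
  prob_vectors m /\
  forall t, prob_vectors t -> t <> m -> Hfun beta h t < Hfun beta h m.

Definition Qform (v : 'rV[R]_q) (beta : R) (t : 'rV[R]_q) : R :=
  \sum_(r < q) (beta * p%:R * (p%:R - 1) * v 0 r ^+ (p - 2) - (v 0 r)^-1)
    * t 0 r ^+ 2.

Definition sum_zero : set 'rV[R]_q := [set t | \sum_(r < q) t 0 r = 0].

Definition Qsingular (v : 'rV[R]_q) (beta : R) : Prop :=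
  exists t, [/\ sum_zero t, t <> 0 & Qform v beta t = 0].

(* (beta, h) is special, with unique maximizer m_* = xs s. *)
Definition special (beta h s : R) : Prop :=
  [/\ 0 <= s < 1, unique_maximizer beta h (xs s) & Qsingular (xs s) beta].

Definition typeI_special (beta h s : R) : Prop :=
  special beta h s /\ f4 beta h s < 0.

Definition typeII_special (beta h s : R) : Prop :=
  special beta h s /\ f4 beta h s = 0.

Definition uvec : 'rV[R]_q := \row_r (if r == c1 then 1 - q%:R else 1).

End potts_model.

Section exp_poly_measure.
Context {R : realType} (w : {poly R}).

Definition exp_poly_measure (A : set (measurableTypeR R)) : \bar R :=
  (\int[lebesgue_measure]_(x in A) (expR w.[x])%:E)%E.

Let measure_set0 : exp_poly_measure set0 = 0%E.
Proof. by rewrite /exp_poly_measure integral_set0. Qed.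

Let measure_nneg A : (0 <= exp_poly_measure A)%E.
Proof. by apply: integral_ge0 => x _; rewrite lee_fin expR_ge0. Qed.

Let measure_sadditive : semi_sigma_additive exp_poly_measure.
Proof.
move=> /= A mA tA mUA.
have mw : measurable_fun setT (fun x : measurableTypeR R => (expR w.[x])%:E).
  apply/measurable_EFinP; apply: measurableT_comp => //.
  by apply: continuous_measurable_fun; exact: continuous_horner.
have w_ge0 x : (0 <= (expR w.[x])%:E)%E by rewrite lee_fin expR_ge0.
have -> : exp_poly_measure (\bigcup_n A n) =
    (\sum_(n <oo) exp_poly_measure (A n))%E.
  apply: ge0_integral_bigcup => //; exact: measurable_funTS.
apply: is_cvg_ereal_nneg_natsum_cond => n _ _; exact: measure_nneg.
Qed.

HB.instance Definition _ := isMeasure.Build _ _ _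
  exp_poly_measure measure_set0 measure_nneg measure_sadditive.

End exp_poly_measure.

(* The law on R whose density at x is proportional to exp (w.[x]); it is a Dirac
   mass when exp (w.[x]) is not integrable. *)
Definition exp_poly_law {R : realType} (w : {poly R}) :
    probability (measurableTypeR R) R :=
  mnormalize (exp_poly_measure w) (dirac (0 : measurableTypeR R)).

Definition distr_fun {R : realType} (mu : probability (measurableTypeR R) R)
  (t : R) : R := fine (mu `]-oo, t]%classic).

Definition law_mean {R : realType} (mu : probability (measurableTypeR R) R) : R :=
  \int[mu]_u u.

(* Convergence in distribution to mu of (possibly extended-real) random
   variables with distribution functions F N. *)
Definition cvg_in_distribution {R : realType} (F : nat -> R -> R)
    (mu : probability (measurableTypeR R) R) : Prop :=
  forall t : R, {for t, continuous (distr_fun mu)} ->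
    F N t @[N --> \oo] --> distr_fun mu t.

Section limit_laws.
Context {R : realType} (p q : nat) (q_gt1 : (1 < q)%N).

(* The law of T_{bbar,hbar} at the point (beta, h) with m_* = xs s. *)
Definition T_law (beta h s bbar hbar : R) :
    probability (measurableTypeR R) R :=
  exp_poly_law
    ((q%:R ^+ 4 * f4 p q_gt1 beta h s / 24) *: 'X^4 +
     (bbar * p%:R * (\sum_(r < q) xs q_gt1 s 0 r ^+ (p - 1) * uvec q_gt1 0 r)
      + hbar * (1 - q%:R)) *: 'X).

Definition F_law (hbar : R) : probability (measurableTypeR R) R :=
  exp_poly_law ((- (32 / 15)) *: 'X^6 - hbar *: 'X).

(* Distribution function of N^a (hhat_N - h) under P_{beta,h,N}. *)
Definition mle_distr_fun (beta h a : R) (N : nat) (t : R) : R :=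
  potts_prob p q_gt1 beta h
    (fun X : {ffun 'I_N -> 'I_q} =>
       ((N%:R `^ a)%:E * (mle p q_gt1 beta X - h%:E) <= t%:E)%E).

End limit_laws.

(* Main.v *)
Require Import Defs.
From HB Require Import structures.
From mathcomp Require Import all_boot all_order all_algebra.
From mathcomp Require Import all_classical all_reals all_analysis.
From mathcomp Require Import measurable_realfun ring lra.

Set Implicit Arguments.
Unset Strict Implicit.
Unset Printing Implicit Defensive.

Import Order.TTheory GRing.Theory Num.Theory.
Import numFieldNormedType.Exports.

Local Open Scope classical_set_scope.
Local Open Scope ring_scope.

(** Write [m = q - 1], let [a] and [b] be the proportions of colour 1 and of each
    other colour in the maximizer, and let [F] be the restriction of the
    functional [Hfun] to the segment of the vectors whose coordinates outside
    colour 1 are equal, parametrized by the first coordinate.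

    The field acts only through the count [k] of colour 1. The inverse likelihood
    is strictly convex in the field, hence the estimate is at most [h'] if and
    only if the observed proportion of colour 1 is at most its mean under [h']
    ([mle_le]). For [h' = h + t N^(1/d - 1)] the change of the field multiplies the
    weight of the count [k] by [exp (m t x_k)], up to a constant, where
    [x_k = N^(1/d) (k/N - a) / m] is the rescaled count
    ([mean_count1_threshold]). The distribution function of the rescaled estimate
    at [t] is therefore the probability that the rescaled count is at most its own
    mean under the tilt [m t], and it suffices to know the limit law of the
    rescaled count together with its exponential moments.

    The weight of the count [k] behaves like [exp (N F(k/N))]. Instead of
    multinomial asymptotics the proof uses the recolouring of one site, a
    bijection that gives two exact identities ([exchange]). The first one is a
    recursion in [k] for the weight of the count ([count_weight_rec]). The second
    one is a discrete integration by parts for the other colours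
    ([pair_identity]); it shows that, given the count of colour 1, their
    proportions are equal up to [O(N^(-1/2))] ([spread_bound]). Together they
    determine the increments of the logarithm of the weight up to [O(1/N)]
    ([count_weight_increment]). Away from [a] the weight is exponentially small,
    by a large deviation estimate: the number of types is polynomial, and the
    tangent planes of the convex powers compare the total weight with a product
    measure ([sum_weight_le], [partition_ge]).

    At a special point the quadratic form degenerates along the segment only, so
    that the second derivative of [F] at [a] vanishes, and the third one with it
    since [a] is a maximum ([F2_eq0], [F3_eq0]). If the fourth derivative is
    negative, [d = 4]. If it vanishes, the equations for the three derivatives
    leave a single model, with two colours, [p = 4], [beta = 2/3] and [a = 1/2]
    ([F4_eq0]), for which [d = 6]. In both cases the Laplace method gives the limit
    density [exp (c x^d)] with [c = m^d F^(d)(a) / d!], together with the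
    convergence of the exponential moments and of the probabilities of moving
    half-lines ([laplace_sum]).

    The limit in [t] is thus the distribution function of this density at the
    mean of its tilt by [m t]. It is a distribution function because this mean is
    nondecreasing, continuous and unbounded on both sides in [t]
    ([limit_cdf_probability]); it is the one of the statement because for even
    [d] the mean is odd in the tilt ([tilted_mean_opp]). *)

(** * Taylor expansions and one-variable calculus *)

Section calculus.
Context {R : realType}.
Implicit Types (a x y e : R) (D : nat -> R -> R).

Lemma is_derive_pow n x :
  is_derive x 1 (fun z : R => z ^+ n) (n%:R * x ^+ n.-1).
Proof.
have -> : (fun z : R => z ^+ n) = (@id R) ^+ n by apply/funext => z; rewrite fctE.
by apply: is_derive_eq; rewrite scaler1.
Qed.

Lemma is_derive_powV n x : x != 0 ->
  is_derive x 1 (fun z : R => z ^- n) (- n%:R * x ^- n.+1).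
Proof.
move=> x0; have xn0 : x ^+ n != 0 by rewrite expf_neq0.
have := @is_deriveV R (fun z => z ^+ n) x _ 1 xn0 (is_derive_pow n x).
move=> H; apply: (is_derive_eq H); rewrite /GRing.scale/=.
case: n {H} xn0 => [|n] xn0 /=; first by rewrite oppr0 !mul0r mulr0.
by rewrite !exprS; field; rewrite x0 expf_neq0.
Qed.

Lemma MVT_between (f df : R -> R) (lo hi a x : R) :
  (forall z, lo < z < hi -> is_derive z 1 f (df z)) ->
  lo < a < hi -> lo < x < hi ->
  exists2 z, `|z - a| <= `|x - a| /\ lo < z < hi & f x - f a = df z * (x - a).
Proof.
move=> Df.
have key u v : lo < u < hi -> lo < v < hi -> u <= v ->
    exists2 z, u <= z <= v & f v - f u = df z * (v - u).
  move=> /andP[u1 u2] /andP[v1 v2] uv.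
  have H1 z : z \in `]u, v[ -> is_derive z 1 f (df z).
    by rewrite in_itv/= => /andP[uz zv]; apply: Df; rewrite (lt_trans u1)//= (lt_trans zv).
  have [|z] := @MVT_segment R f df u v uv H1.
    apply: derivable_within_continuous => z; rewrite in_itv/= => /andP[uz zv].
    have := Df z; rewrite (lt_le_trans u1)//= (le_lt_trans zv)// => /(_ isT) [+ _].
    by [].
  by rewrite in_itv/= => zuv e; exists z.
move=> ah xh; have [ax|/ltW xa] := leP a x.
  have [z /andP[az zx] e] := key _ _ ah xh ax; exists z => //; split.
    by rewrite !ger0_norm ?subr_ge0// ?lerD2r//.
  move: ah xh => /andP[a1 a2] /andP[x1 x2].
  by rewrite (lt_le_trans a1)//= (le_lt_trans zx).
have [z /andP[xz za] e] := key _ _ xh ah xa; exists z.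
  split; first by rewrite !ler0_norm ?subr_le0// lerN2 lerD2r.
  move: ah xh => /andP[a1 a2] /andP[x1 x2].
  by rewrite (lt_le_trans x1)//= (le_lt_trans za).
by rewrite -opprB e -mulrN opprB.
Qed.

(** Induction on the order: by the mean value theorem the remainder of [D 0] at
    [x] is the remainder of [D 1] at an intermediate point times [x - a]. The
    last derivative is only evaluated near [a], so its continuity there is
    enough. *)
Lemma taylor_vanishing D (lo hi a : R) n : lo < a < hi ->
  (forall i z, (i < n)%N -> lo < z < hi -> is_derive z 1 (D i) (D i.+1 z)) ->
  {for a, continuous (D n)} ->
  (forall i, (i < n)%N -> D i a = 0) ->
  forall e, 0 < e -> \forall x \near a,
    `|D 0%N x - D n a / n`!%:R * (x - a) ^+ n| <= e * `|x - a| ^+ n.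
Proof.
move=> ah.
elim: n D => [|n IHn] D DD cD D0 e e0.
  rewrite fact0 divr1; near=> x; rewrite !expr0 !mulr1.
  rewrite distrC; near: x.
  by move/cvgrPdist_le : cD; apply.
have {}IHn : \forall x \near a,
    `|D 1%N x - D n.+1 a / n`!%:R * (x - a) ^+ n| <= e * `|x - a| ^+ n.
  by apply: (IHn (fun i => D i.+1)) => // [i z ilt|i ilt];
    [exact: DD|exact: D0].
have [d /= d0 H] := IHn.
have abn : \forall x \near a, lo < x < hi.
  by move/andP: ah => [? ?]; near=> x; apply/andP; split; near: x;
   [exact: lt_nbhsr|exact: lt_nbhsl].
near=> x.
have xh : lo < x < hi by near: x.
have xd : `|x - a| < d.
  by rewrite distrC; near: x; apply/nbhs_ballP; exists d.
pose c := D n.+1 a / n.+1`!%:R.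
have Dg z : lo < z < hi -> is_derive z 1
    (fun z => D 0%N z - c * (z - a) ^+ n.+1)
    (D 1%N z - D n.+1 a / n`!%:R * (z - a) ^+ n).
  move=> zh; have := DD 0%N z isT zh => D0z.
  have H1 : is_derive z 1 (fun z => (z - a) ^+ n.+1) (n.+1%:R * (z - a) ^+ n * (1 - 0)).
    have := @is_derive1_comp R (fun z => z ^+ n.+1) (fun z => z - a) z _ _
      (is_derive_pow n.+1 _) (is_deriveB (is_derive_id z 1) (is_derive_cst a z 1)).
    by [].
  have -> : (fun z => D 0%N z - c * (z - a) ^+ n.+1) =
     (fun z => D 0%N z) - c \*: (fun z => (z - a) ^+ n.+1).
    by apply/funext => t /=; rewrite !fctE.
  apply: (is_derive_eq (is_deriveB D0z (is_deriveZ c H1))).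
  rewrite /GRing.scale/= /c factS natrM subr0 mulr1.
  have nf : (n`!%:R : R) != 0 by rewrite pnatr_eq0 -lt0n fact_gt0.
  have n0 : (n.+1%:R : R) != 0 by rewrite pnatr_eq0.
  move: nf n0; move: (n.+1%:R : R) (n`!%:R : R) => u v v0 u0.
  by field; rewrite v0.
have [z [za zh]] := MVT_between Dg ah xh.
rewrite D0// subrr expr0n mulr0 subrr subr0 => ->.
rewrite normrM exprSr mulrA ler_wpM2r//.
have /= Hz : `|a - z| < d by rewrite distrC (le_lt_trans za).
apply: (le_trans (H _ Hz)).
by rewrite ler_wpM2l ?(ltW e0)// lerXn2r// ?nnegrE.
Unshelve. all: by end_near. Qed.

Lemma taylor_at D (lo hi a : R) n : lo < a < hi -> (0 < n)%N ->
  (forall i z, (i < n)%N -> lo < z < hi -> is_derive z 1 (D i) (D i.+1 z)) ->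
  {for a, continuous (D n)} ->
  (forall i, (0 < i < n)%N -> D i a = 0) ->
  forall e, 0 < e -> \forall x \near a,
    `|D 0%N x - D 0%N a - D n a / n`!%:R * (x - a) ^+ n| <= e * `|x - a| ^+ n.
Proof.
move=> ah n0 DD cD D0 e e0.
pose D' i := if i is 0%N then (fun x => D 0%N x - D 0%N a) else D i.
have D'n : D' n = D n by rewrite /D'; case: n n0 {DD cD D0}.
have := @taylor_vanishing D' lo hi a n ah; rewrite D'n; apply => //.
- move=> [|i] z ilt zh; last exact: DD.
  have -> : D' 0%N = D 0%N - cst (D 0%N a) by [].
  by apply: (is_derive_eq (is_deriveB (DD _ _ ilt zh) (is_derive_cst _ _ _))); rewrite subr0.
- by move=> [|i] ilt; [rewrite /D' subrr|exact: D0].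
Qed.

(** The leading term of the expansion has to be nonpositive at [a + y] and at
    [a - y] for small [y]; for an odd order these two values are opposite. *)
Lemma local_max_taylor D (lo hi a : R) n : lo < a < hi -> (0 < n)%N ->
  (forall i z, (i < n)%N -> lo < z < hi -> is_derive z 1 (D i) (D i.+1 z)) ->
  {for a, continuous (D n)} ->
  (forall i, (0 < i < n)%N -> D i a = 0) ->
  (\forall x \near a, D 0%N x <= D 0%N a) ->
  D n a <= 0 /\ (odd n -> D n a = 0).
Proof.
move=> ah n0 DD cD D0 amax.
have nf : 0 < (n`!%:R : R) by rewrite ltr0n fact_gt0.
have key (s : bool) : D n a * (-1) ^+ (s * n) <= 0.
  rewrite leNgt; apply/negP => c0.
  have e0 : 0 < D n a / n`!%:R * (-1) ^+ (s * n) / 2.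
    by rewrite [X in X / 2]mulrAC divr_gt0// divr_gt0.
  have /nbhs_ballP[d /= d0 H] : nbhs a ([set x | `|D 0%N x - D 0%N a -
      D n a / n`!%:R * (x - a) ^+ n| <=
      (D n a / n`!%:R * (-1) ^+ (s * n) / 2) * `|x - a| ^+ n] `&`
      [set x | D 0%N x <= D 0%N a]).
    by apply: filterI => //; exact: (taylor_at ah n0 DD cD D0 e0).
  pose x := a + (-1) ^+ s * (d / 2).
  have xa : x - a = (-1) ^+ s * (d / 2) by rewrite /x addrC addKr.
  have xd : ball a d x.
    rewrite /ball/= distrC xa normrM normrX normrN1 expr1n mul1r.
    by rewrite gtr0_norm ?divr_gt0// ltr_pdivrMr// ltr_pMr// ltr1n.
  have [] := H _ xd; rewrite /= xa exprMn -exprM => H1 H2.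
  have d2 : 0 < (d / 2) ^+ n by rewrite exprn_gt0// divr_gt0.
  move: H1; rewrite normrM normrX normrN1 expr1n mul1r gtr0_norm ?divr_gt0//.
  rewrite ler_norml => /andP[+ _].
  move: e0 d2 H2; move: (D 0%N x) (D 0%N a) (D n a / n`!%:R) ((-1) ^+ (s * n)) ((d / 2) ^+ n).
  move=> X A C S E e0 E0 XA; rewrite !mulrA.
  by have := mulr_gt0 e0 E0; lra.
have k0 := key false; have k1 := key true; move: k0 k1.
rewrite mul0n mul1n expr0 mulr1 => k0 k1; split => // on.
by apply/eqP; rewrite eq_le k0 /=; move: k1; rewrite -signr_odd on expr1; lra.
Qed.

Lemma taylor2_bound (g g1 g2 : R -> R) (lo hi C x y : R) :
  (forall z, lo < z < hi -> is_derive z 1 g (g1 z)) ->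
  (forall z, lo < z < hi -> is_derive z 1 g1 (g2 z)) ->
  (forall z, lo < z < hi -> `|g2 z| <= C) ->
  lo < x < hi -> lo < y < hi ->
  `|g x - g y - g1 y * (x - y)| <= C * (x - y) ^+ 2.
Proof.
move=> Dg Dg1 bg2 xh yh.
have [z [zy zh] ->] := MVT_between Dg yh xh.
have [t [ty th] e] := MVT_between Dg1 yh zh.
rewrite -mulrBl e normrM normrM -(ger0_norm (sqr_ge0 (x - y))) normrX expr2 mulrA.
rewrite ler_wpM2r//; apply: ler_pM => //; exact: bg2.
Qed.

(** The successive derivatives of [x |-> beta x^p - x ln x], the contribution of
    one colour to [Hfun]. The falling factorial makes the first summand vanish
    beyond order [p]. *)
Definition etad (beta : R) p k x : R :=
  beta * (p ^_ k)%:R * x ^+ (p - k) +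
  match k with
  | 0 => - (x * ln x)
  | 1 => - ln x - 1
  | k'.+2 => (-1) ^+ k'.+1 * k'`!%:R * x ^- k'.+1
  end.

Lemma is_derive_etad beta p k x : 0 < x ->
  is_derive x 1 (etad beta p k) (etad beta p k.+1 x).
Proof.
move=> x0; have xn0 : x != 0 by rewrite gt_eqF.
have H1 : is_derive x 1 (fun z : R => beta * (p ^_ k)%:R * z ^+ (p - k))
    (beta * (p ^_ k.+1)%:R * x ^+ (p - k.+1)).
  have -> : (fun z : R => beta * (p ^_ k)%:R * z ^+ (p - k)) =
    (beta * (p ^_ k)%:R) \*: (fun z : R => z ^+ (p - k)) by [].
  apply: (is_derive_eq (is_deriveZ _ (is_derive_pow _ _))).
  by rewrite /GRing.scale/= ffactnSr natrM subnS !mulrA.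
have Dln : is_derive x 1 (@ln R) x^-1 := is_derive1_ln x0.
case: k H1 => [|[|k]] H1.
- have -> : etad beta p 0 = (fun z : R => beta * (p ^_ 0)%:R * z ^+ (p - 0)) -
     ((@id R) * (@ln R)) by apply/funext.
  apply: (is_derive_eq (is_deriveB H1 (is_deriveM (is_derive_id x 1) Dln))).
  by rewrite /GRing.scale/= /etad mulr1; field.
- have -> : etad beta p 1 = (fun z : R => beta * (p ^_ 1)%:R * z ^+ (p - 1)) -
     ((@ln R) + cst 1).
    by apply/funext => z; rewrite /etad !fctE opprD.
  have D1 := is_deriveB H1 (is_deriveD Dln (is_derive_cst (1 : R) x 1)).
  apply: (is_derive_eq D1).
  by rewrite /etad !expr1 fact0 addr0 mulr1 mulN1r.
- have -> : etad beta p k.+2 = (fun z : R => beta * (p ^_ k.+2)%:R * z ^+ (p - k.+2)) +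
     ((-1) ^+ k.+1 * k`!%:R) \*: (fun z : R => z ^- k.+1) by [].
  apply: (is_derive_eq (is_deriveD H1 (is_deriveZ _ (is_derive_powV k.+1 xn0)))).
  rewrite /GRing.scale/= /etad; congr (_ + _); rewrite (exprS (-1) k.+1) factS natrM.
  by rewrite mulN1r; move: ((-1) ^+ k.+1) (x ^- k.+2) (k.+1%:R : R) => u v w; ring.
Qed.

End calculus.
(** * Recolouring one site *)

Section configurations.
Context {R : realType} (p q : nat) (q_gt1 : (1 < q)%N) (beta h : R) (N : nat).
Hypothesis N_gt0 : (0 < N)%N.
Local Notation c1 := (color1 q_gt1).
Local Notation config := {ffun 'I_N -> 'I_q}.
Implicit Types (X Y : config) (i : 'I_N) (r s t : 'I_q).
Local Notation weight := (potts_weight p q_gt1 beta h).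

Definition cnt X r : nat := #|[set i | X i == r]%SET|.

Definition recolor X i r : config := [ffun j => if j == i then r else X j].

Lemma xbarE X r : xbar X 0 r = (cnt X r)%:R / N%:R :> R.
Proof. by rewrite mxE. Qed.

Lemma cntE X r : cnt X r = (\sum_i (X i == r))%N.
Proof. by rewrite /cnt -sum1dep_card big_mkcond. Qed.

Lemma cnt_sum X : (\sum_r cnt X r = N)%N.
Proof.
under eq_bigr do rewrite cntE.
rewrite exchange_big/= -[RHS]card_ord -sum1_card; apply: eq_bigr => i _.
by rewrite (bigD1 (X i))//= eqxx big1 // => r /negPf; rewrite eq_sym => ->.
Qed.

Lemma cnt_le X r : (cnt X r <= N)%N.
Proof. by rewrite -[leqRHS](cnt_sum X) (bigD1 r)//= leq_addr. Qed.

Lemma cnt_recolor X i r t :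
  (cnt (recolor X i r) t + (X i == t) = cnt X t + (r == t))%N.
Proof.
rewrite !cntE (bigD1 i)//= [in RHS](bigD1 i)//= /recolor ffunE eqxx.
rewrite (eq_bigr (fun j => (X j == t : nat))); last first.
  by move=> j /negPf ji; rewrite ffunE ji.
by rewrite addnAC [RHS]addnC addnA.
Qed.

Lemma sum_cnt (A : config -> R) r :
  \sum_X (cnt X r)%:R * A X = \sum_i \sum_(X : config | X i == r) A X.
Proof.
under eq_bigr do rewrite cntE natr_sum mulr_suml.
rewrite exchange_big/=; apply: eq_bigr => i _.
rewrite [RHS]big_mkcond/=; apply: eq_bigr => X _.
by case: eqP; rewrite ?mul1r ?mul0r.
Qed.

Lemma sum_recolor (A : config -> R) i r s :
  \sum_(X : config | X i == r) A X = \sum_(X : config | X i == s) A (recolor X i r).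
Proof.
rewrite (reindex_onto (fun X => recolor X i r) (fun X => recolor X i s))/=.
  apply: eq_bigl => X; rewrite ffunE eqxx eqxx /=.
  apply/eqP/eqP => [<-|Xi]; first by rewrite ffunE eqxx.
  by apply/ffunP => j; rewrite !ffunE; case: eqP => // ->.
by move=> X /eqP Xi; apply/ffunP => j; rewrite !ffunE; case: eqP => // ->.
Qed.

(** When a site leaves a colour of count [j], the energy [beta N (j/N)^p] drops
    by the exponent below; the factor [j/N] is the proportion of the sites that
    may be chosen. *)
Definition dphi (j : nat) : R :=
  j%:R / N%:R *
  expR (- (beta * N%:R * ((j%:R / N%:R) ^+ p - (j.-1%:R / N%:R) ^+ p))).

Definition field_at r : R := if r == c1 then h else 0.

Lemma weight_recolor X i r s : r != s -> X i = s ->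
  weight (recolor X i r) *
    expR (- (beta * N%:R * (((cnt (recolor X i r) r)%:R / N%:R) ^+ p -
                            ((cnt (recolor X i r) r).-1%:R / N%:R) ^+ p)))
    * expR (- field_at r) =
  weight X *
    expR (- (beta * N%:R * (((cnt X s)%:R / N%:R) ^+ p -
                            ((cnt X s).-1%:R / N%:R) ^+ p)))
    * expR (- field_at s).
Proof.
move=> rs Xi; rewrite /potts_weight -!expRD; congr expR.
have H t := cnt_recolor X i r t.
have N0 : (N%:R : R) != 0 by rewrite pnatr_eq0 -lt0n.
have Hr : cnt (recolor X i r) r = (cnt X r).+1.
  by have := H r; rewrite Xi eqxx eq_sym (negPf rs) addn0 addn1.
have Hs : cnt X s = (cnt (recolor X i r) s).+1.
  by have := H s; rewrite Xi eqxx (negPf rs) addn0 addn1.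
have Ht t : t != r -> t != s -> cnt (recolor X i r) t = cnt X t.
  by move=> /negPf tr /negPf ts; have := H t; rewrite Xi eq_sym ts eq_sym tr !addn0.
have Hh : N%:R * h * xbar (recolor X i r) 0 c1 - field_at r =
          N%:R * h * xbar X 0 c1 - field_at s.
  rewrite !xbarE /field_at.
  have : ((cnt (recolor X i r) c1)%:R + (s == c1)%:R : R) =
         (cnt X c1)%:R + (r == c1)%:R by rewrite -!natrD -Xi H.
  move: (cnt (recolor X i r) c1)%:R (cnt X c1)%:R => u v e.
  have -> : N%:R * h * (u / N%:R) = h * u by field.
  have -> : N%:R * h * (v / N%:R) = h * v by field.
  have -> : u = v + (r == c1)%:R - (s == c1)%:R by rewrite -e; ring.
  by case: (r == c1); case: (s == c1) => /=; ring.
rewrite Hr /= (bigD1 r)//= (bigD1 s)/=; last by rewrite eq_sym.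
rewrite [X in _ = beta * N%:R * X + _ + _ + _](bigD1 r)//=.
rewrite [X in _ = beta * N%:R * (_ + X) + _ + _ + _](bigD1 s)/=; last by rewrite eq_sym.
rewrite (eq_bigr (fun t => xbar X 0 t ^+ p)); last first.
  by move=> t /andP[tr ts]; rewrite !xbarE Ht.
rewrite !xbarE in Hh *; rewrite Hr Hs /=.
move: Hh; set S := \sum_(_ < _ | _) _.
set a := N%:R * h * _; set b := N%:R * h * _ => Hh.
have -> : a = b - field_at s + field_at r by rewrite -Hh; ring.
ring.
Qed.

(** Moving one spin from colour [s] to colour [r] is a bijection between the
    pairs (configuration, site of colour [s]) and the pairs (configuration, site
    of colour [r]); [dphi] is chosen so that the change of the weight factors
    exactly through the counts of the two colours. *)
Lemma exchange (B B' : config -> R) r s : r != s ->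
  (forall X i, X i = s -> B (recolor X i r) = B' X) ->
  expR (- field_at r) * \sum_X weight X * dphi (cnt X r) * B X =
  expR (- field_at s) * \sum_X weight X * dphi (cnt X s) * B' X.
Proof.
move=> rs BB'.
have unfold t (C : config -> R) :
    expR (- field_at t) * \sum_X weight X * dphi (cnt X t) * C X =
    N%:R^-1 * \sum_X (cnt X t)%:R * (weight X * expR (- (beta * N%:R *
      (((cnt X t)%:R / N%:R) ^+ p - ((cnt X t).-1%:R / N%:R) ^+ p)))
      * expR (- field_at t) * C X).
  rewrite !mulr_sumr; apply: eq_bigr => X _; rewrite /dphi.
  by move: (expR _) (expR _) => u v; ring.
rewrite (unfold r) (unfold s) !sum_cnt; apply: congr1; apply: eq_bigr => i _.
rewrite (sum_recolor _ i r s); apply: eq_bigr => X /eqP Xi.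
by rewrite (weight_recolor rs Xi) (BB' _ _ Xi).
Qed.

End configurations.
(** * Large deviations of the type *)

Lemma tangent_pow {R : realType} (n : nat) (x v : R) : 0 <= x -> 0 <= v ->
  v ^+ n + n%:R * v ^+ n.-1 * (x - v) <= x ^+ n.
Proof.
move=> x0 v0; elim: n => [|n IHn]; first by rewrite mul0r mul0r addr0.
rewrite [x ^+ _]exprS /=; apply: le_trans (ler_wpM2l x0 IHn).
rewrite -subr_ge0 -natr1 exprS.
case: n {IHn} => [|n] /=; first by rewrite expr0 !mulr1; lra.
rewrite [X in 0 <= X](_ : _ = n.+1%:R * v ^+ n * (x - v) ^+ 2); last first.
  by rewrite exprS; ring.
by rewrite mulr_ge0 ?sqr_ge0// mulr_ge0 ?ler0n ?exprn_ge0.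
Qed.

Section large_deviations.
Context {R : realType} (p q : nat) (q_gt1 : (1 < q)%N) (beta h : R) (N : nat).
Hypotheses (N_gt0 : (0 < N)%N) (beta_gt0 : 0 < beta).
Local Notation c1 := (color1 q_gt1).
Local Notation config := {ffun 'I_N -> 'I_q}.
Implicit Types (X Y : config) (i : 'I_N) (r s t : 'I_q).
Local Notation weight := (potts_weight p q_gt1 beta h).

Lemma weight_gt0 X : 0 < weight X. Proof. exact: expR_gt0. Qed.

Lemma prod_sites (F : 'I_q -> R) X : \prod_i F (X i) = \prod_r F r ^+ cnt X r.
Proof.
rewrite (partition_big (fun i => X i) predT)//=; apply: eq_bigr => r _.
rewrite (eq_bigr (fun=> F r)); last by move=> i /eqP ->.
by rewrite prodr_const; congr (_ ^+ _); rewrite /cnt; apply: eq_card => i; rewrite !inE.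
Qed.

Lemma sum_prod_sites (F : 'I_q -> R) : \sum_(X : config) \prod_i F (X i) = (\sum_r F r) ^+ N.
Proof.
rewrite -(bigA_distr_bigA (fun (i : 'I_N) r => F r)) /=.
by rewrite prodr_const card_ord.
Qed.

Lemma xbar_ge0 X r : 0 <= xbar X 0 r :> R.
Proof. by rewrite xbarE divr_ge0. Qed.

Lemma xbar_sum X : \sum_r xbar X 0 r = 1 :> R.
Proof.
under eq_bigr do rewrite xbarE.
by rewrite -mulr_suml -natr_sum cnt_sum divff// pnatr_eq0 -lt0n.
Qed.

Lemma xbar_prob_vectors X : @prob_vectors R q (xbar X).
Proof. by split; [move=> r; exact: xbar_ge0|exact: xbar_sum]. Qed.

Lemma xbar_le1 X r : xbar X 0 r <= 1 :> R.
Proof.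
by rewrite -(xbar_sum X) (bigD1 r)//= lerDl sumr_ge0// => t _; exact: xbar_ge0.
Qed.

(** At a critical point [v] of [H] the tangent planes of the convex powers bound
    the weight below by a product weight, whose total mass is explicit. *)
Lemma partition_ge (v : 'rV[R]_q) (lambda : R) :
  (forall r, 0 < v 0 r) -> \sum_r v 0 r = 1 ->
  (forall r, beta * p%:R * v 0 r ^+ p.-1 + field_at q_gt1 h r - ln (v 0 r) = lambda) ->
  expR (N%:R * Hfun p q_gt1 beta h v) <= \sum_(X : config) weight X.
Proof.
move=> v0 v1 crit.
have N0 : (N%:R : R) != 0 by rewrite pnatr_eq0 -lt0n.
pose c r := beta * p%:R * v 0 r ^+ p.-1 + field_at q_gt1 h r.
pose S := \sum_r v 0 r ^+ p.
have Hv : Hfun p q_gt1 beta h v = lambda - beta * (p%:R - 1) * S.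
  rewrite /Hfun -/S.
  have -> : \sum_(r < q) v 0 r * ln (v 0 r) =
     beta * p%:R * \sum_r v 0 r * v 0 r ^+ p.-1 + \sum_r field_at q_gt1 h r * v 0 r - lambda.
    rewrite -[in - lambda](mulr1 lambda) -[X in lambda * X]v1 !mulr_sumr -big_split/= -sumrB.
    apply: eq_bigr => r _; rewrite -(crit r); ring.
  have -> : \sum_r v 0 r * v 0 r ^+ p.-1 = S * (p != 0%N)%:R + (p == 0%N)%:R.
    rewrite /S; case: (p) => [|p'] /=.
      by rewrite mulr0 add0r -v1; apply: eq_bigr => r _; rewrite mulr1.
    by rewrite mulr1 addr0; apply: eq_bigr => r _; rewrite exprS.
  have -> : \sum_r field_at q_gt1 h r * v 0 r = h * v 0 c1.
    rewrite (bigD1 c1)//= /field_at eqxx big1 ?addr0// => r /negPf ->.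
    by rewrite mul0r.
  by case: (p) => [|p'] /=; rewrite ?mul0r; ring.
have Ec r : expR (c r) = expR lambda * v 0 r.
  rewrite -[v 0 r]lnK ?posrE// -expRD -(crit r) /c; congr expR; ring.
have -> : expR (N%:R * Hfun p q_gt1 beta h v) =
   \sum_(X : config) expR (- (N%:R * (beta * (p%:R - 1) * S))) * \prod_i expR (c (X i)).
  rewrite -mulr_sumr (sum_prod_sites (fun r => expR (c r))); under eq_bigr do rewrite Ec.
  by rewrite -mulr_sumr v1 mulr1 -expRM_natl -expRD Hv; congr expR; ring.
apply: ler_sum => X _; rewrite (prod_sites (fun r => expR (c r))).
under eq_bigr do rewrite -expRM_natl.
rewrite -expR_sum -expRD ler_expR /potts_weight.
have -> : \sum_(r < q) (cnt X r)%:R * c r =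
   N%:R * (beta * \sum_r p%:R * v 0 r ^+ p.-1 * xbar X 0 r) + N%:R * h * xbar X 0 c1.
  have -> : N%:R * h * xbar X 0 c1 = \sum_r N%:R * field_at q_gt1 h r * xbar X 0 r.
    rewrite (bigD1 c1)//= /field_at eqxx big1 ?addr0// => r /negPf ->.
    by rewrite mulr0 mul0r.
  rewrite !mulr_sumr -big_split/=; apply: eq_bigr => r _; rewrite /c xbarE.
  by field.
set T := \sum_(r < q) _ * _; set U := \sum_(r < q) xbar X 0 r ^+ p.
have TU : T - (p%:R - 1) * S <= U.
  rewrite /T /S /U mulr_sumr -sumrB; apply: ler_sum => r _.
  apply: le_trans (tangent_pow p (xbar_ge0 X r) (ltW (v0 r))).
  rewrite le_eqVlt; apply/orP; left; apply/eqP.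
  by case: (p) => [|p'] /=; rewrite ?exprS; ring.
rewrite addrA lerD2r -subr_ge0.
rewrite [X in 0 <= X](_ : _ = N%:R * beta * (U - (T - (p%:R - 1) * S))); last by ring.
by rewrite mulr_ge0 ?subr_ge0// mulr_ge0// ltW.
Qed.

(** All configurations of a type have the same weight, and under the product
    measure with marginal [xbar X] each of them has probability
    [expR (N sum_r x_r ln x_r)]: their number is at most the inverse. *)
Lemma type_class_le X :
  #|[set Y : config | [forall r, cnt Y r == cnt X r]]%SET|%:R * weight X <=
    expR (N%:R * Hfun p q_gt1 beta h (xbar X)).
Proof.
have N0 : (N%:R : R) != 0 by rewrite pnatr_eq0 -lt0n.
pose S := \sum_r (cnt X r)%:R * ln (xbar X 0 r) : R.
have -> : expR (N%:R * Hfun p q_gt1 beta h (xbar X)) = expR (- S) * weight X.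
  rewrite -expRD; congr expR; rewrite /Hfun.
  have -> : S = N%:R * \sum_r xbar X 0 r * ln (xbar X 0 r).
    by rewrite /S mulr_sumr; apply: eq_bigr => r _; rewrite mulrA xbarE (mulrC N%:R) divfK.
  by ring.
rewrite ler_pM2r ?weight_gt0// expRN -div1r ler_pdivlMr ?expR_gt0//.
rewrite -[leRHS](expr1n _ N) -[X in _ <= X ^+ N](xbar_sum X) -(sum_prod_sites (fun r => xbar X 0 r)).
set D := [set Y : config | _]%SET.
have -> : #|D|%:R = \sum_(Y in D) 1 :> R by rewrite sumr_const.
rewrite /D mulr_suml.
rewrite [leRHS](bigID (mem [set Y : config | [forall r, cnt Y r == cnt X r]]%SET))/=.
rewrite -[leLHS]addr0 lerD//; last first.
  by rewrite sumr_ge0// => Y _; rewrite prodr_ge0// => i _; exact: xbar_ge0.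
apply: ler_sum => Y; rewrite inE => /forallP XY; rewrite mul1r.
rewrite (prod_sites (fun r => xbar X 0 r)) /S expR_sum.
rewrite le_eqVlt; apply/orP; left; apply/eqP; apply: eq_bigr => r _.
rewrite (eqP (XY r)) expRM_natl; have [->|r0] := eqVneq (cnt X r) 0%N.
  by rewrite !expr0.
by rewrite lnK// posrE xbarE divr_gt0// ltr0n// lt0n.
Qed.

(** There are at most [(N + 1) ^ q] types, and the configurations of one type
    weigh at most [expR (N H)] together. *)
Lemma sum_weight_le (P : pred config) (M : R) :
  (forall X, P X -> Hfun p q_gt1 beta h (xbar X) <= M) ->
  \sum_(X | P X) weight X <= N.+1%:R ^+ q * expR (N%:R * M).
Proof.
move=> PM.
pose ty X : {ffun 'I_q -> 'I_N.+1} := [ffun r => inord (cnt X r)].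
rewrite (partition_big ty predT)//=.
apply: (@le_trans _ _ (\sum_(tau : {ffun 'I_q -> 'I_N.+1}) expR (N%:R * M))); last first.
  by rewrite sumr_const card_ffun !card_ord -[leLHS]mulr_natl natrX.
apply: ler_sum => tau _.
have [[X /andP[PX /eqP tauX]]|none] := pselect (exists X, P X && (ty X == tau)); last first.
  by rewrite big_pred0 ?expR_ge0// => X; apply/negP => H; apply: none; exists X.
have tyP Y Z : ty Y = ty Z -> forall r, cnt Y r = cnt Z r.
  move=> /ffunP YZ r; have := YZ r; rewrite !ffunE => /(congr1 val).
  by rewrite /= !inordK ?ltnS ?cnt_le.
apply: (@le_trans _ _ (\sum_(Y in [set Y : config | [forall r, cnt Y r == cnt X r]]%SET)
   weight X)).
  rewrite [leRHS](bigID P)/= -[leLHS]addr0 lerD//; last first.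
    by rewrite sumr_ge0// => Y _; exact/ltW/weight_gt0.
  rewrite le_eqVlt; apply/orP; left; apply/eqP.
  have E Y : (P Y && (ty Y == tau)) =
    (Y \in [set Y : config | [forall r, cnt Y r == cnt X r]]%SET) && P Y.
    rewrite inE andbC; congr (_ && _); apply/eqP/forallP => [YX r|YX].
      by apply/eqP/tyP; rewrite YX.
    by rewrite -tauX; apply/ffunP => r; rewrite !ffunE (eqP (YX r)).
  rewrite (eq_bigl _ _ E); apply: eq_bigr => Y /andP[+ _].
  rewrite inE => /forallP YX.
  have xE r : xbar Y 0 r = xbar X 0 r :> R by rewrite !xbarE (eqP (YX r)).
  by rewrite /potts_weight xE; under eq_bigr do rewrite xE.
rewrite sumr_const -[leLHS]mulr_natl; apply: (le_trans (type_class_le X)).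
by rewrite ler_expR ler_wpM2l// PM.
Qed.

End large_deviations.
(** * Weight of the count of colour 1 *)

Section conditioning.
Context {R : realType} (p q : nat) (q_gt1 : (1 < q)%N) (beta h : R) (N : nat).
Hypotheses (N_gt0 : (0 < N)%N) (beta_gt0 : 0 < beta).
Local Notation c1 := (color1 q_gt1).
Local Notation config := {ffun 'I_N -> 'I_q}.
Implicit Types (X Y : config) (i : 'I_N) (r s t : 'I_q).
Local Notation weight := (potts_weight p q_gt1 beta h).
Local Notation dphi := (dphi p beta N).

Let N0 : (N%:R : R) != 0. Proof. by rewrite pnatr_eq0 -lt0n. Qed.
Let NR0 : 0 < (N%:R : R). Proof. by rewrite ltr0n. Qed.

Definition count_weight k : R := \sum_(X : config | cnt X c1 == k) weight X.

Lemma sum_count_weight (g : nat -> R) :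
  \sum_(X : config) weight X * g (cnt X c1) = \sum_(k < N.+1) count_weight k * g k.
Proof.
rewrite (partition_big (fun X => inord (cnt X c1) : 'I_N.+1) predT)//=.
apply: eq_bigr => k _; rewrite /count_weight mulr_suml; apply: eq_big => [X|X /eqP <-].
  by rewrite -val_eqE /= inordK// ltnS cnt_le.
by rewrite inordK// ltnS cnt_le.
Qed.

Lemma count_weight_ge0 k : 0 <= count_weight k.
Proof. by apply: sumr_ge0 => X _; exact/ltW/weight_gt0. Qed.

Let c2 : 'I_q := Ordinal q_gt1.

Lemma count_weight_gt0 k : (k <= N)%N -> 0 < count_weight k.
Proof.
move=> kN; pose X : config := [ffun i : 'I_N => if (i < k)%N then c1 else c2].
have Xk : cnt X c1 == k.
  apply/eqP; rewrite cntE (eq_bigr (fun i : 'I_N => if (i < k)%N then 1%N else 0%N)).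
    by rewrite -big_mkcond/= (big_ord_narrow kN)/= sum1_card card_ord.
  by move=> i _; rewrite ffunE; case: ifP; rewrite ?eqxx.
rewrite /count_weight (bigD1 X)//= ltr_pwDl ?weight_gt0// sumr_ge0// => Y _.
exact/ltW/weight_gt0.
Qed.

Lemma sum_indic (G : config -> R) (P : pred config) :
  \sum_(X : config) G X * (P X)%:R = \sum_(X | P X) G X.
Proof.
rewrite [RHS]big_mkcond/=; apply: eq_bigr => X _.
by case: (P X); rewrite ?mulr1 ?mulr0.
Qed.

(** Recolouring a site of colour [s] with colour 1 turns the count [k] of colour
    1 into [k + 1]. *)
Lemma count_weight_rec k s : s != c1 ->
  dphi k.+1 * count_weight k.+1 =
    expR h * \sum_(X : config | cnt X c1 == k) weight X * dphi (cnt X s).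
Proof.
move=> s1.
have H X i : X i = s -> ((cnt (recolor X i c1) c1 == k.+1)%:R = (cnt X c1 == k)%:R :> R).
  move=> Xi; have := cnt_recolor X i c1 c1.
  by rewrite Xi (negPf s1) eqxx addn0 addn1 => ->; rewrite eqSS.
have c1s : c1 != s by rewrite eq_sym.
have := @exchange R p q q_gt1 beta h N N_gt0
  (fun X => (cnt X c1 == k.+1)%:R) _ _ _ c1s H.
rewrite /field_at eqxx (negPf s1) oppr0 expR0 mul1r.
rewrite (sum_indic (fun X : config => weight X * dphi (cnt X c1)) (fun X => cnt X c1 == k.+1)).
rewrite (sum_indic (fun X : config => weight X * dphi (cnt X s)) (fun X => cnt X c1 == k)) => <-.
rewrite mulrA -expRD subrr expR0 mul1r /count_weight mulr_sumr; apply: eq_bigr => X /eqP ->.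
by rewrite mulrC.
Qed.

(** The same identity for two colours that carry no field, tested against the
    difference of their counts: the conditional law of these counts satisfies a
    discrete integration by parts. *)
Lemma pair_identity k r s : r != s -> r != c1 -> s != c1 ->
  \sum_(X : config | cnt X c1 == k) weight X *
      ((dphi (cnt X r) - dphi (cnt X s)) * (xbar X 0 r - xbar X 0 s)) =
  2 / N%:R * \sum_(X : config | cnt X c1 == k) weight X * dphi (cnt X s).
Proof.
move=> rs r1 s1.
have H X i : X i = s ->
    (cnt (recolor X i r) c1 == k)%:R *
      (xbar (recolor X i r) 0 r - xbar (recolor X i r) 0 s) =
    (cnt X c1 == k)%:R * (xbar X 0 r - xbar X 0 s + 2 / N%:R) :> R.
  move=> Xi; have E := cnt_recolor X i r; rewrite Xi in E.
  have := E c1; rewrite (negPf s1) (negPf r1) !addn0 => ->.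
  congr (_ * _); rewrite !xbarE -!mulrBl -mulrDl; congr (_ * _).
  have := E r; rewrite eqxx eq_sym (negPf rs) addn0 => ->.
  have := E s; rewrite eqxx (negPf rs) addn0 => <-.
  by rewrite !natrD /=; ring.
have := @exchange R p q q_gt1 beta h N N_gt0
  (fun X => (cnt X c1 == k)%:R * (xbar X 0 r - xbar X 0 s)) _ _ _ rs H.
rewrite /field_at (negPf r1) (negPf s1) oppr0 expR0 !mul1r => E.
have {}E : \sum_(X : config | cnt X c1 == k) weight X * dphi (cnt X r) * (xbar X 0 r - xbar X 0 s)
  = \sum_(X : config | cnt X c1 == k) weight X * dphi (cnt X s) * (xbar X 0 r - xbar X 0 s + 2 / N%:R).
  rewrite -(sum_indic (fun X : config => weight X * dphi (cnt X r) * (xbar X 0 r - xbar X 0 s))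
     (fun X => cnt X c1 == k)).
  rewrite -(sum_indic (fun X : config => weight X * dphi (cnt X s) *
     (xbar X 0 r - xbar X 0 s + 2 / N%:R)) (fun X => cnt X c1 == k)).
  transitivity (\sum_(X : config) weight X * dphi (cnt X r) *
    ((cnt X c1 == k)%:R * (xbar X 0 r - xbar X 0 s))).
    by apply: eq_bigr => X _; ring.
  by rewrite E; apply: eq_bigr => X _; ring.
transitivity (\sum_(X : config | cnt X c1 == k) weight X * dphi (cnt X r) * (xbar X 0 r - xbar X 0 s)
 - \sum_(X : config | cnt X c1 == k) weight X * dphi (cnt X s) * (xbar X 0 r - xbar X 0 s)).
  by rewrite -sumrB; apply: eq_bigr => X _; ring.
by rewrite E -sumrB mulr_sumr; apply: eq_bigr => X _; ring.
Qed.

End conditioning.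
(** * Bounds at a fixed number of sites *)

Section window_estimates.
Context {R : realType} (p q : nat) (p_gt1 : (1 < p)%N) (q_gt1 : (1 < q)%N).
Variables (beta h : R) (N : nat).
Hypotheses (N_gt0 : (0 < N)%N) (beta_gt0 : 0 < beta).
Local Notation c1 := (color1 q_gt1).
Local Notation config := {ffun 'I_N -> 'I_q}.
Implicit Types (X Y : config) (i : 'I_N) (r s t : 'I_q).
Local Notation weight := (potts_weight p q_gt1 beta h).
Local Notation dphi := (dphi p beta N).
Local Notation count_weight := (count_weight p q_gt1 beta h N).

Let N0 : (N%:R : R) != 0. Proof. by rewrite pnatr_eq0 -lt0n. Qed.
Let NR0 : 0 < (N%:R : R). Proof. by rewrite ltr0n. Qed.

(** The limit of [dphi], read at proportions. *)
Definition phif (x : R) : R := x * expR (- (beta * p%:R * x ^+ p.-1)).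

(** By convexity a difference quotient of the power lies between the derivatives
    at its two ends. *)
Let incr j : (j <= N)%N ->
  let x := j%:R / N%:R : R in
  let D := N%:R * (x ^+ p - (j.-1%:R / N%:R) ^+ p) in
  [/\ 0 <= D, D <= p%:R * x ^+ p.-1 & p%:R * x ^+ p.-1 - p%:R * p.-1%:R / N%:R <= D].
Proof.
case: j => [|j] jN /=.
  have E0 : (0 : R) ^+ p.-1 = 0 by rewrite expr0n -subn1 subn_eq0 leqNgt p_gt1.
  rewrite mul0r subrr mulr0 E0 mulr0; split=> //.
set x := j.+1%:R / N%:R; set y := j%:R / N%:R.
have x0 : 0 <= x by rewrite divr_ge0.
have y0 : 0 <= y by rewrite divr_ge0.
have x1 : x <= 1 by rewrite ler_pdivrMr// mul1r ler_nat.
have xy : x - y = N%:R^-1 by rewrite /x /y -mulrBl -natrB// subSnn mul1r.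
have y1 : y <= 1 by apply: le_trans x1; rewrite -subr_ge0 xy invr_ge0.
have T1 := tangent_pow p x0 y0; have T2 := tangent_pow p y0 x0.
have T3 := tangent_pow p.-1 y0 x0.
have yx : y - x = - N%:R^-1 by rewrite -opprB xy.
rewrite xy in T1; rewrite yx in T2 T3.
have E1 : p%:R * y ^+ p.-1 <= N%:R * (x ^+ p - y ^+ p).
  rewrite -ler_pdivrMl// mulrC; lra.
split.
- by apply: le_trans E1; rewrite mulr_ge0// exprn_ge0.
- by rewrite -ler_pdivlMl// mulrC; lra.
- apply: le_trans E1; rewrite -!mulrA -mulrBr ler_wpM2l//.
  have : p.-1%:R * x ^+ p.-1.-1 * N%:R^-1 <= p.-1%:R / N%:R.
    by rewrite ler_pM2r ?invr_gt0// ler_piMr// exprn_ile1.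
  lra.
Qed.

Lemma dphi_bounds j : (j <= N)%N ->
  expR (- (beta * p%:R)) * (j%:R / N%:R) <= dphi j <= j%:R / N%:R.
Proof.
move=> jN; have [/=] := incr jN; rewrite /dphi -(mulrA beta).
set D := N%:R * _ => D0 D1 _.
have x0 : 0 <= (j%:R / N%:R : R) by rewrite divr_ge0.
have x1 : (j%:R / N%:R : R) <= 1 by rewrite ler_pdivrMr// mul1r ler_nat.
apply/andP; split.
  rewrite mulrC ler_wpM2l// ler_expR lerN2 ler_pM2l//.
  by apply: (le_trans D1); rewrite ler_piMr// exprn_ile1.
by rewrite ler_piMr// -expR0 ler_expR oppr_le0 mulr_ge0// ltW.
Qed.

Lemma dphi_phif j : (j <= N)%N ->
  phif (j%:R / N%:R) <= dphi j <= phif (j%:R / N%:R) + beta * p%:R * p.-1%:R / N%:R.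
Proof.
move=> jN; have [/=] := incr jN; rewrite /dphi /phif -!(mulrA beta).
set x := j%:R / N%:R; set D := N%:R * _ => D0 D1 D2.
have x0 : 0 <= x by rewrite divr_ge0.
have x1 : x <= 1 by rewrite ler_pdivrMr// mul1r ler_nat.
apply/andP; split; first by rewrite ler_wpM2l// ler_expR lerN2 ler_pM2l.
set u := beta * (p%:R * _); set v := beta * D; set c := beta * (_ * _).
have uv : u - c <= v by rewrite /u /v /c -mulrBr ler_pM2l// mulrA.
have v0 : 0 <= v by rewrite mulr_ge0// ltW.
have vu : v <= u by rewrite ler_pM2l.
have := expR_ge1Dx (v - u).
have -> : expR (v - u) = expR (- u) / expR (- v).
  by rewrite expRB !expRN invrK mulrC.
rewrite ler_pdivlMr ?expR_gt0// => H.
have e0 : 0 < expR (- v) by exact: expR_gt0.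
have e1 : expR (- v) <= 1 by rewrite -expR0 ler_expR oppr_le0.
have H2 : expR (- v) <= expR (- u) + c.
  have : (u - v) * expR (- v) <= (u - v) * 1 by rewrite ler_wpM2l// subr_ge0.
  move: H; rewrite !mulrDl mul1r; lra.
rewrite -lerBlDl -mulrBr; apply: le_trans (_ : 1 * c <= _); last by rewrite mul1r.
by apply: ler_pM => //; [rewrite subr_ge0 ler_expR lerN2|rewrite lerBlDl].
Qed.

Lemma sum_xbar_neq1 X : \sum_(s | s != c1) xbar X 0 s = 1 - xbar X 0 c1 :> R.
Proof.
by rewrite -(xbar_sum N_gt0 X) [in RHS](bigD1 c1)//= addrC addrK.
Qed.

Lemma card_neq1 : #|[pred s : 'I_q | s != c1]| = q.-1.
Proof.
have := cardC1 c1; rewrite card_ord => <-; apply: eq_card => s.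
by rewrite !inE.
Qed.

Lemma count_weight_rec_avg k :
  q.-1%:R * (dphi k.+1 * count_weight k.+1) =
  expR h * \sum_(X : config | cnt X c1 == k) weight X * \sum_(s | s != c1) dphi (cnt X s).
Proof.
rewrite -card_neq1 mulr_natl -sumr_const.
under [X in _ = _ * X]eq_bigr do rewrite mulr_sumr.
rewrite exchange_big/= [RHS]mulr_sumr; apply: eq_big => [s|s s1]; first by rewrite inE.
by rewrite -count_weight_rec.
Qed.

(** Averaging [count_weight_rec] over [s] replaces the counts of single colours by their
    sum, which [k] determines; [dphi] being within constant factors of the
    proportion, the ratio of consecutive weights is bounded on both sides. *)
Lemma count_weight_step k : (k < N)%N ->
  q.-1%:R * expR (- (beta * p%:R)) * (k.+1%:R / N%:R) * count_weight k.+1 <=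
    expR h * (1 - k%:R / N%:R) * count_weight k /\
  expR h * expR (- (beta * p%:R)) * (1 - k%:R / N%:R) * count_weight k <=
    q.-1%:R * (k.+1%:R / N%:R) * count_weight k.+1.
Proof.
move=> kN; have /andP[B1 B2] := dphi_bounds kN; have E := count_weight_rec_avg k.
have w0 : 0 <= count_weight k.+1 by exact: count_weight_ge0.
have S X : cnt X c1 == k ->
    expR (- (beta * p%:R)) * (1 - k%:R / N%:R) <= \sum_(s | s != c1) dphi (cnt X s)
      <= 1 - k%:R / N%:R.
  move=> /eqP Xk; rewrite -Xk -xbarE -sum_xbar_neq1; apply/andP; split.
    rewrite mulr_sumr; apply: ler_sum => s _; rewrite xbarE.
    by have /andP[] := dphi_bounds (cnt_le X s).
  by apply: ler_sum => s _; rewrite xbarE; have /andP[] := dphi_bounds (cnt_le X s).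
split.
  apply: (@le_trans _ _ (q.-1%:R * (dphi k.+1 * count_weight k.+1))).
    rewrite [leLHS](_ : _ = q.-1%:R * ((expR (- (beta * p%:R)) * (k.+1%:R / N%:R)) * count_weight k.+1));
      last by rewrite !mulrA.
    by rewrite ler_wpM2l// ler_wpM2r.
  rewrite E -mulrA ler_wpM2l ?expR_ge0// [leRHS]mulr_sumr; apply: ler_sum => X Xk.
  by rewrite mulrC ler_wpM2r ?(ltW (weight_gt0 _ _ _ _ _))//; have /andP[] := S _ Xk.
apply: (@le_trans _ _ (q.-1%:R * (dphi k.+1 * count_weight k.+1))); last first.
  by rewrite -[leRHS]mulrA ler_wpM2l// ler_wpM2r.
rewrite E -!(mulrA (expR h)) ler_wpM2l ?expR_ge0// [leLHS]mulr_sumr; apply: ler_sum => X Xk.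
by rewrite mulrC ler_wpM2l ?(ltW (weight_gt0 _ _ _ _ _))//; have /andP[] := S _ Xk.
Qed.

Local Notation slack := (beta * p%:R * p.-1%:R).

Let slack_ge0 : 0 <= slack.
Proof. by rewrite mulr_ge0// mulr_ge0// ltW. Qed.

(** The map [phif] is increasing near the common value [b] of the colours
    without field, so that the integration by parts formula controls the
    spread of two of these colours. *)
Lemma pair_spread (c b rho : R) (bad : pred config) k r s :
  0 <= c ->
  (forall x y, `|x - b| < rho -> `|y - b| < rho ->
     c * (x - y) ^+ 2 <= (phif x - phif y) * (x - y)) ->
  (forall X, ~~ bad X -> forall r, r != c1 -> `|xbar X 0 r - b| < rho) ->
  r != s -> r != c1 -> s != c1 ->
  c * \sum_(X : config | cnt X c1 == k) weight X * (xbar X 0 r - xbar X 0 s) ^+ 2 <=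
  (2 + slack) / N%:R * count_weight k +
    (c + 1) * \sum_(X : config | (cnt X c1 == k) && bad X) weight X.
Proof.
move=> c0 mono good rs r1 s1.
have w0 X : 0 <= weight X by exact/ltW/weight_gt0.
have d01 X t : 0 <= dphi (cnt X t) <= 1.
  have /andP[B1 B2] := dphi_bounds (cnt_le X t); rewrite (le_trans _ B1)/=; last first.
    by rewrite mulr_ge0 ?expR_ge0// divr_ge0.
  by rewrite (le_trans B2)// -xbarE xbar_le1.
have x01 X t : 0 <= (xbar X 0 t : R) <= 1 by rewrite xbar_ge0 xbar_le1.
apply: (@le_trans _ _ (\sum_(X : config | cnt X c1 == k)
   (weight X * ((dphi (cnt X r) - dphi (cnt X s)) * (xbar X 0 r - xbar X 0 s)) +
    slack / N%:R * weight X + (c + 1) * (weight X * (bad X)%:R)))); last first.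
  rewrite !big_split/= (pair_identity _ _ _ _ _ rs r1 s1)// -!mulr_sumr.
  rewrite (_ : \sum_(X : config | _) weight X * (bad X)%:R =
    \sum_(X : config | (cnt X c1 == k) && bad X) weight X); last first.
    rewrite [RHS]big_mkcondr/=; apply: eq_bigr => X _.
    by case: (bad X); rewrite ?mulr1 ?mulr0.
  rewrite lerD2r [X in _ <= X * _]mulrDl [leRHS]mulrDl /count_weight lerD2r; apply: ler_wpM2l; first by rewrite divr_ge0.
  by apply: ler_sum => X _; rewrite ler_piMr//; have /andP[] := d01 X s.
rewrite mulr_sumr; apply: ler_sum => X _.
rewrite mulrCA.
rewrite [leRHS](_ : _ = weight X * ((dphi (cnt X r) - dphi (cnt X s)) *
  (xbar X 0 r - xbar X 0 s) + slack / N%:R + (c + 1) * (bad X)%:R)); last by ring.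
rewrite ler_wpM2l//.
have /andP[dr0 dr1] := d01 X r; have /andP[ds0 ds1] := d01 X s.
have /andP[xr0 xr1] := x01 X r; have /andP[xs0 xs1] := x01 X s.
have sN : 0 <= slack / N%:R by rewrite divr_ge0.
have [bX|gX] := boolP (bad X).
  rewrite mulr1; set d := dphi _ - _; set x := xbar _ _ _ - _.
  have dle : -1 <= d <= 1 by apply/andP; split; rewrite /d; lra.
  have xle : -1 <= x <= 1 by apply/andP; split; rewrite /x; lra.
  have x21 : x ^+ 2 <= 1 by move: xle; nra.
  have : c * x ^+ 2 <= c by rewrite ler_piMr.
  have : -1 <= d * x by nra.
  by move=> h1 h2; move: sN h1 h2; move: (slack / N%:R) => S; nra.
rewrite mulr0 addr0; apply: (le_trans (mono _ _ (good X gX r r1) (good X gX s s1))).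
have /andP[pr0 pr1] := dphi_phif (cnt_le X r); have /andP[ps0 ps1] := dphi_phif (cnt_le X s).
rewrite -!xbarE in pr0 pr1 ps0 ps1.
move: pr0 pr1 ps0 ps1 sN; move: (slack / N%:R) (phif _) (phif _) (dphi _) (dphi _).
move=> S f1 f2 d1 d2 h1 h2 h3 h4 S0.
set x := xbar X 0 r in xr0 xr1 *; set y := xbar X 0 s in xs0 xs1 *.
have e1 : - S <= d1 - d2 - (f1 - f2) by lra.
have e2 : d1 - d2 - (f1 - f2) <= S by lra.
have : (d1 - d2 - (f1 - f2)) * (x - y) >= - S by nra.
by nra.
Qed.

Lemma sum_sqr_mean (I : finType) (P : pred I) (x : I -> R) (z : R) m :
  (forall c : R, \sum_(i | P i) c = m * c) ->
  0 < m ->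
  \sum_(i | P i) (x i - (\sum_(i | P i) x i) / m) ^+ 2 <= \sum_(i | P i) (x i - z) ^+ 2.
Proof.
move=> sc m0; set S := \sum_(i | P i) x i; set y := S / m.
have -> : \sum_(i | P i) (x i - z) ^+ 2 =
    \sum_(i | P i) (x i - y) ^+ 2 + 2 * (y - z) * (S - m * y) + m * (y - z) ^+ 2.
  rewrite -(sc y) -(sc ((y - z) ^+ 2)) /S -sumrB mulr_sumr -!big_split/=.
  by apply: eq_bigr => i _; ring.
rewrite -addrA lerDl /y (mulrC m) divfK ?gt_eqF// subrr mulr0 add0r.
by rewrite mulr_ge0 ?sqr_ge0// ltW.
Qed.

Let m_gt0 : 0 < (q.-1%:R : R). Proof. by rewrite ltr0n -subn1 subn_gt0. Qed.

Let sum_cst (c : R) : \sum_(s : 'I_q | s != c1) c = q.-1%:R * c.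
Proof.
rewrite -card_neq1 mulr_natl -sumr_const; apply: eq_bigl => s.
by rewrite inE.
Qed.

Let c2 : 'I_q := Ordinal q_gt1.

Definition rest k : R := (1 - k%:R / N%:R) / q.-1%:R.

(** Under the law conditioned on a count [k] of colour 1, this is the total
    variance of the other proportions, times the weight of [k]. *)
Definition spread k : R :=
  \sum_(X : config | cnt X c1 == k) weight X *
    \sum_(s | s != c1) (xbar X 0 s - rest k) ^+ 2.

Let mean_rest X k : cnt X c1 == k -> (\sum_(s | s != c1) xbar X 0 s) / q.-1%:R = rest k.
Proof. by move=> /eqP Xk; rewrite sum_xbar_neq1 xbarE Xk. Qed.

Lemma spread_two k : q = 2%N -> spread k = 0.
Proof.
move=> q2; rewrite /spread big1// => X Xk; rewrite -(mean_rest Xk).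
have uni s : s != c1 -> s = c2.
  move=> s1; apply/val_inj => /=; have := ltn_ord s; rewrite {2}q2.
  by case: s s1 => [[|[|s]]] //= i; rewrite -val_eqE.
rewrite (_ : q.-1%:R = 1) ?q2// divr1.
have S (g : 'I_q -> R) : \sum_(s | s != c1) g s = g c2.
  rewrite (bigD1 c2)//= big1 ?addr0// => s /andP[/uni -> ]; by rewrite eqxx.
by rewrite !S subrr expr0n mulr0.
Qed.

Lemma spread_le (c b rho : R) (bad : pred config) k :
  0 <= c ->
  (forall x y, `|x - b| < rho -> `|y - b| < rho ->
     c * (x - y) ^+ 2 <= (phif x - phif y) * (x - y)) ->
  (forall X, ~~ bad X -> forall r, r != c1 -> `|xbar X 0 r - b| < rho) ->
  c * spread k <= q.-1%:R * ((2 + slack) / N%:R * count_weight k +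
    (c + 1) * \sum_(X : config | (cnt X c1 == k) && bad X) weight X).
Proof.
move=> c0 mono good.
have w0 X : 0 <= weight X by exact/ltW/weight_gt0.
apply: (@le_trans _ _ (\sum_(s | s != c1) c * \sum_(X : config | cnt X c1 == k)
    weight X * (xbar X 0 s - xbar X 0 c2) ^+ 2)).
  rewrite -mulr_sumr ler_wpM2l// exchange_big/=; apply: ler_sum => X Xk.
  rewrite -mulr_sumr ler_wpM2l// -(mean_rest Xk).
  exact: sum_sqr_mean.
rewrite -sum_cst; apply: ler_sum => s s1.
have [->|sc] := eqVneq s c2; last exact: (pair_spread k c0 mono good sc s1 isT).
rewrite big1; last by move=> X _; rewrite subrr expr0n mulr0.
rewrite mulr0 addr_ge0// mulr_ge0 ?count_weight_ge0//.
- by rewrite divr_ge0// addr_ge0.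
- by rewrite addr_ge0.
- by rewrite sumr_ge0.
Qed.

(** The terms of first order cancel because the proportions of the colours
    without field have the fixed mean [rest k]. *)
Lemma count_weight_rec_phif (phi1 : R -> R) (C : R) k : (k <= N)%N -> 0 <= C ->
  (forall x y, 0 <= x <= 1 -> 0 <= y <= 1 ->
     `|phif x - phif y - phi1 y * (x - y)| <= C * (x - y) ^+ 2) ->
  `|q.-1%:R * (dphi k.+1 * count_weight k.+1) - expR h * (q.-1%:R * phif (rest k) * count_weight k)| <=
  expR h * (q.-1%:R * slack / N%:R * count_weight k + C * spread k).
Proof.
move=> kN C0 T; rewrite count_weight_rec_avg -mulrBr normrM ger0_norm ?expR_ge0//.
rewrite ler_wpM2l ?expR_ge0// /count_weight /spread !mulr_sumr -sumrB -big_split/=.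
apply: (le_trans (ler_norm_sum _ _ _)); apply: ler_sum => X Xk.
have w0 : 0 <= weight X by exact/ltW/weight_gt0.
have kN1 : (k%:R / N%:R : R) <= 1 by rewrite ler_pdivrMr// mul1r ler_nat.
have y01 : 0 <= rest k <= 1.
  rewrite /rest; apply/andP; split; first by rewrite divr_ge0 ?subr_ge0.
  rewrite ler_pdivrMr// mul1r.
  have : (1 : R) <= q.-1%:R by rewrite ler1n -subn1 subn_gt0.
  have : 0 <= (k%:R / N%:R : R) by rewrite divr_ge0.
  lra.
rewrite (mulrC (q.-1%:R * _)) -mulrBr normrM ger0_norm//.
rewrite (mulrC (_ / _)) (mulrCA C) -mulrDr ler_wpM2l//.
have -> : \sum_(s | s != c1) dphi (cnt X s) - q.-1%:R * phif (rest k) =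
  \sum_(s | s != c1) ((dphi (cnt X s) - phif (xbar X 0 s)) +
     (phif (xbar X 0 s) - phif (rest k) - phi1 (rest k) * (xbar X 0 s - rest k))).
  have : phi1 (rest k) * \sum_(s | s != c1) (xbar X 0 s - rest k) = 0.
    rewrite sumrB sum_cst -(mean_rest Xk) (mulrC q.-1%:R) divfK ?gt_eqF//.
    by rewrite subrr mulr0.
  rewrite mulr_sumr => E; rewrite -[LHS]subr0 -[X in _ - X]E -sum_cst -!sumrB.
  by apply: eq_bigr => s _; ring.
apply: (le_trans (ler_norm_sum _ _ _)).
rewrite -!mulrA -sum_cst mulr_sumr -big_split/=; apply: ler_sum => s s1.
apply: (le_trans (ler_normD _ _)); apply: lerD.
  have /andP[p1 p2] := dphi_phif (cnt_le X s); rewrite xbarE.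
  by rewrite ger0_norm ?subr_ge0// lerBlDl !mulrA.
by apply: T => //; rewrite xbar_ge0 xbar_le1.
Qed.

End window_estimates.
(** * Uniform gap around a unique maximizer *)

Lemma cvg_rsum {R : realType} {T : Type} (F : set_system T) {I : Type}
    (r : seq I) (P : pred I) (u : I -> T -> R) (l : I -> R) : Filter F ->
  (forall i, P i -> u i x @[x --> F] --> l i) ->
  \sum_(i <- r | P i) u i x @[x --> F] --> \sum_(i <- r | P i) l i.
Proof.
move=> FF; apply: (@cvg_big R I (@GRing.add R) 0 P _ T F r u l FF).
exact: (@add_continuous R).
Qed.

Section gap.
Context {R : realType}.

Lemma continuous_xlnx : continuous (fun x : R => x * ln x).
Proof.
move=> x; have [x0|x0|->] := ltgtP x 0.
- have E : {near x, (fun=> 0) =1 (fun x : R => x * ln x)}.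
    by near=> y; rewrite ln0 ?mulr0//; apply/ltW; near: y; exact: lt_nbhsl.
  rewrite /continuous_at [X in _ --> X](_ : _ = 0); last by rewrite ln0 ?mulr0// ltW.
  by apply: cvg_trans (near_eq_cvg E) _; exact: cvg_cst.
- by apply: cvgM => //; exact: continuous_ln.
rewrite /continuous_at mul0r; apply/cvgrPdist_le => e e0.
have e2 : 0 < (e / 2) ^+ 2 by rewrite exprn_gt0// divr_gt0.
near=> y; rewrite sub0r normrN.
have [y0|y0] := leP y 0; first by rewrite ln0// mulr0 normr0 ltW.
have y1 : y < 1 by near: y; exact: lt_nbhsl.
have ye : y < (e / 2) ^+ 2 by near: y; exact: lt_nbhsl.
(* [y ln y = 2 z (z ln z)], where [z ln z] stays bounded. *)
set z := Num.sqrt y; have z0 : 0 < z by rewrite sqrtr_gt0.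
have zy : z ^+ 2 = y by rewrite sqr_sqrtr// ltW.
have ze : z < e / 2.
  by rewrite -(@ltr_pXn2r _ 2)// ?nnegrE ?ltW// ?divr_gt0// zy.
have lnz : ln z^-1 < z^-1 by rewrite ln_sublinear// invr_gt0.
rewrite lnV ?posrE// in lnz.
rewrite normrM gtr0_norm// ler0_norm ?(ln_le0 (ltW y1))//.
rewrite -zy lnXn//.
apply: (@le_trans _ _ (z ^+ 2 * (2 * z^-1))).
  by rewrite ler_wpM2l ?sqr_ge0//; move: lnz; move: (z^-1) (ln z) => u w; lra.
rewrite mulrCA expr2 -mulrA divff ?gt_eqF// mulr1; lra.
Unshelve. all: by end_near. Qed.

Context (p q : nat) (q_gt1 : (1 < q)%N) (beta h : R).

Lemma continuous_Hfun : continuous (Hfun p q_gt1 beta h : 'rV[R]_q -> R).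
Proof.
move=> t.
have FF : Filter (nbhs t) := nbhs_filter t.
have H r : {for t, continuous (fun u : 'rV[R]_q => u 0 r)} := @coord_continuous _ _ _ 0 r t.
have H1 : {for t, continuous (fun u : 'rV[R]_q => beta * (\sum_(r < q) u 0 r ^+ p))}.
  apply: cvgM; first exact: cvg_cst.
  apply: cvg_rsum => r _.
  exact: (@continuous_comp _ _ _ (fun u : 'rV[R]_q => u 0 r) (fun z : R => z ^+ p) t (H r)
    (@exprn_continuous _ p _)).
have H2 : {for t, continuous (fun u : 'rV[R]_q => h * u 0 (color1 q_gt1))}.
  by apply: cvgM; [exact: cvg_cst|exact: H].
have H3 : {for t, continuous (fun u : 'rV[R]_q => \sum_(r < q) u 0 r * ln (u 0 r))}.
  apply: cvg_rsum => r _.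
  exact: (@continuous_comp _ _ _ (fun u : 'rV[R]_q => u 0 r) (fun z : R => z * ln z) t (H r)
    (@continuous_xlnx _)).
exact: (cvgB (cvgD H1 H2) H3).
Qed.

Lemma compact_prob_vectors : compact (@prob_vectors R q).
Proof.
have cbox := @rV_compact R q (fun=> `[0%R, 1%R]%classic) (fun=> @segment_compact R 0 1).
apply: subclosed_compact cbox _.
  rewrite (_ : (@prob_vectors R q) = (\bigcap_r [set t : 'rV[R]_q | 0 <= t 0 r]) `&`
     [set t : 'rV[R]_q | \sum_(r < q) t 0 r = 1]); last first.
    apply/seteqP; split => [t [t0 t1]|t [t0 t1]]; split => // r.
      by move=> _; exact: t0.
    exact: t0.
  apply: closedI.
    apply: closed_bigI => r _.
    apply: (@preimage_closed _ _ (fun t : 'rV[R]_q => t 0 r) [set x | 0 <= x]).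
      by move=> t _; exact: coord_continuous.
    exact: closed_ge.
  apply: (@preimage_closed _ _ (fun t : 'rV[R]_q => \sum_(r < q) t 0 r) [set 1]).
    move=> t _; have FF : Filter (nbhs t) := nbhs_filter t.
    by apply: cvg_rsum => r _; exact: coord_continuous.
  exact: closed_eq.
move=> t [t0 t1] r /=; rewrite in_itv/= t0/= -t1 (bigD1 r)//= lerDl.
by rewrite sumr_ge0.
Qed.

(** By compactness, a unique maximizer leaves a uniform gap away from it. *)
Lemma maximizer_gap (v : 'rV[R]_q) (rho : R) : 0 < rho ->
  unique_maximizer p q_gt1 beta h v ->
  exists2 eta, 0 < eta & forall t, (@prob_vectors R q) t ->
    (exists r, rho <= `|t 0 r - v 0 r|) ->
    Hfun p q_gt1 beta h t <= Hfun p q_gt1 beta h v - eta.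
Proof.
move=> rho0 [vP vmax].
have key r : \forall eta \near 0^'+, forall t, (@prob_vectors R q) t ->
    rho <= `|t 0 r - v 0 r| ->
    Hfun p q_gt1 beta h t <= Hfun p q_gt1 beta h v - eta.
  pose K := (@prob_vectors R q) `&` [set t : 'rV[R]_q | rho <= `|t 0 r - v 0 r|].
  have cK : compact K.
    apply: subclosed_compact compact_prob_vectors _; last by move=> t [].
    apply: closedI; first by apply: compact_closed; [exact: norm_hausdorff|exact: compact_prob_vectors].
    apply: (@preimage_closed _ _ (fun t : 'rV[R]_q => `|t 0 r - v 0 r|) [set x | rho <= x]).
      move=> t _; have FF : Filter (nbhs t) := nbhs_filter t.
      apply: cvg_norm; apply: cvgB; last exact: cvg_cst.
      exact: coord_continuous.
    exact: closed_ge.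
  have [K0|/set0P K0] := eqVneq K set0.
    near=> eta => t tP tr; suff : K t by rewrite K0.
    by split.
  have [|u uK umax] := EVT_max_rV (f := Hfun p q_gt1 beta h) K0 cK.
    by apply: continuous_subspaceT => t; exact: continuous_Hfun.
  have {}uK : K u by rewrite -in_setE.
  have uv : Hfun p q_gt1 beta h u < Hfun p q_gt1 beta h v.
    apply: vmax; first by case: uK.
    by case: uK => _ /= + uv; rewrite uv subrr normr0 leNgt rho0.
  near=> eta => t tP tr; have := umax t; rewrite in_setE => /(_ (conj tP tr)) Hu.
  apply: (le_trans Hu); rewrite lerBrDr -lerBrDl.
  near: eta; apply: nbhs_right_le; rewrite subr_gt0//.
near (0 : R)^'+ => eta; exists eta; first by near: eta; exact: nbhs_right_gt.
move=> t tP [r]; suff H : forall r t, (@prob_vectors R q) t ->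
    rho <= `|t 0 r - v 0 r| -> Hfun p q_gt1 beta h t <= Hfun p q_gt1 beta h v - eta.
  exact: H.
by near: eta; apply: filter_forall.
Unshelve. all: by end_near. Qed.

End gap.
(** * Concentration near the maximizer *)

Lemma telescope_dist {R : realType} (u : nat -> R) (c : R) (P : nat -> Prop) :
  (forall l, P l -> P l.+1 -> `|u l.+1 - u l| <= c) ->
  (forall i j l, P i -> P j -> (i <= l <= j)%N -> P l) ->
  forall i j, P i -> P j -> `|u j - u i| <= c * `|j%:R - i%:R|.
Proof.
move=> step conv.
have key i n : P i -> P (i + n)%N -> `|u (i + n)%N - u i| <= c * n%:R.
  elim: n => [|n IHn] Pi Pin; first by rewrite addn0 subrr normr0 mulr0.
  have Pn : P (i + n)%N.
    by apply: (conv _ _ _ Pi Pin); rewrite leq_addr addnS leqnSn.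
  rewrite addnS [leRHS](_ : _ = c + c * n%:R); last by rewrite -natr1; ring.
  have -> : u (i + n).+1 - u i = (u (i + n).+1 - u (i + n)%N) + (u (i + n)%N - u i).
    by rewrite addrA subrK.
  apply: (le_trans (ler_normD _ _)); apply: lerD; last exact: IHn.
  by apply: step => //; rewrite -addnS.
move=> i j Pi Pj; have [ij|/ltnW ji] := leqP i j.
  rewrite -natrB// normr_nat; have := key i (j - i)%N Pi; rewrite subnKC//.
  exact.
rewrite distrC [`|_%:R - _|]distrC -natrB// normr_nat.
have := key j (i - j)%N Pj; rewrite subnKC//; exact.
Qed.

Lemma poly_le_expR {R : realType} (n : nat) (C eta : R) : 0 < eta ->
  \forall N \near \oo, C * N.+1%:R ^+ n <= expR (eta * N%:R).
Proof.
move=> eta0; pose c := Num.min 1 (eta / n.+1%:R).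
have c0 : 0 < c by rewrite lt_min ltr01 divr_gt0.
near=> N.
have N1 : C <= N.+1%:R * c ^+ n.+1.
  rewrite -ler_pdivrMr ?exprn_gt0//.
  apply: (@le_trans _ _ N%:R); last by rewrite ler_nat.
  by near: N; exact: nbhs_infty_ger.
have -> : eta * N%:R = n.+1%:R * (eta / n.+1%:R * N%:R).
  by rewrite mulrA mulrCA divff ?mulr1// pnatr_eq0.
rewrite expRM_natl.
apply: (@le_trans _ _ ((c * N.+1%:R) ^+ n.+1)).
  rewrite [leRHS](_ : _ = (N.+1%:R * c ^+ n.+1) * N.+1%:R ^+ n).
    by rewrite ler_wpM2r// exprn_ge0.
  by rewrite exprMn !(exprS _ n); ring.
rewrite lerXn2r ?nnegrE ?expR_ge0//; first by rewrite mulr_ge0// ltW.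
apply: le_trans (expR_ge1Dx _).
rewrite -natr1 mulrDr mulr1 addrC lerD//; first by rewrite ge_min lexx.
by rewrite ler_wpM2r// ge_min lexx orbT.
Unshelve. all: by end_near. Qed.

Section concentration.
Context {R : realType} (p q : nat) (p_gt1 : (1 < p)%N) (q_gt1 : (1 < q)%N).
Variables (beta h : R).
Hypotheses (beta_gt0 : 0 < beta).
Local Notation c1 := (color1 q_gt1).
Local Notation weight := (potts_weight p q_gt1 beta h).
Local Notation count_weight := (count_weight p q_gt1 beta h).
Variables (v : 'rV[R]_q) (a b : R).
Hypotheses (va : v 0 c1 = a) (vb : forall r, r != c1 -> v 0 r = b).
Hypotheses (a_gt0 : 0 < a) (b_gt0 : 0 < b) (ab1 : a + q.-1%:R * b = 1).
Hypothesis crit : beta * p%:R * a ^+ p.-1 + h - ln a = beta * p%:R * b ^+ p.-1 - ln b.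
Hypothesis vmax : unique_maximizer p q_gt1 beta h v.
Local Notation H0 := (Hfun p q_gt1 beta h v).

Let m_ge1 : 1 <= (q.-1%:R : R). Proof. by rewrite ler1n -subn1 subn_gt0. Qed.
Let m_gt0 : 0 < (q.-1%:R : R). Proof. exact: lt_le_trans m_ge1. Qed.
Let a_lt1 : a < 1. Proof. by rewrite -ab1 ltrDl mulr_gt0. Qed.

Lemma partition_low N : (0 < N)%N ->
  expR (N%:R * H0) <= \sum_(X : {ffun 'I_N -> 'I_q}) weight X.
Proof.
move=> N0.
apply: (@partition_ge R p q q_gt1 beta h N N0 beta_gt0 v (beta * p%:R * b ^+ p.-1 - ln b)).
- by move=> r; have [->|/vb ->] := eqVneq r c1; rewrite ?va.
- by case: vmax => -[].
- move=> r; rewrite /field_at; have [->|r1] := eqVneq r c1.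
    by rewrite va -crit.
  by rewrite vb// addr0.
Qed.

Definition far (rho : R) N (X : {ffun 'I_N -> 'I_q}) : bool :=
  [exists r, rho <= `|xbar X 0 r - v 0 r|].

(** The gap in [Hfun] beats the polynomial number of types. *)
Lemma sum_far rho : 0 < rho -> exists2 eta, 0 < eta &
  \forall N \near \oo,
    \sum_(X : {ffun 'I_N -> 'I_q} | far rho X) weight X <= expR (N%:R * (H0 - eta)).
Proof.
move=> rho0; have [eta eta0 gap] := maximizer_gap rho0 vmax.
exists (eta / 2); first by rewrite divr_gt0.
have e2 : 0 < eta / 2 by rewrite divr_gt0.
near=> N.
have N0 : (0 < N)%N by near: N; exact: nbhs_infty_gt.
apply: (le_trans (@sum_weight_le R p q q_gt1 beta h N N0 (@far rho N) (H0 - eta) _)).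
  move=> X /existsP[r Xr]; apply: gap; first exact: xbar_prob_vectors.
  by exists r.
have : 1 * N.+1%:R ^+ q <= expR (eta / 2 * N%:R) by near: N; exact: poly_le_expR.
rewrite mul1r => H; apply: (@le_trans _ _ (expR (eta / 2 * N%:R) * expR (N%:R * (H0 - eta)))).
  by rewrite ler_wpM2r ?expR_ge0.
by rewrite -expRD ler_expR le_eqVlt; apply/orP; left; apply/eqP; field.
Unshelve. all: by end_near. Qed.

Definition near_a (e : R) N k := `|k%:R / N%:R - a| <= e.

Lemma near_a_conv e N i j l : near_a e N i -> near_a e N j -> (i <= l <= j)%N ->
  near_a e N l.
Proof.
rewrite /near_a => Hi Hj /andP[il lj]; move: Hi Hj; rewrite !ler_distl.
move=> /andP[i1 i2] /andP[j1 j2]; apply/andP; split.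
  by apply: (le_trans i1); rewrite ler_wpM2r ?invr_ge0// ler_nat.
by apply: le_trans j2; rewrite ler_wpM2r ?invr_ge0// ler_nat.
Qed.

Definition margin := Num.min a (1 - a) / 2.

Lemma margin_gt0 : 0 < margin.
Proof. by rewrite divr_gt0// lt_min a_gt0 subr_gt0 a_lt1. Qed.

Lemma near_a_bounds e N k : e <= margin -> near_a e N k ->
  margin <= k%:R / N%:R <= 1 - margin.
Proof.
rewrite /near_a ler_distl => ew /andP[k1 k2].
have H1 : margin * 2 <= a by rewrite /margin divfK// ge_min lexx.
have H2 : margin * 2 <= 1 - a by rewrite /margin divfK// ge_min lexx orbT.
by apply/andP; split; lra.
Qed.

Lemma near_a_le e N k : e <= margin -> near_a e N k -> (0 < N)%N -> (k < N)%N.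
Proof.
move=> ew kN N0; have /andP[_] := near_a_bounds ew kN.
have := margin_gt0 => margin0 H; have : (k%:R / N%:R : R) < 1 by lra.
by rewrite ltr_pdivrMr ?ltr0n// mul1r ltr_nat.
Qed.

Lemma ln_count_weight_step : exists2 L, 0 <= L & forall N k, (0 < N)%N ->
  near_a margin N k -> near_a margin N k.+1 -> `|ln (count_weight N k.+1) - ln (count_weight N k)| <= L.
Proof.
have margin0 := margin_gt0.
pose K1 := expR h * expR (beta * p%:R) / (q.-1%:R * margin).
pose K2 := q.-1%:R * expR (beta * p%:R) / (expR h * margin).
have mw0 : 0 < q.-1%:R * margin by exact: mulr_gt0.
have hw0 : 0 < expR h * margin by apply: mulr_gt0 => //; exact: expR_gt0.
have K10 : 0 < K1 by apply: divr_gt0 => //; apply: mulr_gt0; exact: expR_gt0.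
have K20 : 0 < K2 by apply: divr_gt0 => //; apply: mulr_gt0 => //; exact: expR_gt0.
exists (`|ln K1| + `|ln K2|); first by rewrite addr_ge0.
move=> N k N0 k0 k1.
have kN := near_a_le (lexx _) k0 N0.
have /andP[a1 a2] := near_a_bounds (lexx _) k0.
have /andP[b1 b2] := near_a_bounds (lexx _) k1.
have [S1 S2] := count_weight_step p_gt1 q_gt1 h N0 beta_gt0 kN.
have W0 := count_weight_gt0 p q_gt1 beta h (ltnW kN).
have W1 := count_weight_gt0 p q_gt1 beta h kN.
have e0 := expR_gt0 (beta * p%:R); have eh := expR_gt0 h.
rewrite expRN in S1 S2.
move: S1 S2 a1 a2 b1 b2; move: (k%:R / N%:R) (k.+1%:R / N%:R) => x y S1 S2 a1 a2 b1 b2.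
have U1 : count_weight N k.+1 <= K1 * count_weight N k.
  rewrite /K1 mulrAC ler_pdivlMr//.
  have T : q.-1%:R * (expR (beta * p%:R))^-1 * margin * count_weight N k.+1 <= expR h * count_weight N k.
    apply: (@le_trans _ _ (q.-1%:R / expR (beta * p%:R) * y * count_weight N k.+1)).
      by rewrite ler_wpM2r ?(ltW W1)// ler_wpM2l// divr_ge0 ?expR_ge0.
    apply: (le_trans S1); rewrite ler_wpM2r ?(ltW W0)// ler_piMr ?(ltW eh)//.
    lra.
  move: T; rewrite -(@ler_pM2r _ (expR (beta * p%:R)))//.
  have -> : q.-1%:R / expR (beta * p%:R) * margin * count_weight N k.+1 * expR (beta * p%:R) =
    count_weight N k.+1 * (q.-1%:R * margin) by field; rewrite gt_eqF.
  by move=> T; apply: (le_trans T); rewrite mulrAC.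
have U2 : count_weight N k <= K2 * count_weight N k.+1.
  rewrite /K2 mulrAC ler_pdivlMr//.
  have T : expR h * (expR (beta * p%:R))^-1 * margin * count_weight N k <= q.-1%:R * count_weight N k.+1.
    apply: (@le_trans _ _ (expR h / expR (beta * p%:R) * (1 - x) * count_weight N k)).
      by rewrite ler_wpM2r ?(ltW W0)// ler_wpM2l ?divr_ge0 ?expR_ge0//; lra.
    apply: (le_trans S2); rewrite ler_wpM2r ?(ltW W1)// ler_piMr ?(ltW m_gt0)//.
    lra.
  move: T; rewrite -(@ler_pM2r _ (expR (beta * p%:R)))//.
  have -> : expR h / expR (beta * p%:R) * margin * count_weight N k * expR (beta * p%:R) =
    count_weight N k * (expR h * margin) by field; rewrite gt_eqF.
  by move=> T; apply: (le_trans T); rewrite mulrAC.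
have V1 : ln (count_weight N k.+1) - ln (count_weight N k) <= ln K1.
  by rewrite lerBlDr -lnM ?posrE// ler_ln ?posrE ?(mulr_gt0 K10 W0).
have V2 : ln (count_weight N k) - ln (count_weight N k.+1) <= ln K2.
  by rewrite lerBlDr -lnM ?posrE// ler_ln ?posrE ?(mulr_gt0 K20 W1).
have := ler_norm (ln K1); have := ler_norm (ln K2).
have := normr_ge0 (ln K1); have := normr_ge0 (ln K2).
by rewrite ler_norml => *; apply/andP; split; lra.
Qed.

Lemma sum_weight_split e N : (0 < N)%N ->
  \sum_(X : {ffun 'I_N -> 'I_q}) weight X <=
  \sum_(X : {ffun 'I_N -> 'I_q} | far e X) weight X +
  \sum_(k < N.+1 | near_a e N k) count_weight N k.
Proof.
move=> N0; rewrite [X in _ <= _ + X]big_mkcond/=.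
rewrite (eq_bigr (fun k : 'I_N.+1 => count_weight N k * (near_a e N k)%:R)); last first.
  by move=> k _; case: ifP; rewrite ?mulr1 ?mulr0.
rewrite -(@sum_count_weight R p q q_gt1 beta h N (fun k => (near_a e N k)%:R)).
rewrite [X in X + _]big_mkcond/= -big_split/=; apply: ler_sum => X _.
have margin := ltW (weight_gt0 p q_gt1 beta h X).
case: ifPn => [_|/existsPn/(_ c1)].
  by rewrite lerDl mulr_ge0.
by rewrite -ltNge va xbarE /near_a => /ltW ->; rewrite mulr1 add0r.
Qed.

(** Since the far configurations carry a negligible part of the total weight,
    some count in the window is heavy; by [ln_count_weight_step] the weights of the other
    counts in a window of width [e] differ from it by a factor at most
    [expR (2 e L N)]. *)
Lemma count_weight_low eta : 0 < eta -> exists e, [/\ 0 < e, e <= margin &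
  \forall N \near \oo, forall k, near_a e N k ->
    expR (N%:R * (H0 - eta)) <= count_weight N k].
Proof.
move=> eta0; have [L L0 step] := ln_count_weight_step.
have margin0 := margin_gt0.
pose e := Num.min margin (eta / 2 / (2 * (L + 1))).
have L1 : 0 < L + 1 by rewrite ltr_wpDl.
have e0 : 0 < e.
  by rewrite lt_min margin0/= divr_gt0 ?mulr_gt0// divr_gt0.
have ew : e <= margin by rewrite ge_min lexx.
have eL : 2 * e * L <= eta / 2.
  apply: (@le_trans _ _ (2 * e * (L + 1))); first by rewrite ler_wpM2l ?lerDl// mulr_ge0// ltW.
  rewrite mulrAC -ler_pdivlMl ?mulr_gt0// mulrC /e ge_min; apply/orP; right.
  by rewrite mulrC.
exists e; split => //.
have [eta' eta'0 farP] := sum_far e0.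
have e2 : 0 < eta / 2 by rewrite divr_gt0.
near=> N => k kN.
have N0 : (0 < N)%N by near: N; exact: nbhs_infty_gt.
have NR0 : 0 < (N%:R : R) by rewrite ltr0n.
have [k' k'N wk'] : exists2 k', near_a e N k' & expR (N%:R * (H0 - eta / 2)) <= count_weight N k'.
  apply: contrapT => none.
  have none' k' : near_a e N k' -> count_weight N k' <= expR (N%:R * (H0 - eta / 2)).
    move=> k'N; rewrite leNgt; apply/negP => lt; apply: none; exists k' => //.
    exact: ltW.
  have := partition_low N0; rewrite leNgt => /negP; apply.
  apply: (le_lt_trans (sum_weight_split e N0)).
  have F : \sum_(X : {ffun 'I_N -> 'I_q} | far e X) weight X <= expR (N%:R * (H0 - eta')).
    by near: N; exact: farP.
  have G : \sum_(k < N.+1 | near_a e N k) count_weight N k <=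
      N.+1%:R * expR (N%:R * (H0 - eta / 2)).
    apply: (@le_trans _ _ (\sum_(k < N.+1) expR (N%:R * (H0 - eta / 2)))).
      rewrite big_mkcond/=; apply: ler_sum => i _; case: ifPn => [|_]; first exact: none'.
      exact: expR_ge0.
    by rewrite sumr_const card_ord -[leLHS]mulr_natl.
  apply: (le_lt_trans (lerD F G)).
  (* A quarter of the total for each of the two parts leaves a contradiction. *)
  have P1 : 4 * N.+1%:R ^+ 0 <= expR (eta' * N%:R) by near: N; exact: poly_le_expR.
  have P2 : 4 * N.+1%:R ^+ 1 <= expR (eta / 2 * N%:R) by near: N; exact: poly_le_expR.
  have E1 : expR (N%:R * H0) = expR (N%:R * (H0 - eta')) * expR (eta' * N%:R).
    by rewrite -expRD; congr expR; ring.
  have E2 : expR (N%:R * H0) = expR (N%:R * (H0 - eta / 2)) * expR (eta / 2 * N%:R).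
    by rewrite -expRD; congr expR; ring.
  have := expR_gt0 (N%:R * H0).
  have X1 : expR (N%:R * (H0 - eta')) * 4 <= expR (N%:R * H0).
    by rewrite E1 ler_wpM2l ?expR_ge0//; rewrite mulr1 in P1.
  have X2 : expR (N%:R * (H0 - eta / 2)) * (4 * N.+1%:R) <= expR (N%:R * H0).
    by rewrite E2 ler_wpM2l ?expR_ge0//; rewrite expr1 in P2.
  by move: X1 X2; lra.
have kk' : `|k%:R - k'%:R| <= 2 * e * N%:R :> R.
  move: kN k'N; rewrite /near_a !ler_distl !ler_pdivlMr// !ler_pdivrMr//.
  by move=> /andP[? ?] /andP[? ?]; apply/andP; split; lra.
have mono i : near_a e N i -> near_a margin N i by move/le_trans; apply.
have T : `|ln (count_weight N k) - ln (count_weight N k')| <= L * `|k%:R - k'%:R|.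
  apply: (telescope_dist (u := fun l => ln (count_weight N l)) (P := near_a margin N)); [|exact: near_a_conv|exact: mono|exact: mono].
  by move=> l l0 l1; exact: step.
have W : 0 < count_weight N k by apply: count_weight_gt0; exact/ltnW/(near_a_le ew kN).
have W' : 0 < count_weight N k' by apply: count_weight_gt0; exact/ltnW/(near_a_le ew k'N).
rewrite -[leRHS]lnK ?posrE// ler_expR.
have {}wk' : N%:R * (H0 - eta / 2) <= ln (count_weight N k').
  by rewrite -ler_expR lnK ?posrE.
have T2 : L * `|k%:R - k'%:R| <= eta / 2 * N%:R.
  apply: (@le_trans _ _ (L * (2 * e * N%:R))); first by rewrite ler_wpM2l.
  by rewrite mulrA [L * _]mulrC ler_wpM2r.
have := ler_norm (- (ln (count_weight N k) - ln (count_weight N k'))); rewrite normrN.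
by move: wk' T T2; lra.
Unshelve. all: by end_near. Qed.

(** Far configurations stay negligible under the law conditioned on any count in
    a small window, because their total weight is exponentially smaller than
    the lower bound [count_weight_low]. *)
Lemma cond_far rho : 0 < rho -> exists e, [/\ 0 < e, e <= margin &
  \forall N \near \oo, forall k, near_a e N k ->
    \sum_(X : {ffun 'I_N -> 'I_q} | (cnt X c1 == k) && far rho X) weight X <= count_weight N k / N%:R].
Proof.
move=> rho0; have [eta eta0 farP] := sum_far rho0.
have e2 : 0 < eta / 2 by rewrite divr_gt0.
have [e [e0 ew low]] := count_weight_low e2.
exists e; split => //; near=> N => k kN.
have N0 : (0 < N)%N by near: N; exact: nbhs_infty_gt.
have NR0 : 0 < (N%:R : R) by rewrite ltr0n.
apply: (@le_trans _ _ (\sum_(X : {ffun 'I_N -> 'I_q} | far rho X) weight X)).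
  rewrite [leRHS]big_mkcond/= [leLHS]big_mkcond/=; apply: ler_sum => X _.
  by case: (far rho X); rewrite ?andbF ?andbT//; case: ifP => // _; exact/ltW/weight_gt0.
have F : \sum_(X : {ffun 'I_N -> 'I_q} | far rho X) weight X <= expR (N%:R * (H0 - eta)).
  by near: N; exact: farP.
apply: (le_trans F); rewrite ler_pdivlMr//.
have Lo : expR (N%:R * (H0 - eta / 2)) <= count_weight N k.
  by move: (k) kN; near: N.
apply: le_trans Lo.
have P1 : 1 * N.+1%:R ^+ 1 <= expR (eta / 2 * N%:R) by near: N; exact: poly_le_expR.
have -> : expR (N%:R * (H0 - eta / 2)) = expR (N%:R * (H0 - eta)) * expR (eta / 2 * N%:R).
  by rewrite -expRD; congr expR; field.
rewrite ler_wpM2l ?expR_ge0//; apply: le_trans P1.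
by rewrite mul1r expr1 ler_nat.
Unshelve. all: by end_near. Qed.

End concentration.
(** * Profile of the weight of the count *)

Lemma ln_lipschitz {R : realType} (c u v : R) : 0 < c -> c <= u -> c <= v ->
  `|ln u - ln v| <= `|u - v| / c.
Proof.
move=> c0; have key (x y : R) : c <= x -> c <= y -> ln x - ln y <= `|x - y| / c.
  move=> cx cy; have x0 := lt_le_trans c0 cx; have y0 := lt_le_trans c0 cy.
  rewrite -ln_div ?posrE//.
  have -> : x / y = 1 + (x - y) / y by field; rewrite gt_eqF.
  apply: (@le_trans _ _ ((x - y) / y)).
    apply: le_ln1Dx; rewrite -subr_gt0 opprK.
    by rewrite (_ : _ + 1 = x / y) ?divr_gt0//; field; rewrite gt_eqF.
  apply: (@le_trans _ _ (`|x - y| / y)).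
    by rewrite ler_wpM2r ?invr_ge0 ?(ltW y0)// ler_norm.
  by rewrite ler_wpM2l// lef_pV2 ?posrE.
move=> cu cv; rewrite ler_norml key// andbT lerNl opprB distrC.
exact: key.
Qed.

Section increments.
Context {R : realType} (p q : nat) (p_gt1 : (1 < p)%N) (q_gt1 : (1 < q)%N).
Variables (beta h : R).
Hypotheses (beta_gt0 : 0 < beta).
Local Notation c1 := (color1 q_gt1).
Local Notation weight := (potts_weight p q_gt1 beta h).
Local Notation count_weight := (count_weight p q_gt1 beta h).
Local Notation phi := (phif p beta).

Definition phif1 (x : R) : R :=
  (1 - beta * p%:R * p.-1%:R * x ^+ p.-1) * expR (- (beta * p%:R * x ^+ p.-1)).

Definition phif2 (x : R) : R :=
  (- (beta * p%:R * p.-1%:R * (p.-1%:R * x ^+ p.-2))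
   - (1 - beta * p%:R * p.-1%:R * x ^+ p.-1) * (beta * p%:R * (p.-1%:R * x ^+ p.-2)))
  * expR (- (beta * p%:R * x ^+ p.-1)).

Let is_derive_gibbs (x : R) :
  is_derive x 1 (fun z : R => expR (- (beta * p%:R * z ^+ p.-1)))
    (expR (- (beta * p%:R * x ^+ p.-1)) * - (beta * p%:R * (p.-1%:R * x ^+ p.-2))).
Proof.
have D1 : is_derive x 1 (fun z : R => - (beta * p%:R * z ^+ p.-1))
     (- (beta * p%:R * (p.-1%:R * x ^+ p.-2))).
  have -> : (fun z : R => - (beta * p%:R * z ^+ p.-1)) =
     - ((beta * p%:R) \*: (fun z : R => z ^+ p.-1)) by [].
  exact: (is_deriveN (is_deriveZ _ (is_derive_pow _ _))).
exact: (is_derive1_comp (is_derive_expR _) D1).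
Qed.

Lemma is_derive_phif (x : R) : is_derive x 1 phi (phif1 x).
Proof.
have -> : phi = (@id R) * (fun z : R => expR (- (beta * p%:R * z ^+ p.-1))) by [].
apply: (is_derive_eq (is_deriveM (is_derive_id x 1) (is_derive_gibbs x))).
rewrite /GRing.scale/= /phif1.
have : x * x ^+ p.-2 = x ^+ p.-1 by move: p_gt1; case: (p) => [|[|p']]//= _; rewrite exprS.
by move=> <-; ring.
Qed.

Lemma is_derive_phif1 (x : R) : is_derive x 1 phif1 (phif2 x).
Proof.
have D1 : is_derive x 1 (fun z : R => 1 - beta * p%:R * p.-1%:R * z ^+ p.-1)
     (0 - beta * p%:R * p.-1%:R * (p.-1%:R * x ^+ p.-2)).
  have -> : (fun z : R => 1 - beta * p%:R * p.-1%:R * z ^+ p.-1) =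
     cst 1 - ((beta * p%:R * p.-1%:R) \*: (fun z : R => z ^+ p.-1)) by [].
  exact: (is_deriveB (is_derive_cst (1 : R) x 1) (is_deriveZ _ (is_derive_pow _ _))).
have -> : phif1 = (fun z : R => 1 - beta * p%:R * p.-1%:R * z ^+ p.-1) *
   (fun z : R => expR (- (beta * p%:R * z ^+ p.-1))) by [].
apply: (is_derive_eq (is_deriveM D1 (is_derive_gibbs x))).
by rewrite /GRing.scale/= /phif2; ring.
Qed.

Lemma phif_taylor : exists2 C, 0 <= C & forall x y, 0 <= x <= 1 -> 0 <= y <= 1 ->
  `|phi x - phi y - phif1 y * (x - y)| <= C * (x - y) ^+ 2.
Proof.
have c2 : continuous (fun x => `|phif2 x|).
  move=> x; apply: cvg_norm; apply: cvgM; last first.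
    apply: continuous_comp; last exact: continuous_expR.
    apply: cvgN; apply: cvgM; [exact: cvg_cst|exact: exprn_continuous].
  apply: cvgB.
    apply: cvgN; apply: cvgM; first exact: cvg_cst.
    by apply: cvgM; [exact: cvg_cst|exact: exprn_continuous].
  apply: cvgM.
    apply: cvgB; first exact: cvg_cst.
    by apply: cvgM; [exact: cvg_cst|exact: exprn_continuous].
  apply: cvgM; first exact: cvg_cst.
  by apply: cvgM; [exact: cvg_cst|exact: exprn_continuous].
have [||z _ zmax] := @EVT_max R (fun x => `|phif2 x|) (-1) 2; first by lra.
  exact: continuous_subspaceT.
exists `|phif2 z| => // x y x01 y01.
apply: (@taylor2_bound _ phi phif1 phif2 (-1) 2).
- by move=> t _; exact: is_derive_phif.
- by move=> t _; exact: is_derive_phif1.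
- by move=> t /andP[t1 t2]; apply: zmax; rewrite in_itv/= (ltW t1) ltW.
- by move: x01 => /andP[? ?]; apply/andP; split; lra.
- by move: y01 => /andP[? ?]; apply/andP; split; lra.
Qed.

(** The stability of [b] says that the derivative of [phif] at [b] is
    positive. *)
Lemma phif_mono b : 0 < b -> beta * p%:R * p.-1%:R * b ^+ p.-1 < 1 ->
  exists c rho, [/\ 0 < c, 0 < rho & forall x y, `|x - b| < rho -> `|y - b| < rho ->
    c * (x - y) ^+ 2 <= (phi x - phi y) * (x - y)].
Proof.
move=> b0 stab; have pb : 0 < phif1 b.
  by rewrite /phif1 mulr_gt0 ?expR_gt0// subr_gt0.
have cb : {for b, continuous phif1}.
  apply: differentiable_continuous; apply/derivable1_diffP.
  by have [] := is_derive_phif1 b.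
have p2 : 0 < phif1 b / 2 by rewrite divr_gt0.
have /cvgrPdist_lt/(_ _ p2)/nbhs_ballP[rho /= rho0 H] := cb.
exists (phif1 b / 2), rho; split => // x y xb yb.
have Hx : b - rho < x < b + rho by move: xb; rewrite ltr_distl.
have Hy : b - rho < y < b + rho by move: yb; rewrite ltr_distl.
have [|z [_ zb] ->] := @MVT_between _ phi phif1 (b - rho) (b + rho) y x _ Hy Hx.
  by move=> z _; exact: is_derive_phif.
rewrite -mulrA -expr2 ler_wpM2r ?sqr_ge0//.
have : `|phif1 b - phif1 z| < phif1 b / 2.
  by apply: H; rewrite /ball/= distrC ltr_distl.
by rewrite ltr_norml => /andP[_]; lra.
Qed.

Lemma phif_low x : 0 <= x <= 1 -> x * expR (- (beta * p%:R)) <= phi x.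
Proof.
move=> /andP[x0 x1]; rewrite ler_wpM2l// ler_expR lerN2 ler_piMr ?exprn_ile1//.
by rewrite mulr_ge0// ltW.
Qed.

Lemma ln_phif x : 0 < x -> ln (phi x) = - etad beta p 1 x - 1.
Proof.
move=> x0; rewrite /phif lnM ?posrE ?expR_gt0// expRK /etad ffactn1 subn1; ring.
Qed.

(** For [i = 0], the value of [Hfun] when colour 1 has proportion [k] and the
    other colours share the rest equally; in general, its derivative of order
    [i] in [k]. *)
Definition segment_deriv i (k : R) : R :=
  etad beta p i k + (if i is 0%N then h * k else if i is 1%N then h else 0) +
  q.-1%:R * (- q.-1%:R^-1) ^+ i * etad beta p i ((1 - k) / q.-1%:R).

Let m_ge1 : 1 <= (q.-1%:R : R). Proof. by rewrite ler1n -subn1 subn_gt0. Qed.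
Let m_gt0 : 0 < (q.-1%:R : R). Proof. exact: lt_le_trans m_ge1. Qed.

Lemma is_derive_segment i (k : R) : 0 < k < 1 -> is_derive k 1 (segment_deriv i) (segment_deriv i.+1 k).
Proof.
move=> /andP[k0 k1]; have y0 : 0 < (1 - k) / q.-1%:R by rewrite divr_gt0// subr_gt0.
have D1 : is_derive k 1 (fun z : R => (1 - z) / q.-1%:R) (- q.-1%:R^-1).
  have -> : (fun z : R => (1 - z) / q.-1%:R) = q.-1%:R^-1 \*: (cst 1 - (@id R)).
    by apply/funext => z; rewrite !fctE /GRing.scale/= mulrC.
  apply: (is_derive_eq (is_deriveZ _ (is_deriveB (is_derive_cst (1 : R) k 1) (is_derive_id k 1)))).
  by rewrite /GRing.scale/= sub0r mulrN1.
have D2 := @is_derive1_comp R (etad beta p i) (fun z : R => (1 - z) / q.-1%:R) k _ _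
  (is_derive_etad beta p i y0) D1.
have D3 : is_derive k 1 (fun z : R => if i is 0%N then h * z else if i is 1%N then h else 0)
    (if i is 0%N then h else 0).
  case: i {D2} => [|[|i]].
  - have -> : (fun z : R => h * z) = h \*: (@id R) by [].
    apply: (is_derive_eq (is_deriveZ _ (is_derive_id k 1))).
    by rewrite /GRing.scale/= mulr1.
  - exact: is_derive_cst.
  - exact: is_derive_cst.
have -> : segment_deriv i = etad beta p i +
   (fun z : R => if i is 0%N then h * z else if i is 1%N then h else 0) +
   (q.-1%:R * (- q.-1%:R^-1) ^+ i) \*:
     (etad beta p i \o (fun z : R => (1 - z) / q.-1%:R)) by [].
apply: (is_derive_eq (is_deriveD (is_deriveD (is_derive_etad beta p i k0) D3)
  (is_deriveZ _ D2))).
rewrite /GRing.scale/= /segment_deriv exprSr.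
have -> : (if i is 0%N then h else 0) =
   (match i.+1 with 0%N => h * k | 1%N => h | _ => 0 end) by case: (i).
congr (_ + _); ring.
Qed.

Lemma etad1_lipschitz lo x y : 0 < lo -> lo < x < 1 -> lo < y < 1 ->
  `|etad beta p 1 x - etad beta p 1 y| <= (beta * (p ^_ 2)%:R + lo^-1) * `|x - y|.
Proof.
move=> lo0 xh yh.
have [|z [_ zh] ->] := @MVT_between _ (etad beta p 1) (etad beta p 2) lo 1 y x _ yh xh.
  by move=> z /andP[lz _]; apply: is_derive_etad; exact: lt_trans lz.
move: zh => /andP[lz z1]; have z0 := lt_trans lo0 lz.
rewrite normrM ler_wpM2r// /etad fact0 mulr1 !expr1 mulN1r.
apply: (le_trans (ler_normB _ _)); apply: lerD.
  rewrite normrM !ger0_norm ?exprn_ge0 ?(ltW z0)//; last by rewrite mulr_ge0// ltW.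
  by rewrite ler_piMr ?exprn_ile1 ?(ltW z0) ?(ltW z1)// mulr_ge0// ltW.
by rewrite gtr0_norm ?invr_gt0// lef_pV2 ?posrE// ltW.
Qed.

(** The increment of the logarithm of the weight will involve the derivatives at
    [x + nu] for colour 1 and at [x] for the others; either choice of the point
    costs [O(nu)]. *)
Lemma segment_step w x nu : 0 < w -> 0 < nu -> w <= x -> x + nu <= 1 - w ->
  `|(segment_deriv 0 (x + nu) - segment_deriv 0 x) / nu -
    (etad beta p 1 (x + nu) + h - etad beta p 1 ((1 - x) / q.-1%:R))| <=
  (beta * (p ^_ 2)%:R + (w / 2 / q.-1%:R)^-1) * (3 * nu).
Proof.
move=> margin nu0 wx xw; set lo := w / 2 / q.-1%:R; set y := (1 - x) / q.-1%:R.
have w2 : 0 < w / 2 by rewrite divr_gt0.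
have lo0 : 0 < lo by exact: divr_gt0.
have lo_le : lo <= w / 2 by rewrite /lo ler_pdivrMr// ler_peMr// ltW.
have xh : w / 2 < x < 1 - w / 2 by apply/andP; split; lra.
have xh' : w / 2 < x + nu < 1 - w / 2 by apply/andP; split; lra.
have [|z [zx zh] Ez] := @MVT_between _ (segment_deriv 0) (segment_deriv 1) _ _ _ _ _ xh xh'.
  move=> z /andP[z1 z2]; apply: is_derive_segment.
  by apply/andP; split; lra.
have {}Ez : (segment_deriv 0 (x + nu) - segment_deriv 0 x) / nu = segment_deriv 1 z.
  by rewrite Ez addrAC subrr add0r mulfK// gt_eqF.
rewrite addrAC subrr add0r (gtr0_norm nu0) ler_distl in zx.
have {zh} [z1 z2] := andP zh; have {xh} [x1 x2] := andP xh.
have {xh'} [x1' x2'] := andP xh'; have {zx} [zx1 zx2] := andP zx.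
have inh t : w / 2 < t -> t < 1 - w / 2 -> lo < t < 1.
  by move=> t1 t2; apply/andP; split; lra.
have inh' t : w / 2 < t -> t < 1 - w / 2 -> lo < (1 - t) / q.-1%:R < 1.
  move=> t1 t2.
  have t1' : w / 2 < 1 - t by lra.
  have t2' : 1 - t < 1 by lra.
  apply/andP; split; first by rewrite /lo ltr_pM2r ?invr_gt0.
  by rewrite ltr_pdivrMr// mul1r (lt_le_trans t2').
have M1 := etad1_lipschitz lo0 (inh _ z1 z2) (inh _ x1' x2').
have M2 := etad1_lipschitz lo0 (inh' _ z1 z2) (inh' _ x1 x2).
rewrite -/y in M2; set t := (1 - z) / q.-1%:R in M2.
set L := beta * (p ^_ 2)%:R + lo^-1 in M1 M2 *.
have L0 : 0 <= L by rewrite addr_ge0 ?invr_ge0 ?(ltW lo0)// mulr_ge0// ltW.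
have d1 : `|z - (x + nu)| <= 2 * nu.
  by rewrite ler_distl; apply/andP; split; lra.
have d2 : `|t - y| <= nu.
  rewrite /t /y -mulrBl normrM (gtr0_norm (_ : 0 < q.-1%:R^-1)) ?invr_gt0//.
  apply: (@le_trans _ _ `|1 - z - (1 - x)|).
    by rewrite ler_piMr// invf_le1.
  by rewrite ler_norml; apply/andP; split; lra.
have {}M1 := le_trans M1 (ler_wpM2l L0 d1).
have {}M2 := le_trans M2 (ler_wpM2l L0 d2).
rewrite Ez.
have -> : segment_deriv 1 z - (etad beta p 1 (x + nu) + h - etad beta p 1 y) =
  (etad beta p 1 z - etad beta p 1 (x + nu)) - (etad beta p 1 t - etad beta p 1 y).
  by rewrite /segment_deriv expr1 -/t; field; rewrite gt_eqF.
apply: (le_trans (ler_normB _ _)); apply: (le_trans (lerD M1 M2)).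
by rewrite -mulrDr ler_wpM2l//; lra.
Qed.

Variables (v : 'rV[R]_q) (a b : R).
Hypotheses (va : v 0 c1 = a) (vb : forall r, r != c1 -> v 0 r = b).
Hypotheses (a_gt0 : 0 < a) (b_gt0 : 0 < b) (ab1 : a + q.-1%:R * b = 1).
Hypothesis crit : beta * p%:R * a ^+ p.-1 + h - ln a = beta * p%:R * b ^+ p.-1 - ln b.
Hypothesis vmax : unique_maximizer p q_gt1 beta h v.
Hypothesis stab : q = 2%N \/ beta * p%:R * p.-1%:R * b ^+ p.-1 < 1.
Local Notation H0 := (Hfun p q_gt1 beta h v).
Local Notation near_a := (near_a a).
Local Notation margin := (margin a).

(** Given the count of colour 1, the integration by parts formula makes the other
    proportions fluctuate by [O(N ^ (-1/2))] only: the degeneracy of the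
    maximizer is confined to the first coordinate. *)
Lemma spread_bound : exists V e, [/\ 0 <= V, 0 < e, e <= margin &
  \forall N \near \oo, forall k, near_a e N k ->
    spread p q_gt1 beta h N k <= V / N%:R * count_weight N k].
Proof.
have margin0 := margin_gt0 q_gt1 a_gt0 b_gt0 ab1.
case: stab => [q2|st].
  exists 0, margin; split => //; near=> N => k _.
  have N0 : (0 < N)%N by near: N; exact: nbhs_infty_gt.
  by rewrite spread_two// mul0r mul0r.
have [c [rho [c0 rho0 mono]]] := phif_mono b_gt0 st.
have [e [e0 ew cf]] := cond_far p_gt1 beta_gt0 va vb a_gt0 b_gt0 ab1 crit vmax rho0.
pose S := beta * p%:R * p.-1%:R.
have S0 : 0 <= S by rewrite mulr_ge0// mulr_ge0// ltW.
exists (q.-1%:R * (2 + S + (c + 1)) / c), e; split => //.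
  by rewrite divr_ge0 ?(ltW c0)// mulr_ge0// !addr_ge0// ltW.
near=> N => k kN.
have N0 : (0 < N)%N by near: N; exact: nbhs_infty_gt.
have NR0 : 0 < (N%:R : R) by rewrite ltr0n.
have good (X : {ffun 'I_N -> 'I_q}) : ~~ far v rho X -> forall r, r != c1 -> `|xbar X 0 r - b| < rho.
  by move=> /existsPn H r r1; rewrite -(vb r1) ltNge; exact: H.
have F : \sum_(X : {ffun 'I_N -> 'I_q} | (cnt X c1 == k) && far v rho X) weight X <= count_weight N k / N%:R.
  by move: (k) kN; near: N.
rewrite -(@ler_pM2l _ c)//.
have Sp := @spread_le R p q p_gt1 q_gt1 beta h N N0 beta_gt0 c b rho (@far R q v rho N) k (ltW c0) mono good.
apply: (le_trans Sp).
have -> : c * (q.-1%:R * (2 + S + (c + 1)) / c / N%:R * count_weight N k) =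
  q.-1%:R * ((2 + S) / N%:R * count_weight N k + (c + 1) * (count_weight N k / N%:R)).
  by field; rewrite !gt_eqF.
rewrite ler_wpM2l ?(ltW m_gt0)// lerD2l ler_wpM2l//.
by rewrite addr_ge0// ltW.
Unshelve. all: by end_near. Qed.

(** By [count_weight_rec_phif] and [spread_bound] the ratio of two consecutive weights is
    [expR h * phif y / phif x] with relative error [O(1/N)], where [x] and [y] are
    the proportions of colour 1 and of the others, and [ln (phif x)] is the
    derivative of [x ln x - beta x^p] up to a constant. *)
Lemma count_weight_increment : exists C e, [/\ 0 <= C, 0 < e, e <= margin &
  \forall N \near \oo, forall k, near_a e N k -> near_a e N k.+1 ->
    `|(ln (count_weight N k.+1) - N%:R * segment_deriv 0 (k.+1%:R / N%:R)) -
      (ln (count_weight N k) - N%:R * segment_deriv 0 (k%:R / N%:R))| <= C / N%:R].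
Proof.
have margin0 := margin_gt0 q_gt1 a_gt0 b_gt0 ab1.
have [V [e [V0 e0 ew spr]]] := spread_bound.
have [Ct Ct0 tay] := phif_taylor.
pose S := beta * p%:R * p.-1%:R.
have S0 : 0 <= S by rewrite mulr_ge0// mulr_ge0// ltW.
pose D := S + Ct * V / q.-1%:R.
have D0 : 0 <= D by rewrite addr_ge0// divr_ge0 ?(ltW m_gt0)// mulr_ge0.
pose g := expR (- (beta * p%:R)); have g0 : 0 < g by exact: expR_gt0.
pose f0 := margin / q.-1%:R * g.
have f00 : 0 < f0 by apply: mulr_gt0 => //; apply: divr_gt0.
pose lo := margin / 2 / q.-1%:R.
have lo0 : 0 < lo by apply: divr_gt0 => //; exact: divr_gt0.
pose L := beta * (p ^_ 2)%:R + lo^-1.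
have L0 : 0 <= L by rewrite addr_ge0 ?invr_ge0 ?(ltW lo0)// mulr_ge0// ltW.
pose C1 := expR h * D / (expR h * (f0 / 2)) + S / (margin * g).
exists (C1 + L * 3); exists e; split => //.
  rewrite addr_ge0 ?mulr_ge0// addr_ge0//.
    rewrite divr_ge0// mulr_ge0 ?expR_ge0//; exact/ltW/divr_gt0.
  by apply: divr_ge0 => //; apply: mulr_ge0; exact: ltW.
near=> N => k k0 k1.
have N0 : (0 < N)%N by near: N; exact: nbhs_infty_gt.
have NR0 : 0 < (N%:R : R) by rewrite ltr0n.
have kN := near_a_le q_gt1 a_gt0 b_gt0 ab1 ew k0 N0.
have /andP[a1 a2] := near_a_bounds ew k0.
have /andP[b1 b2] := near_a_bounds ew k1.
have W0 := count_weight_gt0 p q_gt1 beta h (ltnW kN).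
have W1 := count_weight_gt0 p q_gt1 beta h kN.
have R1 := @count_weight_rec_phif R p q p_gt1 q_gt1 beta h N N0 beta_gt0 phif1 Ct k (ltnW kN) Ct0 tay.
have Sp : spread p q_gt1 beta h N k <= V / N%:R * count_weight N k by move: (k) k0; near: N.
have /andP[P1 P2] := @dphi_phif R p p_gt1 beta N N0 beta_gt0 _ kN.
set A := dphi p beta N k.+1 in R1 P1 P2.
set y := rest q N k in R1.
have yE : y = (1 - k%:R / N%:R) / q.-1%:R by [].
set x' : R := k.+1%:R / N%:R in P1 P2 b1 b2 *.
set x : R := k%:R / N%:R in yE a1 a2 *.
have x'x : x' - x = N%:R^-1 by rewrite /x' /x -mulrBl -natrB// subSnn mul1r.
have Ni : 0 < (N%:R : R)^-1 by rewrite invr_gt0.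
have y1 : margin / q.-1%:R <= y by rewrite yE ler_wpM2r ?invr_ge0 ?(ltW m_gt0)//; lra.
have wm : margin / q.-1%:R <= margin by rewrite ler_pdivrMr// ler_peMr// ltW.
have wm0 : 0 < margin / q.-1%:R by exact: divr_gt0.
have y2 : y <= 1 - margin.
  by rewrite yE ler_pdivrMr//; apply: (@le_trans _ _ (1 - margin)); [lra|rewrite ler_peMr//; lra].
have yphi : f0 <= phi y.
  apply: le_trans (phif_low _); first by rewrite ler_wpM2r// ltW.
  by apply/andP; split; lra.
have xphi : margin * g <= phi x'.
  apply: le_trans (phif_low _); first by rewrite ler_wpM2r// ltW.
  by apply/andP; split; lra.
have wg0 : 0 < margin * g by exact: mulr_gt0.
have A0 : 0 < A by apply: lt_le_trans P1; exact: lt_le_trans xphi.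
pose r := count_weight N k.+1 / count_weight N k.
have r0 : 0 < r by exact: divr_gt0.
have E1 : `|A * r - expR h * phi y| <= expR h * D / N%:R.
  rewrite -(@ler_pM2l _ (q.-1%:R * count_weight N k)); last exact: mulr_gt0.
  rewrite -{1}(gtr0_norm (mulr_gt0 m_gt0 W0)) -normrM.
  have -> : q.-1%:R * count_weight N k * (A * r - expR h * phi y) =
     q.-1%:R * (A * count_weight N k.+1) - expR h * (q.-1%:R * phi y * count_weight N k).
    by rewrite /r; field; rewrite gt_eqF.
  apply: (le_trans R1).
  have -> : q.-1%:R * count_weight N k * (expR h * D / N%:R) =
     expR h * (q.-1%:R * S / N%:R * count_weight N k + Ct * (V / N%:R * count_weight N k)).
    by rewrite /D; field; rewrite !gt_eqF.
  by rewrite ler_wpM2l ?expR_ge0// lerD2l ler_wpM2l.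
have DN : D / N%:R <= f0 / 2.
  rewrite ler_pdivrMr// mulrC -ler_pdivrMr ?divr_gt0//.
  by near: N; exact: nbhs_infty_ger.
have hp : expR h * (f0 / 2) <= A * r.
  move: E1; rewrite ler_norml => /andP[E1 _].
  have := expR_gt0 h => eh.
  have T1 : expR h * D / N%:R <= expR h * (f0 / 2) by rewrite -mulrA ler_wpM2l// ltW.
  have T2 : expR h * f0 <= expR h * phi y by rewrite ler_wpM2l// ltW.
  by move: E1 T1 T2; rewrite mulrA; lra.
have hq : expR h * (f0 / 2) <= expR h * phi y.
  by rewrite ler_wpM2l ?expR_ge0//; lra.
have hf0 : 0 < expR h * (f0 / 2) by apply: mulr_gt0; [exact: expR_gt0|exact: divr_gt0].
have L1 := ln_lipschitz hf0 hp hq.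
have L2 := ln_lipschitz wg0 (le_trans xphi P1) xphi.
have {}L1 : `|ln (A * r) - ln (expR h * phi y)| <= expR h * D / (expR h * (f0 / 2)) / N%:R.
  apply: (le_trans L1); rewrite [leRHS]mulrAC ler_wpM2r// invr_ge0; exact: ltW.
have {}L2 : `|ln A - ln (phi x')| <= S / (margin * g) / N%:R.
  apply: (le_trans L2); rewrite [leRHS]mulrAC ler_wpM2r ?invr_ge0 ?(ltW wg0)//.
  by rewrite ger0_norm ?subr_ge0// lerBlDl.
have py0 : 0 < phi y by exact: lt_le_trans yphi.
have x'0 : 0 < x' by lra.
have y0 : 0 < y by lra.
rewrite lnM ?posrE// lnM ?posrE ?expR_gt0// expRK (ln_phif y0) /r ln_div ?posrE// in L1.
rewrite (ln_phif x'0) in L2.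
have E3 : x + N%:R^-1 = x' by rewrite -x'x addrCA subrr addr0.
have b2' : x + N%:R^-1 <= 1 - margin by rewrite E3.
have M := segment_step margin0 Ni a1 b2'; rewrite -yE E3 invrK -/lo -/L in M.
have -> : (ln (count_weight N k.+1) - N%:R * segment_deriv 0 x') - (ln (count_weight N k) - N%:R * segment_deriv 0 x) =
   (ln A + (ln (count_weight N k.+1) - ln (count_weight N k)) - (h + (- etad beta p 1 y - 1))) -
   (ln A - (- etad beta p 1 x' - 1)) -
   ((segment_deriv 0 x' - segment_deriv 0 x) * N%:R -
     (etad beta p 1 x' + h - etad beta p 1 y)) by ring.
apply: (le_trans (ler_normB _ _)); rewrite [leRHS]mulrDl -[X in _ <= _ + X]mulrA lerD//.
by apply: (le_trans (ler_normB _ _)); rewrite /C1 mulrDl lerD.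
Unshelve. all: by end_near. Qed.

Lemma count_weight_profile : exists C e, [/\ 0 <= C, 0 < e, e <= margin &
  \forall N \near \oo, forall k l, near_a e N k -> near_a e N l ->
    `|(ln (count_weight N k) - N%:R * segment_deriv 0 (k%:R / N%:R)) -
      (ln (count_weight N l) - N%:R * segment_deriv 0 (l%:R / N%:R))| <= C / N%:R * `|k%:R - l%:R|].
Proof.
have [C [e [C0 e0 ew inc]]] := count_weight_increment; exists C, e; split => //.
near=> N => k l kN lN.
apply: (telescope_dist (u := fun k => ln (count_weight N k) - N%:R * segment_deriv 0 (k%:R / N%:R))
  (P := near_a e N)) => //; last exact: near_a_conv.
by near: N.
Unshelve. all: by end_near. Qed.

Definition center N : nat := Num.truncn (a * N%:R).

Lemma center_near N : (0 < N)%N -> near_a N%:R^-1 N (center N).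
Proof.
move=> N0; have NR0 : 0 < (N%:R : R) by rewrite ltr0n.
have aN : 0 <= a * N%:R by rewrite mulr_ge0// ltW.
have /andP[t1 t2] := truncn_itv aN; rewrite -/(center N) in t1 t2.
rewrite /near_a ler_distl; apply/andP; split.
  by rewrite lerBlDr -[X in _ <= _ + X]mul1r -mulrDl ler_pdivlMr// natr1 ltW.
by rewrite ler_pdivrMr// mulrDl mulVf ?gt_eqF//; lra.
Qed.

(** Compared with the heavy central weight, the counts outside a window are
    exponentially small. *)
Lemma count_weight_far e : 0 < e -> exists2 eta, 0 < eta &
  \forall N \near \oo,
    \sum_(k < N.+1 | ~~ near_a e N k) count_weight N k <= expR (- (eta * N%:R)) * count_weight N (center N).
Proof.
move=> e0; have [eta eta0 farP] := sum_far vmax e0.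
have e2 : 0 < eta / 2 by rewrite divr_gt0.
have [e' [e'0 _ low]] := count_weight_low p_gt1 beta_gt0 va vb a_gt0 b_gt0 ab1 crit vmax e2.
exists (eta / 2) => //; near=> N.
have N0 : (0 < N)%N by near: N; exact: nbhs_infty_gt.
have NR0 : 0 < (N%:R : R) by rewrite ltr0n.
have kN : near_a e' N (center N).
  apply: (le_trans (center_near N0)); rewrite invf_ple ?posrE//.
  by near: N; exact: nbhs_infty_ger.
have Lo : expR (N%:R * (H0 - eta / 2)) <= count_weight N (center N) by move: (center N) kN; near: N.
have F : \sum_(X : {ffun 'I_N -> 'I_q} | far v e X) weight X <= expR (N%:R * (H0 - eta)).
  by near: N; exact: farP.
apply: (@le_trans _ _ (expR (- (eta / 2 * N%:R)) * expR (N%:R * (H0 - eta / 2)))); last first.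
  by rewrite ler_wpM2l ?expR_ge0.
rewrite -expRD (_ : _ + _ = N%:R * (H0 - eta)); last by field.
apply: le_trans F; rewrite big_mkcond/=.
rewrite (eq_bigr (fun k : 'I_N.+1 => count_weight N k * (~~ near_a e N k)%:R)); last first.
  by move=> k _; case: ifP; rewrite ?mulr1 ?mulr0.
rewrite -(@sum_count_weight R p q q_gt1 beta h N (fun k => (~~ near_a e N k)%:R)).
rewrite [leRHS]big_mkcond/=; apply: ler_sum => X _.
have wX := ltW (weight_gt0 p q_gt1 beta h X).
case: ifPn => [_|/existsPn/(_ c1)].
  by rewrite ler_piMr// lern1 leq_b1.
by rewrite -ltNge va xbarE /near_a => /ltW ->; rewrite mulr0.
Unshelve. all: by end_near. Qed.

End increments.
(** * Laplace method for the rescaled count *)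

Section dominated.
Context {R : realType}.
Local Notation mu := (@lebesgue_measure R).

Lemma integrable_gauss_fun : mu.-integrable setT (EFin \o @gauss_fun R).
Proof.
apply/integrableP; split; first by apply/measurable_EFinP; exact: measurable_gauss_fun.
under eq_integral do rewrite /= ger0_norm ?gauss_fun_ge0//.
by rewrite integralT_gauss ltry.
Qed.

(** Setting the first terms to zero makes the bound hold for all [n], and the
    exceptional point is negligible. *)
Lemma dominated_cvg_gauss (f_ : nat -> R -> R) (f : R -> R) (K x0 : R) :
  (forall n, measurable_fun setT (f_ n)) -> measurable_fun setT f ->
  (\forall n \near \oo, forall x, `|f_ n x| <= K * gauss_fun x) ->
  (forall x, x != x0 -> f_ n x @[n --> \oo] --> f x) ->
  mu.-integrable setT (EFin \o f) /\
  \int[mu]_x f_ n x @[n --> \oo] --> \int[mu]_x f x.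
Proof.
move=> mf_ mf [n0 _ dom] cvgf.
have iK : mu.-integrable setT (EFin \o (fun x => K * gauss_fun x)).
  exact: (integrableZl _ K integrable_gauss_fun).
pose g_ n x := if (n0 <= n)%N then f_ n x else 0.
have [||||I1 _ I2] := @dominated_convergence _ _ _ mu setT measurableT
    (fun n x => (g_ n x)%:E) (EFin \o f) (EFin \o (fun x => K * gauss_fun x)) _ _ _ iK.
- move=> n; apply/measurable_EFinP; rewrite /g_; case: (n0 <= n)%N; last exact: measurable_cst.
  exact: mf_.
- exact/measurable_EFinP.
- exists [set x0]; split => //; first exact: lebesgue_measure_set1.
  move=> x /= H; apply: contrapT => xx0; apply: H => _.
  have /cvgf : x != x0 by apply/eqP.
  move=> Hx; apply: cvg_EFin; first by near=> n.
  apply: cvg_trans Hx; apply: near_eq_cvg; near=> n.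
  by rewrite /g_ /= ifT//; near: n; exact: nbhs_infty_ge.
- apply: aeW => x n _; rewrite lee_fin /g_; case: ifPn => [n0n|_]; first exact: dom.
  rewrite normr0; apply: le_trans (dom n0 (leqnn _) x); exact: normr_ge0.
split => //.
have : \int[mu]_x g_ n x @[n --> \oo] --> \int[mu]_x f x.
  apply: fine_cvg; rewrite fineK; first exact: I2.
  exact: integrable_fin_num.
apply: cvg_trans; apply: near_eq_cvg; near=> n.
have n0n : (n0 <= n)%N by near: n; exact: nbhs_infty_ge.
by rewrite /g_ n0n.
Unshelve. all: by end_near. Qed.

End dominated.

Section step_functions.
Context {R : realType}.
Local Notation mu := (@lebesgue_measure R).
Variables (n : nat) (P : pred nat) (c l : nat -> R) (delta : R).
Hypothesis delta_gt0 : 0 < delta.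

Definition step (x : R) : R :=
  \sum_(k < n | P k) c k * \1_(`[l k, l k + delta[%classic) x.

Lemma measurable_step : measurable_fun setT step.
Proof.
have -> : step = (fun x => \sum_(k < n)
    (if P k then c k else 0) * \1_(`[l k, l k + delta[%classic) x).
  apply/funext => x; rewrite /step big_mkcond/=; apply: eq_bigr => k _.
  by case: ifP; rewrite ?mul0r.
apply: measurable_sum => k; apply: measurable_funM; first exact: measurable_cst.
exact: measurable_indic.
Qed.

Lemma Rintegral_step : \int[mu]_x step x = delta * \sum_(k < n | P k) c k.
Proof.
have i1 k : mu.-integrable setT (fun x => (\1_(`[l k, l k + delta[%classic) x)%:E).
  exact: integrable_indic_itv.
have i2 k : mu.-integrable setT (fun x => (c k * \1_(`[l k, l k + delta[%classic) x)%:E).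
  exact: (integrableZl measurableT (c k) (i1 k)).
rewrite /Rintegral /step.
under eq_integral do rewrite -sumEFin.
rewrite (@integral_sum _ _ _ mu setT measurableT 'I_n
  (fun (k : 'I_n) x => (c k * \1_(`[l k, l k + delta[%classic) x)%:E) (fun k => i2 k)).
have Ek k : (\int[mu]_x (c k * \1_(`[l k, l k + delta[%classic) x)%:E = (c k * delta)%:E)%E.
  under eq_integral do rewrite EFinM.
  rewrite integralZl// integral_indic// setIT /= lebesgue_measure_itv/= lte_fin ltrDl delta_gt0.
  by rewrite -EFinB addrAC subrr add0r -EFinM.
under eq_bigr do rewrite Ek.
by rewrite sumEFin/= mulr_sumr; apply: eq_bigr => k _; rewrite mulrC.
Qed.

Hypothesis disj : forall x i j, l i <= x < l i + delta -> l j <= x < l j + delta -> i = j.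

Lemma step_at x k : (k < n)%N -> P k -> l k <= x < l k + delta -> step x = c k.
Proof.
move=> kn Pk xk; rewrite /step (bigD1 (Ordinal kn))//=.
rewrite indicE mem_set ?mulr1; last by rewrite /= in_itv.
rewrite big1 ?addr0// => i /andP[Pi ik]; rewrite indicE memNset ?mulr0//= in_itv/=.
by move=> xi; move/negP: ik; apply; apply/eqP/val_inj => /=; exact: (disj xi xk).
Qed.

Lemma step_cases x : step x = 0 \/
  exists k, [/\ (k < n)%N, P k, l k <= x < l k + delta & step x = c k].
Proof.
have [[k [kn Pk xk]]|none] := pselect (exists k, [/\ (k < n)%N, P k & l k <= x < l k + delta]).
  by right; exists k; split => //; exact: step_at.
left; rewrite /step big1// => i Pi; rewrite indicE memNset ?mulr0//= in_itv/=.
by move=> xi; apply: none; exists i.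
Qed.

End step_functions.

(** The square of [|t| + 1] pays for replacing a point of a mesh of size at most
    one by a neighbour in the Gaussian bound. *)
Lemma quartic_dominates {R : realType} (K c : R) : 0 <= K -> 0 < c ->
  exists M, forall t : R, K * `|t| + (`|t| + 1) ^+ 2 <= M + c * t ^+ 4.
Proof.
move=> K0 c0; exists (K + 3 + (K + 3) ^+ 2 / (4 * c)) => t.
set s := `|t|; have s0 : 0 <= s by rewrite normr_ge0.
have -> : t ^+ 4 = (s ^+ 2) ^+ 2.
  by rewrite /s real_normK ?num_real// -exprM.
have e : (K + 3) * s ^+ 2 <= c * (s ^+ 2) ^+ 2 + (K + 3) ^+ 2 / (4 * c).
  rewrite -subr_ge0.
  have -> : c * (s ^+ 2) ^+ 2 + (K + 3) ^+ 2 / (4 * c) - (K + 3) * s ^+ 2 =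
    c * (s ^+ 2 - (K + 3) / (2 * c)) ^+ 2 by field; rewrite gt_eqF.
  by rewrite mulr_ge0 ?sqr_ge0// ltW.
have : s <= s ^+ 2 + 1 by have := sqr_ge0 (s - 2^-1); rewrite sqrrB; lra.
by nra.
Qed.

Lemma normX_even {R : realDomainType} (d : nat) (x : R) : ~~ odd d -> `|x| ^+ d = x ^+ d.
Proof.
move=> d_even; rewrite -normrX ger0_norm//.
by rewrite -(odd_double_half d) (negPf d_even) add0n -mul2n exprM exprn_ge0// sqr_ge0.
Qed.

Lemma pow4_le_even {R : realDomainType} (d : nat) (x : R) : (4 <= d)%N -> ~~ odd d ->
  x ^+ 4 <= x ^+ d + 1.
Proof.
move=> d4 de; rewrite -(normX_even x de) -(normX_even x (isT : ~~ odd 4)).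
have [u1|u1] := leP `|x| 1.
  by apply: (@le_trans _ _ 1); [exact: exprn_ile1|rewrite lerDr exprn_ge0].
by apply: (@le_trans _ _ (`|x| ^+ d)); rewrite ?lerDl// ler_weXn2l// ltW.
Qed.

Section laplace.
Context {R : realType}.
Local Notation mu := (@lebesgue_measure R).
Variables (d : nat) (a m c0 : R) (F : R -> R) (w : nat -> nat -> R) (k0 : nat -> nat).
Hypotheses (d_ge4 : (4 <= d)%N) (d_even : ~~ odd d).
Hypotheses (a01 : 0 < a < 1) (m_gt0 : 0 < m) (c0_lt0 : c0 < 0).
Hypothesis w_gt0 : forall N k, (k <= N)%N -> 0 < w N k.
Hypothesis taylorF : forall e, 0 < e -> \forall x \near a,
  `|F x - F a - c0 * (x - a) ^+ d| <= e * `|x - a| ^+ d.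
Hypothesis k0_near_a : forall N, (0 < N)%N -> near_a a N%:R^-1 N (k0 N).
Hypothesis profile : exists C e, [/\ 0 <= C, 0 < e &
  \forall N \near \oo, forall k l, near_a a e N k -> near_a a e N l ->
    `|(ln (w N k) - N%:R * F (k%:R / N%:R)) -
      (ln (w N l) - N%:R * F (l%:R / N%:R))| <= C / N%:R * `|k%:R - l%:R|].
Hypothesis tail : forall e, 0 < e -> exists2 eta, 0 < eta &
  \forall N \near \oo,
    \sum_(k < N.+1 | ~~ near_a a e N k) w N k <= expR (- (eta * N%:R)) * w N (k0 N).

Definition scale N : R := N%:R `^ (d%:R^-1).

Let d_neq0 : (d%:R : R) != 0.
Proof. by rewrite pnatr_eq0 -lt0n (leq_trans _ d_ge4). Qed.

Lemma scale_gt0 N : (0 < N)%N -> 0 < scale N.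
Proof. by move=> N0; rewrite powR_gt0// ltr0n. Qed.

Lemma scaleX N : scale N ^+ d = N%:R.
Proof.
by rewrite /scale -powR_mulrn ?powR_ge0// -powRrM mulVf// powRr1.
Qed.

Lemma scale_pinfty A : \forall N \near \oo, A <= scale N.
Proof.
near=> N.
have N0 : (0 < N)%N by near: N; exact: nbhs_infty_gt.
have g0 := scale_gt0 N0.
have [A0|A0] := leP A 0; first by rewrite (le_trans A0)// ltW.
rewrite -(@ler_pXn2r _ d) ?nnegrE ?(ltW g0) ?(ltW A0)//; last by rewrite (leq_trans _ d_ge4).
by rewrite scaleX; near: N; exact: nbhs_infty_ger.
Unshelve. all: by end_near. Qed.

Lemma scale_sqr : \forall N \near \oo, scale N ^+ 2 <= N%:R.
Proof.
near=> N; rewrite -scaleX; apply: ler_weXn2l; last by rewrite (leq_trans _ d_ge4).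
near: N; exact: scale_pinfty.
Unshelve. all: by end_near. Qed.

Definition mesh N : R := scale N / (N%:R * m).

(** The rescaled count: with [m = q - 1], moving by [x] in this coordinate moves
    the vector of proportions along [(m, -1, .., -1)], hence the division. *)
Definition position N k : R := scale N * (k%:R / N%:R - a) / m.

Lemma mesh_gt0 N : (0 < N)%N -> 0 < mesh N.
Proof. by move=> N0; rewrite /mesh divr_gt0 ?scale_gt0// mulr_gt0// ltr0n. Qed.

Lemma mesh_le e : 0 < e -> \forall N \near \oo, mesh N <= e.
Proof.
move=> e0; near=> N.
have N0 : (0 < N)%N by near: N; exact: nbhs_infty_gt.
have NR0 : 0 < (N%:R : R) by rewrite ltr0n.
have g0 := scale_gt0 N0.
have g2 : scale N ^+ 2 <= N%:R by near: N; exact: scale_sqr.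
have gA : (e * m)^-1 <= scale N by near: N; exact: scale_pinfty.
have em : 0 < e * m by exact: mulr_gt0.
rewrite /mesh ler_pdivrMr ?mulr_gt0//.
have : 1 <= e * m * scale N by rewrite -ler_pdivrMl// mulr1.
move=> H; apply: (@le_trans _ _ (e * m * scale N * scale N)).
  by rewrite ler_peMl// ltW.
have -> : e * (N%:R * m) = e * m * N%:R by ring.
by rewrite -mulrA -expr2 ler_wpM2l// ltW.
Unshelve. all: by end_near. Qed.

(** Exactly one count [k] has [x] in the cell of its position, the integer part
    on the right. *)
Lemma position_itv N k x : (0 < N)%N ->
  (position N k <= x < position N k + mesh N) =
  (k%:R <= N%:R * (a + m * x / scale N) < k.+1%:R).
Proof.
move=> N0; have NR0 : 0 < (N%:R : R) by rewrite ltr0n.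
have g0 := scale_gt0 N0.
have q0 : 0 < scale N / (N%:R * m) by exact: mesh_gt0.
have -> : position N k = (k%:R - N%:R * a) * mesh N.
  by rewrite /position /mesh; field; rewrite !gt_eqF.
rewrite -[X in _ < _ + X]mul1r -mulrDl -ler_pdivlMr// -ltr_pdivrMr//.
have -> : x / mesh N = N%:R * (a + m * x / scale N) - N%:R * a.
  by rewrite /mesh; field; rewrite !gt_eqF.
by rewrite -natr1; congr (_ && _); apply/idP/idP; lra.
Qed.

Lemma position_disj N x i j : (0 < N)%N ->
  position N i <= x < position N i + mesh N ->
  position N j <= x < position N j + mesh N -> i = j.
Proof.
move=> N0; rewrite !position_itv//.
move=> /andP[i1 i2] /andP[j1 j2].
have := le_lt_trans i1 j2; have := le_lt_trans j1 i2.
by rewrite !ltr_nat !ltnS => ij ji; apply/eqP; rewrite eqn_leq ij ji.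
Qed.

Lemma position_near N k : (0 < N)%N ->
  k%:R / N%:R - a = m * position N k / scale N.
Proof.
by move=> N0; rewrite /position; field; rewrite !gt_eqF ?scale_gt0// ltr0n.
Qed.

Let normXd (x : R) : `|x| ^+ d = x ^+ d. Proof. exact: normX_even. Qed.

Let c := c0 * m ^+ d.

Lemma scaled_taylor (k : nat -> nat) (x : R) :
  position N (k N) @[N --> \oo] --> x ->
  N%:R * (F ((k N)%:R / N%:R) - F a) @[N --> \oo] --> c * x ^+ d.
Proof.
move=> ux.
have main : c * position N (k N) ^+ d @[N --> \oo] --> c * x ^+ d.
  apply: cvgM; first exact: cvg_cst.
  exact: (cvg_comp _ _ ux (@exprn_continuous _ d x)).
suff err : N%:R * (F ((k N)%:R / N%:R) - F a) - c * position N (k N) ^+ d @[N --> \oo] --> 0.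
  rewrite -[X in _ --> X]add0r; apply: cvg_trans (cvgD err main).
  by apply: near_eq_cvg; near=> N; rewrite /= subrK.
apply/cvgrPdist_le => e e0.
pose B := (m * (`|x| + 1)) ^+ d.
have B0 : 0 < B by rewrite exprn_gt0// mulr_gt0// ltr_wpDl.
have eB : 0 < e / B by exact: divr_gt0.
have /nbhs_ballP[r /= r0 H] := taylorF eB.
have ux1 : \forall N \near \oo, `|x - position N (k N)| <= 1.
  by move/cvgrPdist_le : ux => /(_ 1 ltr01).
near=> N; rewrite sub0r normrN.
have N0 : (0 < N)%N by near: N; exact: nbhs_infty_gt.
have NR0 : 0 < (N%:R : R) by rewrite ltr0n.
have g0 := scale_gt0 N0.
have xu : `|x - position N (k N)| <= 1 by near: N.
set u := position N (k N) in xu *.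
have ub : `|u| <= `|x| + 1.
  by rewrite -[u](subKr x) (le_trans (ler_normB _ _))// lerD2l.
have E := position_near (k N) N0; rewrite -/u in E.
clearbody u.
set kp := (k N)%:R / N%:R in E *.
have near_kp : ball a r kp.
  rewrite /ball/= distrC E normrM normrM (gtr0_norm m_gt0) normfV (gtr0_norm g0).
  rewrite ltr_pdivrMr//; apply: (@le_lt_trans _ _ (m * (`|x| + 1))).
    by rewrite ler_wpM2l// ltW.
  rewrite -ltr_pdivrMl//.
  apply: (@lt_le_trans _ _ (r^-1 * (m * (`|x| + 1)) + 1)); first by rewrite ltrDl.
  by near: N; exact: scale_pinfty.
have := H _ near_kp; rewrite /= normXd E => T.
have Nc : N%:R * (c0 * (m * u / scale N) ^+ d) = c * u ^+ d.
  have gd : scale N ^+ d != 0 by rewrite expf_neq0// gt_eqF.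
  rewrite -scaleX /c !exprMn exprVn.
  by rewrite mulrCA (mulrCA (scale N ^+ d)) divff// mulr1 mulrA.
rewrite -Nc -mulrBr normrM gtr0_norm//.
apply: (le_trans (ler_wpM2l (ltW NR0) T)).
have -> : N%:R * (e / B * (m * u / scale N) ^+ d) = e / B * (m * u) ^+ d.
  have gd : scale N ^+ d != 0 by rewrite expf_neq0// gt_eqF.
  by rewrite -scaleX exprMn exprVn mulrCA (mulrCA (scale N ^+ d)) divff// mulr1.
rewrite -[leRHS](divfK (lt0r_neq0 B0)) ler_wpM2l ?(ltW eB)//.
rewrite -normXd normrM (gtr0_norm m_gt0) /B lerXn2r// ?nnegrE ?mulr_ge0 ?addr_ge0// ?(ltW m_gt0)//.
by rewrite ler_wpM2l// ltW.
Unshelve. all: by end_near. Qed.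

Let ratio N k := w N k / w N (k0 N).

Lemma k0_le : \forall N \near \oo, (k0 N <= N)%N.
Proof.
have [a0 a1] := andP a01.
near=> N.
have N0 : (0 < N)%N by near: N; exact: nbhs_infty_gt.
have NR0 : 0 < (N%:R : R) by rewrite ltr0n.
have Na : (1 - a)^-1 <= N%:R by near: N; exact: nbhs_infty_ger.
have a1' : 0 < 1 - a by rewrite subr_gt0.
have := k0_near_a N0; rewrite /near_a ler_distl => /andP[_ H].
have : (k0 N)%:R / N%:R <= 1 :> R.
  apply: (le_trans H); rewrite -lerBrDl; rewrite invf_ple ?posrE//.
by rewrite ler_pdivrMr// mul1r ler_nat.
Unshelve. all: by end_near. Qed.

Let ratio_gt0 : \forall N \near \oo, forall k, (k <= N)%N -> 0 < ratio N k.
Proof.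
near=> N => k kN; rewrite /ratio divr_gt0//; apply: w_gt0 => //.
by near: N; exact: k0_le.
Unshelve. all: by end_near. Qed.

Lemma near_a_le1 e N k : (0 < N)%N -> e <= 1 - a -> near_a a e N k -> (k <= N)%N.
Proof.
move=> N0 e1; rewrite /near_a ler_distl => /andP[_ H].
have : k%:R / N%:R <= 1 :> R by apply: (le_trans H); rewrite -lerBrDl.
by rewrite ler_pdivrMr ?ltr0n// mul1r ler_nat.
Qed.

Lemma position_k0 : position N (k0 N) @[N --> \oo] --> (0 : R).
Proof.
apply/cvgrPdist_le => e e0; near=> N; rewrite sub0r normrN.
have N0 : (0 < N)%N by near: N; exact: nbhs_infty_gt.
have NR0 : 0 < (N%:R : R) by rewrite ltr0n.
have g0 := scale_gt0 N0.
apply: (@le_trans _ _ (mesh N)); last by near: N; exact: mesh_le.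
rewrite /position /mesh normrM normrM (gtr0_norm g0) normfV (gtr0_norm m_gt0).
rewrite invfM mulrA ler_wpM2r ?invr_ge0 ?(ltW m_gt0)// ler_wpM2l ?(ltW g0)//.
exact: k0_near_a.
Unshelve. all: by end_near. Qed.

Lemma ratio_profile : exists C e, [/\ 0 <= C, 0 < e, e <= 1, e <= 1 - a &
  \forall N \near \oo, forall k, near_a a e N k ->
   `|ln (ratio N k) - (N%:R * (F (k%:R / N%:R) - F a) -
       N%:R * (F ((k0 N)%:R / N%:R) - F a))| <=
     C * (`|k%:R / N%:R - a| + N%:R^-1)].
Proof.
have [a0 a1] := andP a01.
have [C [e [C0 e0 prof]]] := profile.
pose e' := Num.min e (Num.min 1 (1 - a)).
have e'0 : 0 < e' by rewrite !lt_min e0 ltr01 subr_gt0.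
exists C, e'; split => //.
- by rewrite !ge_min lexx orbT.
- by rewrite !ge_min lexx !orbT.
near=> N => k kN.
have N0 : (0 < N)%N by near: N; exact: nbhs_infty_gt.
have NR0 : 0 < (N%:R : R) by rewrite ltr0n.
have e'e x : near_a a e' N x -> near_a a e N x by move/le_trans; apply; rewrite ge_min lexx.
have kle : (k <= N)%N by apply: near_a_le1 kN => //; rewrite !ge_min lexx !orbT.
have k0le : (k0 N <= N)%N by near: N; exact: k0_le.
have Ne : N%:R^-1 <= e'.
  by rewrite invf_ple ?posrE//; near: N; exact: nbhs_infty_ger.
have k0n := k0_near_a N0.
have k0N : near_a a e' N (k0 N) by apply: le_trans Ne.
have H : `|(ln (w N k) - N%:R * F (k%:R / N%:R)) -
      (ln (w N (k0 N)) - N%:R * F ((k0 N)%:R / N%:R))| <= C / N%:R * `|k%:R - (k0 N)%:R|.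
  by move: (k) (k0 N) (e'e _ kN) (e'e _ k0N); near: N.
rewrite /ratio ln_div ?posrE ?w_gt0//.
have -> : ln (w N k) - ln (w N (k0 N)) - (N%:R * (F (k%:R / N%:R) - F a) -
       N%:R * (F ((k0 N)%:R / N%:R) - F a)) =
  (ln (w N k) - N%:R * F (k%:R / N%:R)) -
      (ln (w N (k0 N)) - N%:R * F ((k0 N)%:R / N%:R)) by ring.
apply: (le_trans H); rewrite -mulrA ler_wpM2l//.
rewrite -{1}(gtr0_norm (_ : 0 < N%:R^-1)) ?invr_gt0// -normrM.
have -> : N%:R^-1 * (k%:R - (k0 N)%:R) = (k%:R / N%:R - a) - ((k0 N)%:R / N%:R - a).
  by ring.
by apply: (le_trans (ler_normB _ _)); rewrite lerD2l.
Unshelve. all: by end_near. Qed.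

(** On the fluctuation scale [|k/N - a|] tends to zero, so the error accumulated
    by the profile of the weights between [k] and [k0] vanishes, and only the
    leading term of the expansion of [F] survives. *)
Lemma ratio_cvg (k : nat -> nat) (x : R) :
  position N (k N) @[N --> \oo] --> x ->
  ratio N (k N) @[N --> \oo] --> expR (c * x ^+ d).
Proof.
move=> ux; have [C [e [C0 e0 e1 ea prof]]] := ratio_profile.
have ka : (k N)%:R / N%:R - a @[N --> \oo] --> (0 : R).
  have s0 : (scale N)^-1 @[N --> \oo] --> (0 : R).
    apply/cvgrPdist_le => r r0; near=> N; rewrite sub0r normrN.
    have N0 : (0 < N)%N by near: N; exact: nbhs_infty_gt.
    rewrite gtr0_norm ?invr_gt0 ?scale_gt0// invf_ple ?posrE ?scale_gt0//.
    by near: N; exact: scale_pinfty.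
  have : m * position N (k N) * (scale N)^-1 @[N --> \oo] --> m * x * 0.
    by apply: cvgM => //; apply: cvgM => //; exact: cvg_cst.
  rewrite mulr0; apply: cvg_trans; apply: near_eq_cvg; near=> N.
  by rewrite position_near//; near: N; exact: nbhs_infty_gt.
have T1 := scaled_taylor ux.
have T2 := scaled_taylor position_k0.
rewrite expr0n -leqn0 leqNgt (leq_trans _ d_ge4)//= mulr0 in T2.
have E0 : C * (`|(k N)%:R / N%:R - a| + N%:R^-1) @[N --> \oo] --> (0 : R).
  rewrite -[X in _ --> X](mulr0 C); apply: cvgM; first exact: cvg_cst.
  rewrite -[X in _ --> X](addr0 0); apply: cvgD.
    by rewrite -[X in _ --> X](@normr0 _ R); exact: cvg_norm.
  apply/cvgrPdist_le => r r0; near=> N; rewrite sub0r normrN.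
  have NR0 : 0 < (N%:R : R) by rewrite ltr0n; near: N; exact: nbhs_infty_gt.
  rewrite gtr0_norm ?invr_gt0// invf_ple ?posrE//.
  by near: N; exact: nbhs_infty_ger.
have kn : \forall N \near \oo, near_a a e N (k N).
  move/cvgrPdist_le : ka => /(_ e e0); apply: filterS => N.
  by rewrite sub0r normrN.
have L : ln (ratio N (k N)) @[N --> \oo] --> c * x ^+ d.
  have D := cvgB T1 T2; rewrite subr0 in D.
  rewrite -[X in _ --> X]add0r.
  suff Z : ln (ratio N (k N)) - (N%:R * (F ((k N)%:R / N%:R) - F a) -
       N%:R * (F ((k0 N)%:R / N%:R) - F a)) @[N --> \oo] --> (0 : R).
    apply: cvg_trans (cvgD Z (D _)); apply: near_eq_cvg; near=> N.
    by rewrite /= !fctE subrK.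
  apply/norm_cvg0P; apply: (squeeze_cvgr _ (cvg_cst 0) E0).
  near=> N; rewrite normr_ge0/=.
  have kN : near_a a e N (k N) by near: N.
  by move: (k N) kN; near: N.
have := cvg_comp _ _ L (@continuous_expR R (c * x ^+ d)).
apply: cvg_trans; apply: near_eq_cvg; near=> N => /=.
rewrite lnK// posrE.
have kN : (k N <= N)%N.
  apply: (near_a_le1 _ ea); last by near: N.
  by near: N; exact: nbhs_infty_gt.
by move: (k N) kN; near: N.
Unshelve. all: by end_near. Qed.

Let c_lt0 : c < 0.
Proof. by rewrite /c pmulr_llt0// exprn_gt0. Qed.

(** Half of the leading coefficient absorbs the remainder of the expansion on a
    whole window of fixed width, which dominates the rescaled weights. *)
Lemma ratio_bound : exists B e, [/\ 0 <= B, 0 < e, e <= 1 - a &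
  \forall N \near \oo, forall k, near_a a e N k ->
    0 <= ratio N k <= B * expR (c / 2 * position N k ^+ d)].
Proof.
have [C [e [C0 e0 e1 ea prof]]] := ratio_profile.
have c2 : 0 < - c0 / 2 by rewrite divr_gt0// oppr_gt0.
have /nbhs_ballP[r /= r0 H] := taylorF c2.
pose e' := Num.min e (r / 2).
have e'0 : 0 < e' by rewrite lt_min e0 divr_gt0.
exists (expR (1 + 2 * C)), e'; split => //.
  by rewrite (le_trans _ ea)// ge_min lexx.
have T2 := scaled_taylor position_k0.
rewrite expr0n -leqn0 leqNgt (leq_trans _ d_ge4)//= mulr0 in T2.
have {}T2 : \forall N \near \oo, `|N%:R * (F ((k0 N)%:R / N%:R) - F a)| <= 1.
  move/cvgrPdist_le : T2 => /(_ 1 ltr01); apply: filterS => N.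
  by rewrite sub0r normrN.
near=> N => k kN.
have N0 : (0 < N)%N by near: N; exact: nbhs_infty_gt.
have NR0 : 0 < (N%:R : R) by rewrite ltr0n.
have g0 := scale_gt0 N0.
have kN' : near_a a e N k by apply: (le_trans kN); rewrite ge_min lexx.
have rk : 0 < ratio N k.
  by move: (k) (near_a_le1 N0 ea kN'); near: N; exact: ratio_gt0.
rewrite ltW//=.
have P1 : `|ln (ratio N k) - (N%:R * (F (k%:R / N%:R) - F a) -
       N%:R * (F ((k0 N)%:R / N%:R) - F a))| <=
     C * (`|k%:R / N%:R - a| + N%:R^-1) by move: (k) kN'; near: N.
have P2 : `|N%:R * (F ((k0 N)%:R / N%:R) - F a)| <= 1 by near: N.
have P3 : C * (`|k%:R / N%:R - a| + N%:R^-1) <= 2 * C.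
  rewrite mulrC ler_wpM2r// -[leRHS]/(1 + 1) lerD//.
    exact: le_trans kN' _.
  by rewrite invf_le1// ler1n.
have kr : ball a r (k%:R / N%:R).
  rewrite /ball/= distrC (le_lt_trans kN)// /e' gt_min; apply/orP; right.
  by rewrite ltr_pdivrMr// ltr_pMr// ltr1n.
have := H _ kr; rewrite /= normXd (position_near k N0) => T.
set u := position N k in T *.
have Nu (z : R) : N%:R * (z * (m * u / scale N) ^+ d) = z * m ^+ d * u ^+ d.
  have gd : scale N ^+ d != 0 by rewrite expf_neq0// gt_eqF.
  clearbody u; rewrite -scaleX !exprMn exprVn.
  by rewrite mulrCA (mulrCA (scale N ^+ d)) divff// mulr1 mulrA.
have {}T : N%:R * (F (k%:R / N%:R) - F a) <= c / 2 * u ^+ d.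
  have -> : c / 2 * u ^+ d = N%:R * ((c0 / 2) * (m * u / scale N) ^+ d).
    by rewrite Nu /c; ring.
  rewrite ler_wpM2l ?(ltW NR0)//; move: T; rewrite ler_norml => /andP[_].
  by move: ((m * u / scale N) ^+ d) => z; lra.
rewrite -[leLHS]lnK ?posrE// -expRD ler_expR.
move: P1 P2 P3 T; rewrite !ler_norml => /andP[? ?] /andP[? ?] ? ?.
lra.
Unshelve. all: by end_near. Qed.

(** Riemann sums of the rescaled weights converge to the integral of the limit
    density, for test functions of at most exponential growth that may vary
    with [N] and whose limit may be discontinuous at one point [x0]: this covers
    the exponential moments and the indicator of a moving half-line at once. *)
Theorem laplace_sum (g_ : nat -> R -> R) (g : R -> R) (K x0 : R) :
  0 <= K ->
  (\forall N \near \oo, forall x, `|g_ N x| <= K * expR (K * `|x|)) ->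
  measurable_fun setT g ->
  (forall x, x != x0 -> forall u : nat -> R, u N @[N --> \oo] --> x ->
     g_ N (u N) @[N --> \oo] --> g x) ->
  mu.-integrable setT (EFin \o (fun x => g x * expR (c * x ^+ d))) /\
  mesh N * \sum_(k < N.+1) g_ N (position N k) * ratio N k @[N --> \oo] -->
    \int[mu]_x (g x * expR (c * x ^+ d)).
Proof.
move=> K0 gK mg gcvg; have [a0 a1] := andP a01.
have [B [e [B0 e0 ea bnd]]] := ratio_bound.
pose f_ N := step N.+1 (near_a a e N) (fun k => g_ N (position N k) * ratio N k)
   (position N) (mesh N).
have cn : 0 < - c / 2 by apply: divr_gt0 => //; rewrite oppr_gt0.
have [M HM] := quartic_dominates K0 cn.
have mexp : measurable_fun setT (fun x : R => expR (c * x ^+ d)).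
  apply: continuous_measurable_fun => x.
  apply: continuous_comp; last exact: continuous_expR.
  by apply: cvgM; [exact: cvg_cst|exact: exprn_continuous].
have near_sum : mu.-integrable setT (EFin \o (fun x => g x * expR (c * x ^+ d))) /\
    \int[mu]_x f_ N x @[N --> \oo] --> \int[mu]_x (g x * expR (c * x ^+ d)).
  (* [quartic_dominates] turns the growth of [g_] and the bound on the ratios into
     a Gaussian bound for the step functions. *)
  apply: (@dominated_cvg_gauss _ f_ _ (K * B * expR (M + - c / 2)) x0).
  - by move=> N; exact: measurable_step.
  - exact: measurable_funM.
  - near=> N => x.
    have N0 : (0 < N)%N by near: N; exact: nbhs_infty_gt.
    have := @step_cases _ N.+1 (near_a a e N) (fun k => g_ N (position N k) * ratio N k)
      (position N) (mesh N) (fun x i j => @position_disj N x i j N0) x.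
    rewrite -/(f_ N x) => -[->|[k [kn kN /andP[kx xk] ->]]].
      by rewrite normr0 mulr_ge0 ?gauss_fun_ge0// mulr_ge0 ?expR_ge0// mulr_ge0.
    have /andP[r0 rB] : 0 <= ratio N k <= B * expR (c / 2 * position N k ^+ d).
      by move: (k) kN; near: N.
    have gk : `|g_ N (position N k)| <= K * expR (K * `|position N k|).
      by move: (position N k); near: N.
    have mesh1 : mesh N <= 1 by near: N; exact: mesh_le.
    rewrite normrM (ger0_norm r0).
    apply: (le_trans (ler_pM (normr_ge0 _) r0 gk rB)).
    have -> : K * expR (K * `|position N k|) * (B * expR (c / 2 * position N k ^+ d)) =
      K * B * (expR (K * `|position N k| + c / 2 * position N k ^+ d)).
      by rewrite expRD; ring.
    rewrite -(mulrA (K * B)) ler_wpM2l ?mulr_ge0// /gauss_fun -expRD ler_expR.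
    have := HM (position N k); set u := position N k in kx xk *; move=> Hu.
    have u4 : u ^+ 4 <= u ^+ d + 1 by exact: pow4_le_even.
    have xu : `|x| <= `|u| + 1.
      rewrite -[x](subrK u) addrC (le_trans (ler_normD _ _))// lerD2l.
      by rewrite ger0_norm ?subr_ge0//; lra.
    have x2 : x ^+ 2 <= (`|u| + 1) ^+ 2.
      by rewrite -(real_normK (num_real x)) lerXn2r// nnegrE addr_ge0.
    have c4 : - c / 2 * u ^+ 4 <= - c / 2 * u ^+ d + - c / 2.
      by rewrite -[X in _ + X]mulr1 -mulrDr ler_wpM2l// ltW.
    have -> : c / 2 * u ^+ d = - (- c / 2 * u ^+ d) by ring.
    rewrite lerBlDr; move: Hu x2 c4.
    move: (- c / 2 * u ^+ 4) (- c / 2 * u ^+ d) (x ^+ 2) ((`|u| + 1) ^+ 2) (K * `|u|) (- c / 2).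
    by move=> ? ? ? ? ? ?; lra.
  - move=> x xx0.
    pose k N := Num.truncn (N%:R * (a + m * x / scale N)).
    have y1 : \forall N \near \oo, `|m * x / scale N| <= Num.min (Num.min (a / 2) ((1 - a) / 2)) (e / 2).
      have z0 : 0 < Num.min (Num.min (a / 2) ((1 - a) / 2)) (e / 2).
        by rewrite !lt_min !divr_gt0// subr_gt0.
      near=> N; have N0 : (0 < N)%N by near: N; exact: nbhs_infty_gt.
      have g0 := scale_gt0 N0.
      rewrite normrM normfV (gtr0_norm g0) ler_pdivrMr// -ler_pdivrMl//.
      by near: N; exact: scale_pinfty.
    have kin : \forall N \near \oo, position N (k N) <= x < position N (k N) + mesh N.
      near=> N; have N0 : (0 < N)%N by near: N; exact: nbhs_infty_gt.
      rewrite position_itv//; apply: truncn_itv; rewrite mulr_ge0//.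
      have : `|m * x / scale N| <= Num.min (Num.min (a / 2) ((1 - a) / 2)) (e / 2) by near: N.
      rewrite !le_min => /andP[/andP[+ _] _]; rewrite ler_norml => /andP[+ _]; lra.
    have ux : position N (k N) @[N --> \oo] --> x.
      apply/cvgrPdist_le => r r0; near=> N.
      have /andP[k1 k2] : position N (k N) <= x < position N (k N) + mesh N by near: N.
      rewrite ger0_norm ?subr_ge0//.
      apply: (@le_trans _ _ (mesh N)); last by near: N; exact: mesh_le.
      by rewrite lerBlDl ltW.
    have main : g_ N (position N (k N)) * ratio N (k N) @[N --> \oo] --> g x * expR (c * x ^+ d).
      by apply: cvgM; [exact: gcvg|exact: ratio_cvg].
    apply: cvg_trans main; apply: near_eq_cvg; near=> N.
    have N0 : (0 < N)%N by near: N; exact: nbhs_infty_gt.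
    have kx : position N (k N) <= x < position N (k N) + mesh N by near: N.
    have NR0 : 0 < (N%:R : R) by rewrite ltr0n.
    have yN : `|m * x / scale N| <= Num.min (Num.min (a / 2) ((1 - a) / 2)) (e / 2) by near: N.
    have Ne : N%:R^-1 <= e / 2.
      rewrite invf_ple ?posrE ?divr_gt0//.
      by near: N; exact: nbhs_infty_ger.
    have kN : near_a a e N (k N).
      move: kx; rewrite position_itv// => /andP[k1 k2].
      move: yN; rewrite le_min => /andP[_]; rewrite ler_norml => /andP[y3 y4].
      have k1' : (k N)%:R / N%:R <= a + m * x / scale N by rewrite ler_pdivrMr// mulrC.
      have k2' : a + m * x / scale N <= (k N)%:R / N%:R + N%:R^-1.
        by rewrite -[X in _ <= _ + X]mul1r -mulrDl natr1 ler_pdivlMr// mulrC ltW.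
      by rewrite /near_a ler_distl; apply/andP; split; lra.
    rewrite /f_ /=; apply/esym; apply: step_at => //; first exact: (fun x i j => @position_disj N x i j N0).
    by rewrite ltnS; exact: (near_a_le1 N0 ea kN).
have [I1 I2] := near_sum; split => //.
(* Outside the window the crude bound [K exp (K N^(1/d) / m)] on the test function
   loses against the exponential decay of the weights. *)
have far_sum : mesh N * \sum_(k < N.+1 | ~~ near_a a e N k)
    g_ N (position N k) * ratio N k @[N --> \oo] --> (0 : R).
  have [eta eta0 farP] := tail e0.
  apply/cvgrPdist_le => r r0; near=> N; rewrite sub0r normrN.
  have N0 : (0 < N)%N by near: N; exact: nbhs_infty_gt.
  have NR0 : 0 < (N%:R : R) by rewrite ltr0n.
  have g0 := scale_gt0 N0.
  have mesh0 := mesh_gt0 N0.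
  have W0 : 0 < w N (k0 N) by apply: w_gt0; near: N; exact: k0_le.
  have F1 : \sum_(k < N.+1 | ~~ near_a a e N k) w N k <= expR (- (eta * N%:R)) * w N (k0 N).
    by near: N.
  have gm : forall k, (k <= N)%N -> `|g_ N (position N k)| <= K * expR (K * (scale N / m)).
    move=> k kN.
    have gk : `|g_ N (position N k)| <= K * expR (K * `|position N k|).
      by move: (position N k); near: N.
    apply: (le_trans gk); rewrite ler_wpM2l// ler_expR ler_wpM2l//.
    rewrite /position normrM normrM (gtr0_norm g0) normfV (gtr0_norm m_gt0).
    rewrite ler_wpM2r ?invr_ge0 ?(ltW m_gt0)// ler_piMr ?(ltW g0)//.
    have k1 : (k%:R / N%:R : R) <= 1 by rewrite ler_pdivrMr// mul1r ler_nat.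
    have k2 : 0 <= (k%:R / N%:R : R) by rewrite divr_ge0.
    by rewrite ler_norml; apply/andP; split; lra.
  rewrite normrM (gtr0_norm mesh0).
  apply: (@le_trans _ _ (mesh N * (K * expR (K * (scale N / m)) * expR (- (eta * N%:R))))).
    rewrite ler_wpM2l ?(ltW mesh0)//; apply: (le_trans (ler_norm_sum _ _ _)).
    apply: (@le_trans _ _ (\sum_(k < N.+1 | ~~ near_a a e N k)
       K * expR (K * (scale N / m)) / w N (k0 N) * w N k)).
      apply: ler_sum => k _; have kN : (k <= N)%N by rewrite -ltnS.
      have rk : 0 < ratio N k by apply: divr_gt0 => //; exact: w_gt0.
      rewrite normrM (gtr0_norm rk) mulrAC -[leRHS]mulrA -/(ratio N k).
      by rewrite ler_wpM2r ?(ltW rk)// gm.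
    rewrite -mulr_sumr.
    have A0 : 0 <= K * expR (K * (scale N / m)) / w N (k0 N).
      by rewrite divr_ge0 ?(ltW W0)// mulr_ge0 ?expR_ge0.
    apply: (le_trans (ler_wpM2l A0 F1)).
    by rewrite -(mulrA _ _ (_ * _)) (mulrCA _ (expR _)) mulVf ?mulr1// gt_eqF.
  have small : expR (K * (scale N / m)) * expR (- (eta * N%:R)) <= 1.
    rewrite -expRD -[leRHS]expR0 ler_expR subr_le0.
    have s2 : scale N ^+ 2 <= N%:R by near: N; exact: scale_sqr.
    apply: (@le_trans _ _ (eta * scale N ^+ 2)); last by rewrite ler_wpM2l ?(ltW eta0).
    rewrite mulrCA expr2 [leRHS]mulrCA ler_wpM2l ?(ltW g0)//.
    rewrite -ler_pdivrMl//; near: N; exact: scale_pinfty.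
  rewrite -mulrA; apply: (@le_trans _ _ (mesh N * (K * 1))).
    by rewrite ler_wpM2l ?(ltW mesh0)// ler_wpM2l.
  rewrite mulr1; apply: (@le_trans _ _ (mesh N * (K + 1))).
    by rewrite ler_wpM2l ?(ltW mesh0)// lerDl.
  rewrite -ler_pdivlMr ?ltr_wpDl//; near: N; apply: mesh_le.
  by rewrite divr_gt0// ltr_wpDl.
rewrite -[X in _ --> X]addr0; apply: cvg_trans (cvgD I2 far_sum).
apply: near_eq_cvg; near=> N => /=.
have N0 : (0 < N)%N by near: N; exact: nbhs_infty_gt.
rewrite fctE /f_ Rintegral_step ?mesh_gt0// -mulrDr; congr (_ * _).
by rewrite [RHS](bigID (fun k : 'I_N.+1 => near_a a e N k)).
Unshelve. all: by end_near. Qed.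

End laplace.
(** * The maximum likelihood estimate *)

Section likelihood.
Context {R : realType} (p q : nat) (q_gt1 : (1 < q)%N) (beta : R) (N : nat).
Hypothesis N_gt0 : (0 < N)%N.
Local Notation c1 := (color1 q_gt1).
Local Notation config := {ffun 'I_N -> 'I_q}.
Implicit Types (X Y : config).
Local Notation weight := (potts_weight p q_gt1 beta).

Let N0 : (N%:R : R) != 0. Proof. by rewrite pnatr_eq0 -lt0n. Qed.

Lemma weight_tilt (h h' : R) X :
  weight h' X = weight h X * expR ((h' - h) * (cnt X c1)%:R).
Proof.
rewrite /potts_weight -expRD xbarE; congr expR.
by rewrite -addrA; congr (_ + _); field.
Qed.

Definition mean_count1 (h : R) : R :=
  (\sum_(Y : config) weight h Y * xbar Y 0 c1) / \sum_(Y : config) weight h Y.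

Variable X : config.

Let dc Y : R := (cnt Y c1)%:R - (cnt X c1)%:R.

(** Up to a factor that does not depend on the field, [invL] is the inverse of the
    likelihood of [X]; it is convex, with derivative [dinvL]. *)
Let invL (h : R) : R := \sum_(Y : config) weight 0 Y * expR (h * dc Y).
Let dinvL (h : R) : R := \sum_(Y : config) weight 0 Y * (dc Y * expR (h * dc Y)).

Let weight0_gt0 Y : 0 < weight 0 Y. Proof. exact: weight_gt0. Qed.

Let invL_gt0 h : 0 < invL h.
Proof.
rewrite /invL (bigD1 X)//= ltr_pwDl ?mulr_gt0 ?expR_gt0// sumr_ge0// => Y _.
by rewrite mulr_ge0 ?expR_ge0// ltW.
Qed.

Let likelihoodE h : potts_pmf p q_gt1 beta h X = weight 0 X / invL h.
Proof.
rewrite /potts_pmf (weight_tilt 0) subr0.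
have -> : \sum_(Y : config) weight h Y = expR (h * (cnt X c1)%:R) * invL h.
  rewrite /invL mulr_sumr; apply: eq_bigr => Y _.
  rewrite (weight_tilt 0 h Y) subr0 /dc mulrBr expRB.
  move: (weight 0 Y) (expR (h * (cnt Y c1)%:R)) (expR_gt0 (h * (cnt X c1)%:R)).
  by move: (expR _) => e W f e0; field; rewrite gt_eqF.
have := invL_gt0 h; have := expR_gt0 (h * (cnt X c1)%:R).
by move: (expR _) (invL h) => u v u0 v0; field; rewrite !gt_eqF.
Qed.

Let mean_dinvL h : (xbar X 0 c1 <= mean_count1 h) = (0 <= dinvL h).
Proof.
have Z0 : 0 < \sum_(Y : config) weight h Y.
  rewrite (bigD1 X)//= ltr_pwDl ?weight_gt0// sumr_ge0// => Y _.
  exact/ltW/weight_gt0.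
rewrite /mean_count1 ler_pdivlMr//.
have -> : dinvL h = N%:R * expR (- h * (cnt X c1)%:R) *
    (\sum_(Y : config) weight h Y * xbar Y 0 c1 - xbar X 0 c1 * \sum_(Y : config) weight h Y).
  rewrite mulr_sumr -sumrB mulr_sumr; apply: eq_bigr => Y _.
  rewrite (weight_tilt 0 h) subr0 /dc !xbarE.
  have -> : expR (h * ((cnt Y c1)%:R - (cnt X c1)%:R)) =
     expR (- h * (cnt X c1)%:R) * expR (h * (cnt Y c1)%:R).
    by rewrite -expRD; congr expR; ring.
  by field.
by rewrite pmulr_rge0 ?subr_ge0// mulr_gt0 ?expR_gt0// ltr0n.
Qed.

Let tangent h h' : invL h + (h' - h) * dinvL h <= invL h'.
Proof.
rewrite /invL /dinvL mulr_sumr -big_split/=; apply: ler_sum => Y _.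
have -> : weight 0 Y * expR (h * dc Y) + (h' - h) * (weight 0 Y * (dc Y * expR (h * dc Y))) =
   weight 0 Y * (expR (h * dc Y) * (1 + (h' - h) * dc Y)) by ring.
rewrite ler_wpM2l ?(ltW (weight0_gt0 Y))//.
have -> : expR (h' * dc Y) = expR (h * dc Y) * expR ((h' - h) * dc Y).
  by rewrite -expRD; congr expR; ring.
by rewrite ler_wpM2l ?expR_ge0// expR_ge1Dx.
Qed.

(** Changing the colour of one site changes the count of colour 1 for a suitable
    choice of the new colour, so that the convexity is strict. *)
Let other : exists Y, dc Y != 0.
Proof.
pose c2 : 'I_q := Ordinal q_gt1.
pose i0 : 'I_N := Ordinal N_gt0.
pose s := if X i0 == c1 then c2 else c1.
exists (recolor X i0 s); rewrite subr_eq0 eqr_nat.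
have := cnt_recolor X i0 s c1; rewrite /s.
have c21 : (c2 == c1) = false by rewrite -val_eqE.
by case: (X i0 == c1) => /= H; apply/eqP => E; move: H; rewrite E ?c21 ?eqxx => /addnI.
Qed.

Let dinvL_incr h h' : h < h' -> dinvL h < dinvL h'.
Proof.
move=> hh'.
have le (y : R) : y * expR (h * y) <= y * expR (h' * y).
  have [y0|y0] := leP 0 y.
    by rewrite ler_wpM2l// ler_expR ler_wpM2r// ltW.
  by rewrite ler_nM2l// ler_expR ler_nM2r// ltW.
have [Y Y0] := other.
rewrite /dinvL (bigD1 Y)//= [ltRHS](bigD1 Y)//= ltr_leD//.
  rewrite ltr_pM2l//; have [y0|y0|y0] := ltgtP 0 (dc Y).
  - by rewrite ltr_pM2l// ltr_expR ltr_pM2r.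
  - by rewrite ltr_nM2l// ltr_expR ltr_nM2r.
  - by rewrite y0 eqxx in Y0.
by apply: ler_sum => Z _; rewrite ler_wpM2l ?(ltW (weight0_gt0 Z)).
Qed.

Let continuous_dinvL : continuous dinvL.
Proof.
move=> h; apply: cvg_rsum => Y _; apply: cvgM; first exact: cvg_cst.
apply: cvgM; first exact: cvg_cst.
apply: continuous_comp; last exact: continuous_expR.
by apply: cvgM; [exact: cvg_id|exact: cvg_cst].
Qed.

Let maximizes (h : R) := forall h'', potts_pmf p q_gt1 beta h'' X <= potts_pmf p q_gt1 beta h X.

Let maximizesE h : maximizes h <-> forall h'', invL h <= invL h''.
Proof.
split=> H h''; have := H h''; rewrite !likelihoodE ler_pM2l//.
  by rewrite lef_pV2 ?posrE.
by rewrite lef_pV2 ?posrE// => ?; apply: H.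
Qed.

Let zero_maximizes h : dinvL h = 0 -> maximizes h.
Proof.
move=> D0; apply/maximizesE => h''; have := tangent h h''.
by rewrite D0 mulr0 addr0.
Qed.

Let maximizes_le h h' : maximizes h -> (h <= h') = (0 <= dinvL h').
Proof.
move=> /maximizesE hmin.
have left x : x < h -> dinvL x <= 0.
  move=> xh; have := le_trans (tangent x h) (hmin x).
  by rewrite gerDl pmulr_rle0// subr_gt0.
have right x : h < x -> 0 <= dinvL x.
  move=> hx; have := le_trans (tangent x h) (hmin x).
  by rewrite gerDl nmulr_rle0// subr_lt0.
apply/idP/idP => [|D0].
  rewrite le_eqVlt => /predU1P[<-|]; last exact: right.
  rewrite leNgt; apply/negP => D0.
  have /nbhs_ballP[e /= e0 H] : \forall x \near h, dinvL x < 0.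
    have /cvgrPdist_lt/(_ (- dinvL h)) : dinvL x @[x --> h] --> dinvL h.
      exact: continuous_dinvL.
    rewrite oppr_gt0 => /(_ D0); apply: filterS => x.
    by rewrite ltr_norml => /andP[+ _]; lra.
  have he : h < h + e / 2 by rewrite ltrDl divr_gt0.
  have := right _ he; rewrite leNgt => /negP; apply; apply: H.
  rewrite /ball/= opprD addrA subrr sub0r normrN gtr0_norm ?divr_gt0//.
  by rewrite ltr_pdivrMr// ltr_pMr// ltr1n.
rewrite leNgt; apply/negP => h'h.
pose x := (h' + h) / 2.
have hx : h' < x by rewrite /x; lra.
have xh : x < h by rewrite /x; lra.
by have := dinvL_incr hx; have := left _ xh; lra.
Qed.

Let sign_cases : [\/ exists h, dinvL h = 0, forall h, dinvL h < 0 | forall h, 0 < dinvL h].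
Proof.
have [[h D0]|none] := pselect (exists h, dinvL h = 0); first by apply: Or31; exists h.
have nz h : dinvL h != 0 by apply/eqP => D0; apply: none; exists h.
have [[h D0]|npos] := pselect (exists h, 0 < dinvL h); last first.
  apply: Or32 => h; have := nz h; rewrite neq_lt => /orP[//|D0].
  by exfalso; apply: npos; exists h.
apply: Or33 => x; have := nz x; rewrite neq_lt => /orP[Dx|//].
have xh : x < h.
  have [//|] := ltP x h; rewrite le_eqVlt => /predU1P[hx|/dinvL_incr].
    by move: Dx; rewrite -hx => ?; lra.
  lra.
have [||c _ Dc] := @IVT R dinvL x h 0 (ltW xh).
- exact/continuous_subspaceT/continuous_dinvL.
- rewrite ge_min le_max; apply/andP; split; apply/orP; [left|right]; lra.
by have := nz c; rewrite Dc eqxx.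
Qed.

Local Notation L := (fun h => potts_pmf p q_gt1 beta h X).

Let L_le h : L h <= 1.
Proof.
rewrite /= likelihoodE ler_pdivrMr// mul1r /invL (bigD1 X)//= /dc subrr mulr0 expR0 mulr1.
by rewrite lerDl sumr_ge0// => Y _; rewrite mulr_ge0 ?expR_ge0// ltW.
Qed.

Let has_sup_L : has_sup (range L).
Proof.
split; first by exists (L 0), 0.
by exists 1 => _ [h _ <-]; exact: L_le.
Qed.

Let L_lt h h' : invL h' < invL h -> L h < L h'.
Proof. by move=> H /=; rewrite !likelihoodE ltr_pM2l// ltf_pV2 ?posrE. Qed.

Let L_mono_neg h h' : (forall x, dinvL x < 0) -> h < h' -> L h < L h'.
Proof.
move=> D hh'; apply: L_lt; apply: lt_le_trans (tangent h' h).
by rewrite ltrDl nmulr_rgt0 ?subr_lt0.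
Qed.

Let L_mono_pos h h' : (forall x, 0 < dinvL x) -> h < h' -> L h' < L h.
Proof.
move=> D hh'; apply: L_lt; apply: lt_le_trans (tangent h h').
by rewrite ltrDl pmulr_rgt0 ?subr_gt0.
Qed.

Let mle_exists : exists e, is_mle p q_gt1 beta X e.
Proof.
have sup_ub h : L h <= sup (range L) by apply: ub_le_sup; [case: has_sup_L|exists h].
have [[h D0]|D|D] := sign_cases.
- by exists h%:E; exact: zero_maximizes.
- exists +oo%E; split.
    move=> [h H]; have := H (h + 1); rewrite leNgt => /negP; apply.
    by apply: L_mono_neg => //; rewrite ltrDl.
  apply/cvgrPdist_le => e e0.
  have [_ [h0 _ <-] Lh0] := sup_adherent e0 has_sup_L.
  near=> h; rewrite ger0_norm ?subr_ge0//.
  have : L h0 < L h by apply: L_mono_neg => //; near: h; apply: nbhs_pinfty_gt; exact: num_real.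
  by rewrite lerBlDl; lra.
- exists -oo%E; split.
    move=> [h H]; have := H (h - 1); rewrite leNgt => /negP; apply.
    by apply: L_mono_pos => //; rewrite gtrDl oppr_lt0.
  apply/cvgrPdist_le => e e0.
  have [_ [h0 _ <-] Lh0] := sup_adherent e0 has_sup_L.
  near=> h; rewrite ger0_norm ?subr_ge0//.
  have : L h0 < L h by apply: L_mono_pos => //; near: h; apply: nbhs_ninfty_lt; exact: num_real.
  by rewrite lerBlDl; lra.
Unshelve. all: by end_near. Qed.

(** The inverse likelihood is strictly convex: its minimum is at most [h'] if and
    only if its derivative at [h'] is nonnegative, and this derivative has the
    sign of the mean proportion minus the observed one. Without a minimum the
    derivative has a constant sign, which tells the end where the supremum of the
    likelihood is approached. *)
Lemma mle_le h' : (mle p q_gt1 beta X <= h'%:E)%E = (xbar X 0 c1 <= mean_count1 h').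
Proof.
rewrite mean_dinvL.
have : is_mle p q_gt1 beta X (mle p q_gt1 beta X).
  by rewrite /mle; case: xgetP => [e -> //|none]; have [e] := mle_exists; move/none.
case: (mle p q_gt1 beta X) => [h /= hmax|[noM cvgL]|[noM cvgL]].
- by rewrite lee_fin; exact: maximizes_le.
- rewrite leye_eq; apply/esym/negbTE; rewrite -ltNge.
  have [[h D0]|//|D] := sign_cases.
    by exfalso; apply: noM; exists h; exact: zero_maximizes.
  exfalso.
  have : sup (range L) <= L 1.
    have LL := cvg_lim (@Rhausdorff R) cvgL; rewrite -LL.
    apply: limr_le; first by apply/cvg_ex; exists (sup (range L)).
    near=> h; have h1 : 1 < h by near: h; apply: nbhs_pinfty_gt; exact: num_real.
    exact/ltW/L_mono_pos.
  apply/negP; rewrite -ltNge; apply: (@lt_le_trans _ _ (L 0)).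
    exact: L_mono_pos.
  by apply: ub_le_sup; [case: has_sup_L|exists 0].
- rewrite leNye; apply/esym.
  have [[h D0]|D|D] := sign_cases; last exact: ltW.
    by exfalso; apply: noM; exists h; exact: zero_maximizes.
  exfalso.
  have : sup (range L) <= L 0.
    have LL := cvg_lim (@Rhausdorff R) cvgL; rewrite -LL.
    apply: limr_le; first by apply/cvg_ex; exists (sup (range L)).
    near=> h; have h1 : h < 0 by near: h; apply: nbhs_ninfty_lt; exact: num_real.
    exact/ltW/L_mono_neg.
  apply/negP; rewrite -ltNge; apply: (@lt_le_trans _ _ (L 1)).
    exact: L_mono_neg.
  by apply: ub_le_sup; [case: has_sup_L|exists 1].
Unshelve. all: by end_near. Qed.

End likelihood.
(** * Laws with density exp (c x^d + l x) *)

Section density_law.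
Context {R : realType}.
Local Notation mu := (@lebesgue_measure R).
Variable w : {poly R}.
Local Notation W := (fun x : R => expR w.[x]).
Hypothesis iW : mu.-integrable setT (EFin \o W).

Let cW : continuous W.
Proof.
by move=> x; apply: continuous_comp; [exact: continuous_horner|exact: continuous_expR].
Qed.

Let Z := \int[mu]_x W x.

(** The minimum of [g] on a segment of length one bounds the integral below. *)
Lemma Rintegral_gt0 (f g : R -> R) (u : R) : continuous g ->
  mu.-integrable setT (EFin \o f) -> (forall x, 0 <= f x) ->
  (forall x, u <= x <= u + 1 -> 0 < g x <= f x) -> 0 < \int[mu]_x f x.
Proof.
move=> cg intf f0 fpos.
have [||z zin zmin] := @EVT_min R g u (u + 1); first by rewrite lerDl.
  exact: continuous_subspaceT.
have /andP[gz _] : 0 < g z <= f z by apply: fpos; move: zin; rewrite in_itv.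
apply: (lt_le_trans gz).
have mf : measurable_fun setT (EFin \o f) by case/integrableP : intf.
have E1 : (\int[mu]_(x in `[u, (u + 1)%R]) (g z)%:E = (g z)%:E)%E.
  rewrite integral_cst//= lebesgue_measure_itv/= lte_fin ltrDl ltr01.
  by rewrite -EFinB addrAC subrr add0r mule1.
rewrite -lee_fin /Rintegral fineK; last exact: integrable_fin_num.
rewrite -E1.
apply: (@le_trans _ _ (\int[mu]_(x in `[u, (u + 1)%R]) (f x)%:E)%E).
  apply: ge0_le_integral => //.
  - by move=> x _; rewrite lee_fin ltW.
  - exact: measurable_funTS.
  - move=> x xin; rewrite lee_fin; apply: (le_trans (zmin x xin)).
    by move: xin; rewrite /= in_itv/= => /fpos/andP[].
by apply: ge0_subset_integral => //= x _; rewrite lee_fin.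
Qed.

Let Z_gt0 : 0 < Z.
Proof.
apply: (@Rintegral_gt0 W W 0 cW iW) => [x|x _]; first exact: expR_ge0.
by rewrite expR_gt0 lexx.
Qed.

Let ZE : (\int[mu]_x (W x)%:E)%E = Z%:E.
Proof. by rewrite /Z /Rintegral fineK//; exact: integrable_fin_num. Qed.

Local Notation P := (exp_poly_law w).

Lemma exp_poly_lawE A : P A = ((\int[mu]_(x in A) (W x)%:E) * (Z^-1)%:E)%E.
Proof.
rewrite /exp_poly_law /= /mnormalize /= /exp_poly_measure ZE.
by rewrite eqe (gt_eqF Z_gt0).
Qed.

Let pdf x := W x / Z.

Let ipdf : mu.-integrable setT (EFin \o pdf).
Proof.
have -> : EFin \o pdf = (fun x => (Z^-1)%:E * (W x)%:E)%E.
  by apply/funext => x; rewrite /= -EFinM mulrC.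
exact: integrableZl.
Qed.

Let lawE A : measurable A -> P A = (\int[mu]_(x in A) (pdf x)%:E)%E.
Proof.
move=> mA; rewrite exp_poly_lawE muleC -integralZl//.
  by apply: eq_integral => x _; rewrite -EFinM mulrC.
exact: integrableS iW.
Qed.

Let dom : P `<< mu.
Proof.
apply/null_content_dominatesP => A mA A0; rewrite lawE//.
apply: null_set_integral => //; apply: measurable_funTS.
by case/integrableP : ipdf.
Qed.

(** Integration against the law is integration against the density [pdf], its
    Radon-Nikodym derivative. *)
Lemma ge0_integral_law (f : R -> \bar R) : (forall x, (0 <= f x)%E) ->
  measurable_fun setT f ->
  (\int[P]_x f x = \int[mu]_x (f x * (pdf x)%:E))%E.
Proof.
move=> f0 mf.
rewrite -(Radon_Nikodym_SigmaFinite.change_of_variables dom f0 measurableT mf).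
have iR := Radon_Nikodym_SigmaFinite.f_integrable dom.
apply: ae_eq_integral => //.
- by apply: emeasurable_funM => //; exact: (measurable_int mu).
- by apply: emeasurable_funM => //; exact: (measurable_int mu ipdf).
- apply: ae_eqe_mul2l; apply: integral_ae_eq => //.
    exact: (measurable_int mu ipdf).
  move=> E _ mE; rewrite -Radon_Nikodym_SigmaFinite.f_integral//.
  exact: lawE.
Qed.

Lemma law_meanE : mu.-integrable setT (EFin \o (fun x => x * W x)) ->
  law_mean P = (\int[mu]_x (x * W x)) / Z.
Proof.
move=> ixW.
have mid : measurable_fun setT (EFin \o (@id R)) by exact/measurable_EFinP.
have pdf0 x : 0 <= pdf x by rewrite divr_ge0 ?expR_ge0// ltW.
rewrite -RintegralZr// /law_mean /Rintegral; congr fine.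
rewrite [LHS]integralE [RHS]integralE; congr (_ - _)%E.
  rewrite ge0_integral_law//; last exact: measurable_funepos.
  apply: eq_integral => x _; rewrite !funeposE /= -!EFin_max -EFinM; congr EFin.
  by rewrite -mulrA -[W x / Z]/(pdf x) maxr_pMl// mul0r.
rewrite ge0_integral_law//; last exact: measurable_funeneg.
apply: eq_integral => x _; rewrite !funenegE /= -!EFin_max -EFinM; congr EFin.
by rewrite -mulrA -[W x / Z]/(pdf x) -mulNr maxr_pMl// mul0r.
Qed.

Lemma distr_funE t :
  distr_fun P t = (\int[mu]_x ((x <= t)%R%:R * W x)) / Z.
Proof.
have it : mu.-integrable `]-oo, t]%classic (EFin \o W) by exact: integrableS iW.
rewrite /distr_fun exp_poly_lawE fineM//; last exact: integrable_fin_num.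
congr (_ * _); rewrite integral_mkcond; congr fine; apply: eq_integral => x _.
rewrite patchE; case: ifPn => [|]; rewrite ?in_itv/= ?inE/= ?notin_setE/= in_itv/=.
  by move=> ->; rewrite mul1r.
by move/negP/negbTE => ->; rewrite mul0r.
Qed.

End density_law.

Section exponential_laws.
Context {R : realType}.
Local Notation mu := (@lebesgue_measure R).
Variables (d : nat) (c : R).
Hypotheses (d_ge4 : (4 <= d)%N) (d_even : ~~ odd d) (c_lt0 : c < 0).

Definition dens (l x : R) : R := expR (l * x) * expR (c * x ^+ d).

Definition law_poly (l : R) : {poly R} := c *: 'X^d + l *: 'X.

Lemma expR_law_poly l x : expR (law_poly l).[x] = dens l x.
Proof. by rewrite /law_poly !hornerE expRD mulrC. Qed.

Lemma dens_gt0 l x : 0 < dens l x.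
Proof. by rewrite mulr_gt0// expR_gt0. Qed.

Lemma continuous_dens l : continuous (dens l).
Proof.
move=> x; apply: cvgM; (apply: continuous_comp; last exact: continuous_expR).
  by apply: cvgM; [exact: cvg_cst|exact: cvg_id].
by apply: cvgM; [exact: cvg_cst|exact: exprn_continuous].
Qed.

Lemma dens_dominated (K : R) : exists2 C, 0 <= C &
  forall l x, `|l| <= K -> (1 + `|x|) * dens l x <= C * gauss_fun x.
Proof.
have [K0|K0] := ltP K 0.
  by exists 0 => // l x lK; have := le_lt_trans lK K0; rewrite normr_lt0.
have cn : 0 < - c by rewrite oppr_gt0.
have K1 : 0 <= K + 1 by rewrite addr_ge0.
have [M HM] := quartic_dominates K1 cn.
exists (expR (M - c)); first exact: expR_ge0.
move=> l x lK; rewrite /dens mulrA.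
apply: (@le_trans _ _ (expR `|x| * expR (K * `|x|) * expR (c * x ^+ d))).
  rewrite ler_wpM2r ?expR_ge0// ler_pM ?expR_ge0 ?expR_ge1Dx// ler_expR.
  by apply: (le_trans (ler_norm _)); rewrite normrM ler_wpM2r.
rewrite /gauss_fun -!expRD ler_expR.
have x4 : x ^+ 4 <= x ^+ d + 1 by exact: pow4_le_even.
have c4 : - c * x ^+ 4 <= - (c * x ^+ d) + - c.
  by rewrite -mulNr -[X in _ + X]mulr1 -mulrDr ler_wpM2l// ltW.
have x2 : x ^+ 2 <= (`|x| + 1) ^+ 2.
  by rewrite -(real_normK (num_real x)) lerXn2r// ?nnegrE ?addr_ge0// lerDl.
have := HM x; rewrite mulrDl mul1r; move: x2 c4.
move: (- c * x ^+ 4) (c * x ^+ d) (x ^+ 2) ((`|x| + 1) ^+ 2) (K * `|x|) `|x|.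
by move=> ? ? ? ? ? ?; lra.
Qed.

(** One Gaussian dominates the densities for all tilts in a bounded set. *)
Lemma dens_cvg (B x0 l : R) (f_ : nat -> R -> R) (f : R -> R) (l_ : nat -> R) :
  (forall n, measurable_fun setT (f_ n)) -> measurable_fun setT f ->
  (forall n x, `|f_ n x| <= B * (1 + `|x|)) ->
  l_ n @[n --> \oo] --> l ->
  (forall x, x != x0 -> f_ n x @[n --> \oo] --> f x) ->
  mu.-integrable setT (EFin \o (fun x => f x * dens l x)) /\
  \int[mu]_x (f_ n x * dens (l_ n) x) @[n --> \oo] --> \int[mu]_x (f x * dens l x).
Proof.
move=> mf_ mf fB ll ff.
have B0 : 0 <= B.
  have := fB 0%N 0; rewrite normr0 addr0 mulr1; exact: le_trans.
have [C C0 HC] := dens_dominated (`|l| + 1).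
have md l' : measurable_fun setT (dens l').
  by apply: continuous_measurable_fun; exact: continuous_dens.
have l1 : \forall n \near \oo, `|l_ n| <= `|l| + 1.
  move/cvgrPdist_le : ll => /(_ 1 ltr01); apply: filterS => n H.
  by rewrite -[l_ n](subKr l) (le_trans (ler_normB _ _))// lerD2l.
apply: (@dominated_cvg_gauss _ (fun n x => f_ n x * dens (l_ n) x) _ (B * C) x0).
- by move=> n; exact: measurable_funM.
- exact: measurable_funM.
- near=> n => x; rewrite normrM (ger0_norm (ltW (dens_gt0 _ _))).
  apply: (@le_trans _ _ (B * (1 + `|x|) * dens (l_ n) x)).
    by rewrite ler_wpM2r ?(ltW (dens_gt0 _ _)).
  rewrite -!mulrA ler_wpM2l//; apply: HC.
  by near: n.
- move=> x xx0; apply: cvgM; first exact: ff.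
  apply: cvgM; last exact: cvg_cst.
  apply: (cvg_comp _ _ (_ : l_ n * x @[n --> \oo] --> l * x) (@continuous_expR R (l * x))).
  by apply: cvgM => //; exact: cvg_cst.
Unshelve. all: by end_near. Qed.

Lemma dens_integrable (B l : R) (f : R -> R) : measurable_fun setT f ->
  (forall x, `|f x| <= B * (1 + `|x|)) ->
  mu.-integrable setT (EFin \o (fun x => f x * dens l x)).
Proof.
move=> mf fB.
have [] // := @dens_cvg B 0 l (fun=> f) f (fun=> l) (fun=> mf) mf (fun=> fB).
- exact: cvg_cst.
- by move=> x _; exact: cvg_cst.
Qed.

(** The factor [1] in [mass] gives the three integrals the common form to which
    [dens_cvg] applies. *)
Definition mass (l : R) : R := \int[mu]_x (1 * dens l x).
Definition moment1 (l : R) : R := \int[mu]_x (x * dens l x).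
Definition below (l t : R) : R := \int[mu]_x ((x <= t)%R%:R * dens l x).
Definition tilted_mean (l : R) : R := moment1 l / mass l.

Let b1 x : `|1 : R| <= 1 * (1 + `|x : R|).
Proof. by rewrite normr1 mul1r lerDl. Qed.
Let bx x : `|x : R| <= 1 * (1 + `|x|).
Proof. by rewrite mul1r lerDr. Qed.

Let i1 l : mu.-integrable setT (EFin \o (fun x => 1 * dens l x)).
Proof. by apply: (dens_integrable _ (measurable_cst _) b1). Qed.
Let ix l : mu.-integrable setT (EFin \o (fun x => x * dens l x)).
Proof. by apply: (dens_integrable _ (@measurable_id _ _ setT) bx). Qed.

Lemma mass_gt0 l : 0 < mass l.
Proof.
apply: (@Rintegral_gt0 _ (fun x => 1 * dens l x) (fun x => 1 * dens l x) 0 _ (i1 l)) => [x|x|x _].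
- by apply: cvgM; [exact: cvg_cst|exact: continuous_dens].
- by rewrite mul1r ltW// dens_gt0.
- by rewrite lexx mul1r dens_gt0.
Qed.

Let iW l : mu.-integrable setT (EFin \o (fun x : R => expR (law_poly l).[x])).
Proof.
have -> : (fun x : R => expR (law_poly l).[x]) = (fun x => 1 * dens l x).
  by apply/funext => x; rewrite expR_law_poly mul1r.
exact: i1.
Qed.

Let massE l : \int[mu]_x expR (law_poly l).[x] = mass l.
Proof. by apply: eq_Rintegral => x _; rewrite expR_law_poly mul1r. Qed.

Lemma law_mean_exp l : law_mean (exp_poly_law (law_poly l)) = tilted_mean l.
Proof.
rewrite law_meanE//; last first.
  have -> : (fun x : R => x * expR (law_poly l).[x]) = (fun x => x * dens l x).
    by apply/funext => x; rewrite expR_law_poly.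
  exact: ix.
rewrite massE; congr (_ / _); apply: eq_Rintegral => x _.
by rewrite expR_law_poly.
Qed.

Lemma distr_fun_exp l t : distr_fun (exp_poly_law (law_poly l)) t = below l t / mass l.
Proof.
rewrite distr_funE// massE; congr (_ / _); apply: eq_Rintegral => x _.
by rewrite expR_law_poly.
Qed.

End exponential_laws.
(** * Tilted means and the limit distribution function *)

Section cdf_existence.
Context {R : realType} (G : R -> R).
Hypotheses (nd : nondecreasing G) (rc : right_continuous G).
Hypotheses (GNy : G @ -oo --> (0 : R)) (Gy : G @ +oo --> (1 : R)).

HB.instance Definition _ := isCumulative.Build R _ R G nd rc.
HB.instance Definition _ := isCumulativeBounded.Build R 0 1 G GNy Gy.

(** The Lebesgue-Stieltjes measure of a distribution function. *)
Lemma probability_of_cdf : exists P : probability (measurableTypeR R) R,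
  forall t, distr_fun P t = G t.
Proof.
exists (lebesgue_stieltjes_measure G : probability _ _) => t.
have := cdf_lebesgue_stieltjes_id G t.
by rewrite /cdf /distribution /pushforward /distr_fun /= => ->.
Qed.

End cdf_existence.

Section tilted_means.
Context {R : realType}.
Local Notation mu := (@lebesgue_measure R).
Variables (d : nat) (c : R).
Hypotheses (d_ge4 : (4 <= d)%N) (d_even : ~~ odd d) (c_lt0 : c < 0).
Local Notation dens := (dens d c).
Local Notation mass := (mass d c).
Local Notation moment1 := (moment1 d c).
Local Notation below := (below d c).
Local Notation tilted_mean := (tilted_mean d c).
Let mass_pos := mass_gt0 d_ge4 d_even c_lt0.

Let b1 (x : R) : `|1 : R| <= 1 * (1 + `|x|).
Proof. by rewrite normr1 mul1r lerDl. Qed.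
Let bx (x : R) : `|x| <= 1 * (1 + `|x|).
Proof. by rewrite mul1r lerDr. Qed.
Let mid : measurable_fun setT (@id R) := @measurable_id _ _ setT.

Let ix l := dens_integrable d_ge4 d_even c_lt0 l mid bx.
Let i1 l := dens_integrable d_ge4 d_even c_lt0 l (@measurable_cst _ _ _ _ setT (1 : R)) b1.

Lemma mass_cvg (l_ : nat -> R) l : l_ n @[n --> \oo] --> l ->
  mass (l_ n) @[n --> \oo] --> mass l.
Proof.
move=> ll; have [|_ //] := @dens_cvg R d c d_ge4 d_even c_lt0 1 0 l (fun _ _ => 1) (fun=> 1) l_
  (fun=> measurable_cst _) (measurable_cst _) (fun=> b1) ll.
  by move=> x _; exact: cvg_cst.
Qed.

Lemma moment1_cvg (l_ : nat -> R) l : l_ n @[n --> \oo] --> l ->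
  moment1 (l_ n) @[n --> \oo] --> moment1 l.
Proof.
move=> ll; have [|_ //] := @dens_cvg R d c d_ge4 d_even c_lt0 1 0 l (fun _ x => x) id l_
  (fun=> mid) mid (fun=> bx) ll.
  by move=> x _; exact: cvg_cst.
Qed.

Lemma tilted_mean_cvg (l_ : nat -> R) l : l_ n @[n --> \oo] --> l ->
  tilted_mean (l_ n) @[n --> \oo] --> tilted_mean l.
Proof.
move=> ll; apply: cvgM; first exact: moment1_cvg.
by apply: cvgV; [rewrite gt_eqF//; exact: mass_pos|exact: mass_cvg].
Qed.

Let measurable_below (t : R) : measurable_fun setT (fun x : R => (x <= t)%R%:R : R).
Proof.
have -> : (fun x : R => (x <= t)%R%:R) = \1_(`]-oo, t]%classic) :> (R -> R).
  by apply/funext => x; rewrite indicE mem_setE in_itv.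
exact: measurable_indic.
Qed.

Let below_le (t x : R) : `|(x <= t)%R%:R : R| <= 1 * (1 + `|x|).
Proof.
apply: le_trans (b1 x); rewrite normr1 ger0_norm ?ler0n// lern1; exact: leq_b1.
Qed.

Lemma below_cvg (t_ : nat -> R) t : t_ n @[n --> \oo] --> t ->
  below 0 (t_ n) @[n --> \oo] --> below 0 t.
Proof.
move=> tt; have [||_ //] := @dens_cvg R d c d_ge4 d_even c_lt0 1 t 0 (fun n x => (x <= t_ n)%R%:R)
  (fun x => (x <= t)%R%:R) (fun=> 0) (fun=> measurable_below _) (measurable_below _)
  (fun n => below_le (t_ n)).
- exact: cvg_cst.
- move=> x xt; apply: cvg_near_cst.
  move: xt; rewrite neq_lt => /orP[xt|tx].
    near=> n; have : x < t_ n by near: n; apply: (cvgr_gt t) => //.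
    by move=> /ltW ->; rewrite ltW.
  near=> n; have : t_ n < x by near: n; apply: (cvgr_lt t) => //.
  by rewrite ltNge => /negbTE ->; rewrite leNgt tx.
Unshelve. all: by end_near. Qed.

Lemma below_cvgy (t_ : nat -> R) : t_ n @[n --> \oo] --> +oo ->
  below 0 (t_ n) @[n --> \oo] --> mass 0.
Proof.
move=> /cvgryPge tt.
have [||_ //] := @dens_cvg R d c d_ge4 d_even c_lt0 1 0 0 (fun n x => (x <= t_ n)%R%:R)
  (fun=> 1) (fun=> 0) (fun=> measurable_below _) (measurable_cst _)
  (fun n => below_le (t_ n)).
- exact: cvg_cst.
- move=> x _; apply: cvg_near_cst; near=> n.
  by have -> : x <= t_ n by near: n; exact: tt.
Unshelve. all: by end_near. Qed.

Lemma below_cvgNy (t_ : nat -> R) : t_ n @[n --> \oo] --> -oo ->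
  below 0 (t_ n) @[n --> \oo] --> (0 : R).
Proof.
move=> /cvgrNyPlt tt.
have E : \int[mu]_x (0 * dens 0 x) = 0.
  by under eq_Rintegral do rewrite mul0r; rewrite /Rintegral integral0.
have [||_]  := @dens_cvg R d c d_ge4 d_even c_lt0 1 0 0 (fun n x => (x <= t_ n)%R%:R)
  (fun=> 0) (fun=> 0) (fun=> measurable_below _) (measurable_cst _)
  (fun n => below_le (t_ n)).
- exact: cvg_cst.
- move=> x _; apply: cvg_near_cst; near=> n.
  have : t_ n < x by near: n; exact: tt.
  by rewrite ltNge => /negbTE ->.
- by rewrite E.
Unshelve. all: by end_near. Qed.

Lemma below_mono s t : s <= t -> below 0 s <= below 0 t.
Proof.
move=> st; apply: le_Rintegral => //.
- exact: (dens_integrable d_ge4 d_even c_lt0 0 (measurable_below s) (below_le s)).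
- exact: (dens_integrable d_ge4 d_even c_lt0 0 (measurable_below t) (below_le t)).
- move=> x _; rewrite ler_wpM2r ?(ltW (dens_gt0 _ _ _ _))// ler_nat.
  by case: (leP x s) => // xs; rewrite (le_trans xs st).
Qed.

(** With [M] the mean at tilt [l], the tilt by [l' - l] multiplies the density by a
    nondecreasing function, and [x - M] has the same sign as the difference of
    the values of this function at [x] and at [M]. *)
Lemma tilted_mean_mono l l' : l <= l' -> tilted_mean l <= tilted_mean l'.
Proof.
move=> ll'; set M := tilted_mean l.
rewrite /tilted_mean ler_pdivlMr ?mass_pos//.
have E (k : R) : moment1 k - M * mass k = \int[mu]_x ((x - M) * dens k x).
  rewrite /moment1 /mass -RintegralZl// -RintegralB//.
    by apply: eq_Rintegral => x _; rewrite mul1r mulrBl.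
  exact: (integrableZl measurableT M (i1 k)).
have E0 : moment1 l - M * mass l = 0.
  by rewrite /M /tilted_mean divfK ?subrr// gt_eqF// mass_pos.
rewrite -subr_ge0 E.
have bM (x : R) : `|x - M| <= (1 + `|M|) * (1 + `|x|).
  apply: (le_trans (ler_normB _ _)).
  have := mulr_ge0 (normr_ge0 M) (normr_ge0 x).
  by move: `|M| `|x| => u v; nra.
have mM : measurable_fun setT (fun x : R => x - M).
  by apply: measurable_funB => //; exact: measurable_cst.
have iM k := dens_integrable d_ge4 d_even c_lt0 k mM bM.
have -> : 0 = expR ((l' - l) * M) * \int[mu]_x ((x - M) * dens l x).
  by rewrite -E E0 mulr0.
rewrite -RintegralZl//; apply: le_Rintegral => //.
  exact: (integrableZl measurableT (expR ((l' - l) * M)) (iM l)).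
move=> x _; have -> : dens l' x = expR ((l' - l) * x) * dens l x.
  by rewrite /dens mulrA -(expRD ((l' - l) * x)); congr (expR _ * _); ring.
set D := dens l x; have D0 : 0 <= D by exact/ltW/dens_gt0.
rewrite [leLHS](_ : _ = (x - M) * expR ((l' - l) * M) * D); last by ring.
rewrite [leRHS]mulrA ler_wpM2r//.
have [xM|Mx] := leP x M.
  by rewrite ler_wnM2l ?subr_le0// ler_expR ler_wpM2l ?subr_ge0.
by rewrite ler_wpM2l ?subr_ge0 ?(ltW Mx)// ler_expR ler_wpM2l ?subr_ge0// ltW.
Qed.

Lemma Rintegral_opp (f : R -> R) : mu.-integrable setT (EFin \o f) ->
  \int[mu]_x f (- x) = \int[mu]_x f x.
Proof.
move=> intf; have mf : measurable_fun setT (EFin \o f) by case/integrableP : intf.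
rewrite /Rintegral; congr fine.
have mN : measurable_fun setT (-%R : R -> measurableTypeR R) by exact: oppr_measurable.
have E := eq_measure_integral (D := setT) (m1 := pushforward mu (-%R : R -> measurableTypeR R)) mu
  (f := EFin \o f) (fun A mA _ => lebesgue_measureN mA).
rewrite -E integral_pushforward//.
apply/integrableP; split; first exact: measurableT_comp.
move/integrableP : (intf) => [_].
rewrite -(eq_measure_integral (m1 := pushforward mu (-%R : R -> measurableTypeR R)) mu
  (fun A mA _ => lebesgue_measureN mA)).
rewrite ge0_integral_pushforward//.
exact: measurableT_comp.
Qed.

Let dens_opp l x : dens (- l) x = dens l (- x).
Proof.
rewrite /dens mulNr -mulrN; congr (_ * expR (_ * _)).
by rewrite exprNn -signr_odd (negPf d_even) expr0 mul1r.
Qed.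

Lemma tilted_mean_opp l : tilted_mean (- l) = - tilted_mean l.
Proof.
rewrite /tilted_mean -mulNr; congr (_ / _).
  rewrite /moment1 -(Rintegral_opp (ix l)) -mulN1r -RintegralZl//.
    by apply: eq_Rintegral => x _; rewrite dens_opp; ring.
  have := integrableN (ix (- l)); apply: eq_integrable => // x _ /=.
  by rewrite dens_opp mulNr.
rewrite /mass -(Rintegral_opp (i1 l)).
by apply: eq_Rintegral => x _; rewrite dens_opp.
Qed.

(** The tilt overcomes any barrier [K]: with [y = x - K], the tilted factor
    satisfies [y exp(l y) >= l 1_(y > 1) - |y|]. *)
Lemma tilted_mean_unbounded K : exists L, forall l, L <= l -> K <= tilted_mean l.
Proof.
pose tl (x : R) : R := 1 - (x <= K + 1)%R%:R.
have tl01 x : 0 <= tl x <= 1.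
  by rewrite /tl; case: (x <= K + 1); rewrite ?subr0 ?subrr ler01 lexx.
have mtl : measurable_fun setT tl.
  by apply: measurable_funB => //; exact: measurable_below.
have btl x : `|tl x| <= 1 * (1 + `|x|).
  have /andP[t0 t1] := tl01 x; rewrite ger0_norm// mul1r (le_trans t1)// lerDl//.
have itl := dens_integrable d_ge4 d_even c_lt0 0 mtl btl.
have bK x : `|(`|x - K| : R)| <= (1 + `|K|) * (1 + `|x|).
  rewrite normr_id; apply: (le_trans (ler_normB _ _)).
  have := mulr_ge0 (normr_ge0 K) (normr_ge0 x).
  by move: `|K| `|x| => u v; nra.
have mK : measurable_fun setT (fun x : R => x - K).
  by apply: measurable_funB => //; exact: measurable_cst.
have mKn : measurable_fun setT (fun x : R => `|x - K|) by exact: measurableT_comp.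
have iK := dens_integrable d_ge4 d_even c_lt0 0 mKn bK.
pose B := \int[mu]_x (tl x * dens 0 x).
pose A := \int[mu]_x (`|x - K| * dens 0 x).
have B0 : 0 < B.
  apply: (@Rintegral_gt0 _ _ (dens 0) (K + 2) _ itl) => [|x|x /andP[Kx _]].
  - exact: continuous_dens.
  - by have /andP[t0 _] := tl01 x; rewrite mulr_ge0// ltW// dens_gt0.
  - have Kx1 : K + 1 < x by apply: lt_le_trans Kx; rewrite ltrD2l (ltr_nat R 1 2).
    by rewrite dens_gt0/= /tl (lt_geF Kx1) subr0 mul1r.
exists (Num.max 0 (A / B)) => l; rewrite ge_max => /andP[l0 lAB].
rewrite /tilted_mean ler_pdivlMr ?mass_pos// -subr_ge0.
have bK' (x : R) : `|x - K| <= (1 + `|K|) * (1 + `|x|) by have := bK x; rewrite normr_id.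
have iK' := dens_integrable d_ge4 d_even c_lt0 l mK bK'.
have -> : moment1 l - K * mass l = \int[mu]_x ((x - K) * dens l x).
  rewrite /moment1 /mass -RintegralZl// -RintegralB//.
    by apply: eq_Rintegral => x _; rewrite mul1r mulrBl.
  exact: (integrableZl measurableT K (i1 l)).
have low : 0 <= expR (l * K) * (l * B - A).
  by rewrite mulr_ge0 ?expR_ge0// subr_ge0 -ler_pdivrMr.
apply: (le_trans low).
have iD := integrableB measurableT (integrableZl measurableT l itl) iK.
have E : expR (l * K) * (l * B - A) =
   \int[mu]_x (expR (l * K) * (l * (tl x * dens 0 x) - `|x - K| * dens 0 x)).
  rewrite RintegralZl; [|exact: measurableT|exact: iD].
  congr (_ * _); rewrite RintegralB// ?RintegralZl//.
  exact: (integrableZl measurableT l itl).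
rewrite E; apply: le_Rintegral => //.
  exact: (integrableZl measurableT (expR (l * K)) iD).
move=> x _.
have -> : (x - K) * dens l x = expR (l * K) * ((x - K) * expR (l * (x - K)) * dens 0 x).
  rewrite /dens mul0r expR0 mul1r mulrBr expRB.
  by have := expR_gt0 (l * K); move: (expR (l * K)) => e e0; field; rewrite gt_eqF.
rewrite ler_wpM2l ?expR_ge0// [l * _]mulrA -mulrBl ler_wpM2r ?(ltW (dens_gt0 _ _ _ _))//.
set y := x - K.
have [y0|y0] := leP 0 y.
  rewrite ger0_norm//.
  have e1 : 1 + l * y <= expR (l * y) by exact: expR_ge1Dx.
  have : y * (1 + l * y) <= y * expR (l * y) by rewrite ler_wpM2l.
  have : l * tl x <= l * (y * y).
    rewrite ler_wpM2l// /tl; case: (leP x (K + 1)) => xK /=; first by rewrite subrr mulr_ge0.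
    have : 1 <= y by rewrite /y; lra.
    by rewrite subr0; nra.
  by move: (y * expR (l * y)) (l * tl x) => u v; nra.
have -> : tl x = 0.
  by rewrite /tl (_ : x <= K + 1) ?subrr//; move: y0; rewrite /y; lra.
rewrite mulr0 sub0r ltr0_norm// opprK.
have e1 : expR (l * y) <= 1 by rewrite -[leRHS]expR0 ler_expR mulr_ge0_le0 ?(ltW y0).
by rewrite -[leLHS]mulr1 ler_nM2l.
Qed.

Variables (m : R) (m_gt0 : 0 < m).

(** The limit of the distribution function of the rescaled estimate: the
    probability, without tilt, of lying below the mean under the tilt [m t]. *)
Definition limit_cdf (t : R) : R := below 0 (tilted_mean (m * t)) / mass 0.

Lemma limit_cdf_probability : exists P : probability (measurableTypeR R) R,
  forall t, distr_fun P t = limit_cdf t.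
Proof.
have cvg_seq (u : nat -> R) t : u n @[n --> \oo] --> t ->
    limit_cdf (u n) @[n --> \oo] --> limit_cdf t.
  move=> ut; apply: cvgM; last exact: cvg_cst.
  apply: below_cvg; apply: tilted_mean_cvg.
  by apply: cvgM => //; exact: cvg_cst.
have unb (u : nat -> R) : u n @[n --> \oo] --> +oo -> tilted_mean (m * u n) @[n --> \oo] --> +oo.
  move=> /cvgryPge uy; apply/cvgryPge => K.
  have [L HL] := tilted_mean_unbounded K; near=> n; apply: HL.
  by rewrite -ler_pdivrMl//; near: n; exact: uy.
apply: probability_of_cdf.
- move=> s t st; apply: ler_wpM2r; first by rewrite invr_ge0 ltW// mass_pos.
  by apply: below_mono; apply: tilted_mean_mono; rewrite ler_pM2l.
- by move=> t; apply/cvg_at_rightP => u [_ ut]; exact: cvg_seq.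
- apply/cvg_ninftyP => u uNy.
  have : tilted_mean (m * u n) @[n --> \oo] --> -oo.
    have -> : (fun n => tilted_mean (m * u n)) = (fun n => - tilted_mean (m * - u n)).
      by apply/funext => n; rewrite mulrN tilted_mean_opp opprK.
    by apply/cvgNrNy; apply: unb; apply/cvgNry.
  move=> /below_cvgNy H; rewrite -[X in _ --> X](mul0r (mass 0)^-1).
  by apply: cvgM => //; exact: cvg_cst.
- apply/cvg_pinftyP => u uy.
  have := below_cvgy (unb _ uy) => H.
  rewrite -[X in _ --> X](divff (lt0r_neq0 (mass_pos 0))).
  by apply: cvgM => //; exact: cvg_cst.
Unshelve. all: by end_near. Qed.

End tilted_means.
(** * Derivatives at a special point *)

Section second_order.
Context {R : realType} (p q : nat) (p_gt1 : (1 < p)%N) (q_gt1 : (1 < q)%N).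
Variables (beta h : R).
Hypotheses (beta_gt0 : 0 < beta).
Local Notation c1 := (color1 q_gt1).
Local Notation m := (q.-1%:R : R).
Local Notation eta := (etad beta p).
Local Notation F := (segment_deriv p q beta h).

Let m_ge1 : 1 <= m. Proof. by rewrite ler1n -subn1 subn_gt0. Qed.
Let m_gt0 : 0 < m. Proof. exact: lt_le_trans m_ge1. Qed.

(** Up to a power of [x], the derivatives of order at least two of the function of
    one colour are affine in this quantity ([etad_interaction]), so that the
    conditions at a special point become linear equations. *)
Definition interaction (x : R) : R := beta * p%:R * p.-1%:R * x ^+ p.-1.

Lemma interaction_gt0 x : 0 < x -> 0 < interaction x.
Proof.
move=> x0; rewrite /interaction !mulr_gt0 ?exprn_gt0 ?ltr0n//; first exact: ltnW.
by rewrite -subn1 subn_gt0.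
Qed.

Lemma etad_interaction k x : 0 < x ->
  eta k.+2 x = (interaction x * ((p - 2) ^_ k)%:R + (-1) ^+ k.+1 * k`!%:R) / x ^+ k.+1.
Proof.
rewrite /interaction /etad => x0; rewrite mulrDl; congr (_ + _).
have xk : x ^+ k.+1 != 0 by rewrite expf_neq0// gt_eqF.
move: p_gt1; case: (p) => [|[|n]]// _; rewrite !subn2/= !ffactSS.
have [kn|kn] := leqP k n; last first.
  by rewrite (ffact_small kn) !(muln0, mulr0, mul0r).
have -> : x ^+ n.+1 = x ^+ (n - k) * x ^+ k.+1 by rewrite -exprD addnS subnK.
by rewrite !subSS !natrM; move: (x ^+ k.+1) xk => e e0; field.
Qed.

Section critical_point.
Variables (v : 'rV[R]_q) (a b : R).
Hypotheses (va : v 0 c1 = a) (vb : forall r, r != c1 -> v 0 r = b).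
Hypotheses (a_gt0 : 0 < a) (b_gt0 : 0 < b) (ab1 : a + m * b = 1) (ba : b <= a).
Hypothesis vmax : unique_maximizer p q_gt1 beta h v.

Let bE : (1 - a) / m = b.
Proof. by rewrite -[X in X - _]ab1 addrAC subrr add0r mulrC mulKf// gt_eqF. Qed.

Let a_lt1 : a < 1.
Proof. by rewrite -[X in _ < X]ab1 ltrDl mulr_gt0. Qed.

Let a01 : 0 < a < 1. Proof. by rewrite a_gt0. Qed.

Let card_rest (x : R) : \sum_(r < q | r != c1) x = m * x.
Proof. by rewrite sumr_const cardC1 card_ord mulr_natl. Qed.

(** The segment of these vectors passes through the maximizer, so that [F] inherits
    a maximum at [a]. *)
Lemma Hfun_segment (w : 'rV[R]_q) (x : R) :
  w 0 c1 = x -> (forall r, r != c1 -> w 0 r = (1 - x) / m) ->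
  Hfun p q_gt1 beta h w = F 0 x.
Proof.
move=> w1 wr; rewrite /Hfun !(bigD1 (P := xpredT) c1)//= w1.
rewrite (eq_bigr (fun=> ((1 - x) / m) ^+ p)) => [|r /wr ->//].
rewrite [in X in _ - X](eq_bigr (fun=> (1 - x) / m * ln ((1 - x) / m))) => [|r /wr ->//].
rewrite !card_rest /segment_deriv /etad ffactn0 expr0 subn0; ring.
Qed.

Lemma segment_max : \forall x \near a, F 0 x <= F 0 a.
Proof.
have [_ vm] := vmax.
have Ha : Hfun p q_gt1 beta h v = F 0 a.
  by apply: Hfun_segment => // r rc; rewrite vb// bE.
near=> x.
have x0 : 0 < x by near: x; exact: lt_nbhsr.
have x1 : x < 1 by near: x; exact: lt_nbhsl.
pose w : 'rV[R]_q := \row_r (if r == c1 then x else (1 - x) / m).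
have wx : w 0 c1 = x by rewrite mxE eqxx.
have wr r : r != c1 -> w 0 r = (1 - x) / m by rewrite mxE => /negbTE ->.
rewrite -(Hfun_segment wx wr) -Ha.
have [->//|/eqP wv] := eqVneq w v.
apply/ltW/vm => //; split => [r|].
  by rewrite mxE; case: ifP => _; rewrite ?divr_ge0// ltW// subr_gt0.
rewrite (bigD1 c1)//= wx (eq_bigr (fun=> (1 - x) / m)) => [|r /wr//].
by rewrite card_rest mulrC divfK ?gt_eqF// addrC subrK.
Unshelve. all: by end_near. Qed.

Lemma local_max_F n : (0 < n)%N -> (forall i, (0 < i < n)%N -> F i a = 0) ->
  F n a <= 0 /\ (odd n -> F n a = 0).
Proof.
move=> n0 Fi; apply: (@local_max_taylor R F 0 1 a n a01 n0) => //.
- by move=> i z _ z01; exact: is_derive_segment.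
- apply: differentiable_continuous; apply/derivable1_diffP.
  by have [] := is_derive_segment p q_gt1 beta h n a01.
- exact: segment_max.
Qed.

Lemma F1_eq0 : F 1 a = 0.
Proof. by have [|_ ->//] := @local_max_F 1 isT; move=> [|[]]. Qed.

Lemma F2_le0 : F 2 a <= 0.
Proof.
by have [|//] := @local_max_F 2 isT; move=> [|[|[]]]// _; exact: F1_eq0.
Qed.

Lemma crit_eq : beta * p%:R * a ^+ p.-1 + h - ln a = beta * p%:R * b ^+ p.-1 - ln b.
Proof.
have := F1_eq0; rewrite /segment_deriv /etad bE ffactn1 subn1 expr1 mulrN divff ?gt_eqF//.
by move=> H; apply/eqP; rewrite -subr_eq0 -H; apply/eqP; ring.
Qed.

Definition rest_sum (t : 'rV[R]_q) : R := \sum_(r < q | r != c1) (t 0 r + t 0 c1 / m) ^+ 2.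

(** The variance decomposition of the coordinates other than the first: the
    quadratic form separates the direction of the segment from the vectors with
    zero first coordinate. *)
Lemma Qform_split t : sum_zero t ->
  Qform p v beta t = F 2 a * t 0 c1 ^+ 2 + eta 2 b * rest_sum t.
Proof.
move=> t0.
have coef x : 0 < x -> beta * p%:R * (p%:R - 1) * x ^+ (p - 2) - x^-1 = eta 2 x.
  move=> x0; rewrite /etad expr1 fact0 mulr1 mulN1r expr1; congr (_ * _ - _).
  by rewrite !ffactnS ffactn0 muln1 natrM mulrA -subn1 natrB// ltnW.
have sr : \sum_(r < q | r != c1) t 0 r = - t 0 c1.
  by apply/eqP; rewrite -addr_eq0 addrC -[X in X == _](bigD1 (P := xpredT) c1 isT) t0.
have -> : rest_sum t = \sum_(r < q | r != c1) t 0 r ^+ 2 - t 0 c1 ^+ 2 / m.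
  rewrite /rest_sum (eq_bigr (fun r => t 0 r ^+ 2 + (2 * (t 0 c1 / m) * t 0 r +
    (t 0 c1 / m) ^+ 2))) => [|r _]; last by ring.
  rewrite big_split/= big_split/= -mulr_sumr sr card_rest; field.
  by rewrite gt_eqF.
rewrite /Qform (bigD1 c1)//= va coef//.
rewrite (eq_bigr (fun r => eta 2 b * t 0 r ^+ 2)) => [|r rc]; last by rewrite vb// coef.
rewrite -mulr_sumr /segment_deriv addr0 bE.
by move: (\sum_(r < q | r != c1) t 0 r ^+ 2) => S; field; rewrite gt_eqF.
Qed.

Let mi_lt1 : (2 < q)%N -> m^-1 < 1.
Proof. by move=> q3; rewrite invf_lt1// ltr1n -subn1 ltn_subRL. Qed.

(** With at least three colours, mass can be moved between two colours other
    than [c1]. *)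
Lemma eta2b_le0 : (2 < q)%N -> eta 2 b <= 0.
Proof.
move=> q3; have [_ vm] := vmax.
pose r1 : 'I_q := Ordinal (ltnW q3); pose r2 : 'I_q := Ordinal q3.
have r1c : r1 != c1 by [].
have r2c : r2 != c1 by [].
have r21 : r2 != r1 by [].
pose D i (x : R) := eta i (b + x) + (-1) ^+ i * eta i (b - x).
have Dmax : \forall x \near (0 : R), D 0%N x <= D 0%N 0.
  near=> x.
  have x1 : - b < x by near: x; apply: lt_nbhsr; rewrite oppr_lt0.
  have x2 : x < b by near: x; exact: lt_nbhsl.
  pose w : 'rV[R]_q := \row_r (if r == r1 then b + x else if r == r2 then b - x else v 0 r).
  have w1 : w 0 r1 = b + x by rewrite mxE eqxx.
  have w2 : w 0 r2 = b - x by rewrite mxE (negPf r21) eqxx.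
  have wr r : r != r1 -> r != r2 -> w 0 r = v 0 r by rewrite mxE => /negPf -> /negPf ->.
  have split (g : R -> R) (u : 'rV[R]_q) : \sum_(r < q) g (u 0 r) =
      g (u 0 r1) + g (u 0 r2) + \sum_(r < q | (r != r1) && (r != r2)) g (u 0 r).
    by rewrite (bigD1 r1)//= (bigD1 r2)//= addrA.
  have wv (g : R -> R) : \sum_(r < q) g (w 0 r) =
      \sum_(r < q) g (v 0 r) + (g (b + x) + g (b - x) - (g b + g b)).
    rewrite !split w1 w2 (vb r1c) (vb r2c).
    rewrite (eq_bigr (fun r => g (v 0 r))) => [|r /andP[n1 n2]]; last by rewrite wr.
    by move: (\sum_(i < q | _) _) => S; ring.
  have [wE|/eqP wN] := eqVneq w v.
    have := w1; rewrite wE (vb r1c) => /esym/eqP; rewrite -subr_eq0 addrAC subrr add0r.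
    by move/eqP ->.
  have vp : prob_vectors v by case: vmax.
  have wp : prob_vectors w.
    split => [r|].
      rewrite mxE; case: ifP => _; first by lra.
      by case: ifP => _; [lra|case: vp].
    by rewrite (wv id) (_ : _ - _ = 0) ?addr0; [case: vp|ring].
  have := vm _ wp wN; rewrite /Hfun (wv (fun y => y ^+ p)) (wv (fun y => y * ln y)).
  rewrite (wr c1) ?(eq_sym c1)//= /D /etad !ffactn0 !subn0 !expr0 addr0 subr0 !mul1r mulr1.
  move: (\sum_(r < q) v 0 r ^+ p) (\sum_(r < q) v 0 r * ln (v 0 r)) => S T.
  move: ((b + x) ^+ p) ((b - x) ^+ p) (b ^+ p) => e1 e2 e3.
  move: ((b + x) * ln _) ((b - x) * ln _) (b * ln _) (h * _) => l1 l2 l3 hh H.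
  rewrite -subr_ge0; apply: ltW; move: H; rewrite -subr_gt0 => H.
  by apply: (lt_le_trans H); rewrite le_eqVlt; apply/orP; left; apply/eqP; ring.
have DD i z : - b < z < b -> is_derive z 1 (D i) (D i.+1 z).
  move=> /andP[z1 z2].
  have p1 : 0 < b + z by rewrite -ltrBlDl sub0r.
  have p2 : 0 < b - z by rewrite subr_gt0.
  have d1 : is_derive z 1 (fun y : R => b + y) 1.
    apply: (is_derive_eq (is_deriveD (is_derive_cst b z 1) (is_derive_id z 1))).
    by rewrite add0r.
  have d2 : is_derive z 1 (fun y : R => b - y) (- 1).
    apply: (is_derive_eq (is_deriveB (is_derive_cst b z 1) (is_derive_id z 1))).
    by rewrite sub0r.
  have D1 := @is_derive1_comp R (eta i) (fun y : R => b + y) z _ _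
    (is_derive_etad beta p i p1) d1.
  have D2 := @is_derive1_comp R (eta i) (fun y : R => b - y) z _ _
    (is_derive_etad beta p i p2) d2.
  have -> : D i = (eta i \o (fun y : R => b + y)) +
    (-1) ^+ i \*: (eta i \o (fun y : R => b - y)) by [].
  apply: (is_derive_eq (is_deriveD D1 (is_deriveZ _ D2))).
  by rewrite /GRing.scale/= /D exprS; ring.
have b0 : - b < 0 < b by rewrite oppr_lt0 b_gt0.
have Dc : {for 0, continuous (D 2)}.
  by apply: differentiable_continuous; apply/derivable1_diffP; have [] := DD 2 _ b0.
have D10 i : (0 < i < 2)%N -> D i 0 = 0.
  by case: i => [|[|]]// _; rewrite /D addr0 subr0 expr1 mulN1r subrr.
have [] := local_max_taylor b0 (isT : (0 < 2)%N) (fun i z _ => DD i z) Dc D10 Dmax.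
by rewrite {1}/D addr0 subr0 sqrrN expr1n mul1r; lra.
Unshelve. all: by end_near. Qed.

(** If [eta 2 b] were zero, the second order condition on the segment and
    [b <= a] would force [a = b]; the second derivative on the segment would then
    vanish while the third one is nonzero, which a maximum excludes. *)
Lemma eta2b_lt0 : (2 < q)%N -> eta 2 b < 0.
Proof.
move=> q3; rewrite lt_neqAle eta2b_le0// andbT; apply/negP => /eqP B0.
have b1 : interaction b = 1.
  move: B0; rewrite (etad_interaction 0 b_gt0) ffactn0 fact0 !mulr1 expr1 => /eqP.
  by rewrite mulf_eq0 invr_eq0 (gt_eqF b_gt0) orbF subr_eq0 => /eqP.
have A0 : eta 2 a <= 0.
  by have := F2_le0; rewrite /segment_deriv bE B0 mulr0 !addr0.
have a1 : interaction a <= 1.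
  move: A0; rewrite (etad_interaction 0 a_gt0) ffactn0 fact0 !mulr1 expr1.
  by rewrite pmulr_lle0 ?invr_gt0// subr_le0.
have ab : a = b.
  apply/eqP; rewrite eq_le ba andbT leNgt; apply/negP => blt.
  move: a1; rewrite leNgt -b1 /interaction ltr_pM2l ?ltrXn2r//.
  - by rewrite -lt0n -subn1 subn_gt0 p_gt1.
  - exact: ltW.
  - by rewrite !mulr_gt0 ?ltr0n ?(ltnW p_gt1)// -subn1 subn_gt0.
have F2 : F 2 a = 0 by rewrite /segment_deriv bE ab B0 mulr0 !addr0.
have [|_ /(_ isT)] := @local_max_F 3 isT.
  by case=> [|[|[|]]]// _; rewrite ?F1_eq0.
rewrite /segment_deriv bE ab addr0 (_ : _ + _ = eta 3 b * (1 - m^-1 * m^-1)); last first.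
  by field; rewrite gt_eqF.
apply/eqP; rewrite gt_eqF// mulr_gt0//; last first.
  by rewrite subr_gt0 mulr_ilt1 ?invr_ge0 ?(ltW m_gt0) ?mi_lt1.
rewrite (etad_interaction 1 b_gt0) b1 mul1r factS fact0 mulr1 sqrrN expr1n.
by rewrite divr_gt0 ?exprn_gt0// ltr_wpDl// ler0n.
Qed.

Lemma transverse_stability : q = 2%N \/ beta * p%:R * p.-1%:R * b ^+ p.-1 < 1.
Proof.
have := q_gt1; rewrite leq_eqVlt => /orP[/eqP <-|q3]; [by left|right].
have := eta2b_lt0 q3; rewrite (etad_interaction 0 b_gt0) ffactn0 fact0 !mulr1 expr1.
by rewrite pmulr_llt0 ?invr_gt0// subr_lt0.
Qed.

Hypothesis singular : Qsingular p v beta.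

(** By [Qform_split] the quadratic form is a sum of two nonpositive terms, and the
    second one vanishes only along the segment: a flat direction is the direction
    of the segment. *)
Lemma F2_eq0 : F 2 a = 0.
Proof.
have [t [t0 /eqP tn0]] := singular; rewrite Qform_split// => Q0.
have V0 : 0 <= rest_sum t by apply: sumr_ge0 => r _; exact: sqr_ge0.
have S0 : F 2 a * t 0 c1 ^+ 2 <= 0 by rewrite mulr_le0_ge0 ?F2_le0 ?sqr_ge0.
have Vz : rest_sum t = 0.
  have := q_gt1; rewrite leq_eqVlt => /orP[/eqP q2|q3].
    have sr : \sum_(r < q | r != c1) (t 0 r + t 0 c1 / m) = 0.
      rewrite big_split/= card_rest mulrC divfK ?gt_eqF// addrC.
      by rewrite -[LHS](bigD1 (P := xpredT) c1 isT) t0.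
    pose r1 : 'I_q := Ordinal q_gt1.
    have r1E r : (r != c1) = (r == r1).
      by rewrite -!val_eqE/=; case: r => [[|[|r]]]//=; rewrite -q2.
    by move: sr; rewrite /rest_sum !(eq_bigl _ _ r1E) !big_pred1_eq => ->; rewrite expr0n.
  have B0 := eta2b_lt0 q3; apply/eqP; rewrite eq_le V0 andbT.
  by rewrite -(ler_nM2l B0) mulr0; lra.
have t1 : t 0 c1 != 0.
  apply: contra_neqN tn0 => /eqP t1; apply/rowP => r; rewrite mxE.
  have [->//|rc] := eqVneq r c1.
  move/eqP: Vz; rewrite psumr_eq0 => [|? _]; last exact: sqr_ge0.
  move=> /allP/(_ r); rewrite mem_index_enum => /(_ isT); rewrite rc/= sqrf_eq0.
  by rewrite t1 mul0r addr0 => /eqP.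
move: Q0; rewrite Vz mulr0 addr0 => /eqP.
by rewrite mulf_eq0 sqrf_eq0 (negPf t1) orbF => /eqP.
Qed.

Lemma F3_eq0 : F 3 a = 0.
Proof.
have [|_ ->//] := @local_max_F 3 isT.
by case=> [|[|[|]]]// _; rewrite ?F1_eq0 ?F2_eq0.
Qed.

(** With [y = a / (m b)] and [k = p - 2], the vanishing of the second, third and
    fourth derivatives gives [y + 1/y = k] and [interaction a = y^3 interaction b].
    As [a / b = m y >= 1], the exponent [p - 1 = k + 1 >= 3] of [interaction] only
    leaves [m = 1], [y = 1] and [k = 2]. *)
Lemma F4_eq0 : F 4 a = 0 -> [/\ q = 2%N, p = 4%N, a = 1 / 2, b = 1 / 2 & beta = 2 / 3].
Proof.
have E2 := F2_eq0; have E3 := F3_eq0 => E4.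
pose A := interaction a; pose B := interaction b; pose k := (p - 2)%N.
have A0 : 0 < A by exact: interaction_gt0.
have B0 : 0 < B by exact: interaction_gt0.
pose y := a / (m * b).
have y0 : 0 < y by rewrite divr_gt0// mulr_gt0.
have aE : a = y * m * b by rewrite /y; field; rewrite !gt_eqF.
have {}E2 : (A - 1) + y * (B - 1) = 0.
  rewrite -[RHS](mulr0 a) -E2 /segment_deriv bE !(etad_interaction 0)// ffactn0 fact0 addr0 /y -/A -/B.
  by field; rewrite !gt_eqF.
have {}E3 : (k%:R * A + 1) - y ^+ 2 * (k%:R * B + 1) = 0.
  rewrite -[RHS](mulr0 (a ^+ 2)) -E3 /segment_deriv bE !(etad_interaction 1)// ffactn1 factS fact0 addr0 /y -/A -/B.
  by rewrite /k; field; rewrite !gt_eqF.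
have {}E4 : (k%:R * (k%:R - 1) * A - 2) + y ^+ 3 * (k%:R * (k%:R - 1) * B - 2) = 0.
  have kk : ((p - 2) ^_ 2)%:R = (k%:R * (k%:R - 1) : R).
    rewrite -/k !ffactnS ffactn0 muln1 natrM; case: (k) => [|n]; first by rewrite !mul0r.
    by rewrite -natr1 addrK.
  rewrite -[RHS](mulr0 (a ^+ 3)) -E4 /segment_deriv bE !(etad_interaction 2)// kk addr0 /y -/A -/B.
  by rewrite (_ : 2`! = 2%N)//; field; rewrite !gt_eqF.
have k0 : (k%:R : R) != 0.
  apply/eqP => kz; move: E3 E4; rewrite kz !mul0r add0r mulr1 => E3 E4.
  have := exprn_gt0 3 y0; lra.
have kB : k%:R * B * y = k%:R + 1 - y.
  have AE : A = 1 + y - y * B by lra.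
  have : (1 + y) * (k%:R * B * y - (k%:R + 1 - y)) = 0.
    by rewrite -[RHS]oppr0 -E3 AE; ring.
  by move/eqP; rewrite mulf_eq0 gt_eqF ?addr_gt0//= subr_eq0 => /eqP.
have kA : k%:R * A = (k%:R + 1) * y - 1.
  have -> : A = 1 + y - y * B by lra.
  rewrite [LHS](_ : _ = k%:R + k%:R * y - k%:R * B * y); last by ring.
  by rewrite kB; ring.
have k1 : 0 < (k%:R + 1 : R) by rewrite ltr_wpDl// ler0n.
have yk : y ^+ 2 + 1 = k%:R * y.
  have H : (k%:R + 1) * ((y + 1) * (y ^+ 2 - k%:R * y + 1)) = 0.
    rewrite -[RHS]oppr0 -E4.
    rewrite [X in _ = - X](_ : _ = (k%:R - 1) * (k%:R * A) - 2 +
      (y ^+ 2 * (k%:R - 1) * (k%:R * B * y) - 2 * y ^+ 3)); last by ring.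
    by rewrite kA kB; ring.
  move/eqP: H; rewrite mulf_eq0 gt_eqF//= mulf_eq0 gt_eqF ?addr_gt0//= => /eqP; lra.
have AB : A = y ^+ 3 * B.
  apply: (mulfI k0); rewrite kA [RHS](_ : _ = y ^+ 2 * (k%:R * B * y)); last by ring.
  rewrite kB [LHS](_ : _ = k%:R * y + y - 1); last by ring.
  rewrite [RHS](_ : _ = y * (k%:R * y) + y ^+ 2 - y ^+ 3); last by ring.
  by rewrite -yk; ring.
have my1 : 1 <= m * y.
  have -> : m * y = a / b by rewrite /y; field; rewrite !gt_eqF.
  by rewrite ler_pdivlMr ?mul1r.
have kq : (2 <= k)%N.
  by rewrite -(ler_nat R) -(ler_pM2r y0) -yk; have := sqr_ge0 (y - 1); rewrite sqrrB1; lra.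
have pk : p.-1 = k.+1 by rewrite /k; move: p_gt1; case: (p) => [|[|n]]//; rewrite subn2.
have ratio : (m * y) ^+ k.+1 = y ^+ 3.
  have bp : b ^+ k.+1 != 0 by rewrite expf_neq0// gt_eqF.
  apply: (mulIf bp); rewrite -exprMn (_ : m * y * b = a); last by rewrite aE; ring.
  have c0 : beta * p%:R * p.-1%:R != 0.
    by rewrite gt_eqF// !mulr_gt0 ?ltr0n ?(ltnW p_gt1)// -subn1 subn_gt0.
  by apply: (mulfI c0); move: AB; rewrite /A /B /interaction pk => ->; ring.
have ratio1 : (m * y) ^+ (k - 2) * m ^+ 3 = 1.
  have y3 : y ^+ 3 != 0 by rewrite expf_neq0// gt_eqF.
  apply: (mulIf y3); rewrite mul1r -[RHS]ratio -mulrA -exprMn -exprD.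
  by rewrite addnS subnK.
have m1 : m = 1.
  apply/eqP; rewrite eq_le m_ge1 andbT leNgt; apply/negP => m1.
  have : 1 < (m * y) ^+ (k - 2) * m ^+ 3.
    have m3 : 1 < m ^+ 3 by rewrite exprn_egt1.
    by rewrite (lt_le_trans m3)// ler_peMl ?exprn_ege1// (le_trans ler01) ?ltW.
  by rewrite ratio1 ltxx.
have q2 : q = 2%N.
  have /eqP := m1; rewrite -[X in _ == X]/(1%:R) eqr_nat => /eqP q1.
  by rewrite -(prednK (ltnW q_gt1)) q1.
have y1 : y = 1.
  move: ratio1 my1; rewrite m1 !mul1r expr1n mulr1 => yk2 y1.
  have [k2|k2] := eqVneq k 2%N.
    move: yk; rewrite k2 => /eqP; rewrite -subr_eq0 (_ : _ - _ = (y - 1) ^+ 2); last by ring.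
    by rewrite sqrf_eq0 subr_eq0 => /eqP.
  apply/eqP; rewrite eq_le y1 andbT leNgt; apply/negP => y1'.
  have := exprn_egt1 (k - 2) y1'.
  by rewrite yk2 ltxx -lt0n subn_gt0 ltn_neqAle eq_sym k2 kq.
have k2 : k = 2%N.
  move: yk; rewrite y1 expr1n mulr1 => /eqP; rewrite -[X in X == _](natrD R 1 1) eqr_nat.
  by move/eqP.
have p4 : p = 4%N by rewrite -(prednK (ltnW p_gt1)) pk k2.
have ab : a = b by rewrite aE y1 m1 !mul1r.
have b2 : b = 1 / 2 by move: ab1; rewrite m1 ab; lra.
split => //; first by rewrite ab.
have : B = 1 by move: kB; rewrite y1 k2; lra.
rewrite /B /interaction p4 b2 /=; lra.
Qed.

End critical_point.

Variable s : R.
Let a := (1 + (q%:R - 1) * s) / q%:R : R.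
Let b := (1 - s) / q%:R : R.

Let q_gt0 : 0 < (q%:R : R). Proof. by rewrite ltr0n ltnW. Qed.
Let qE : (q%:R : R) = m + 1. Proof. by rewrite natr1 prednK// ltnW. Qed.

Lemma xs_color1 : xs q_gt1 s 0 c1 = a. Proof. by rewrite mxE eqxx. Qed.
Lemma xs_other r : r != c1 -> xs q_gt1 s 0 r = b.
Proof. by rewrite mxE => /negPf ->. Qed.
Lemma xs_sum : a + m * b = 1.
Proof. by rewrite /a /b qE; field; rewrite -qE gt_eqF. Qed.

Hypothesis s01 : 0 <= s < 1.

Lemma xs_other_gt0 : 0 < b.
Proof. by case/andP: s01 => s0 s1; rewrite divr_gt0// subr_gt0. Qed.
Lemma xs_order : b <= a.
Proof.
case/andP: s01 => s0 s1; rewrite ler_pM2r ?invr_gt0// qE addrK.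
by apply: lerD => //; apply: (@le_trans _ _ 0); [rewrite oppr_le0|rewrite mulr_ge0// ltW].
Qed.
Lemma xs_color1_gt0 : 0 < a.
Proof. exact: lt_le_trans xs_other_gt0 xs_order. Qed.

(** The parametrization of [f] reaches proportion 1 of the first colour at
    [s = 1] and moves it at speed [m / q]. *)
Lemma f4_F : f4 p q_gt1 beta h s = (m / q%:R) ^+ 4 * F 4 a.
Proof.
pose x (z : R) : R := (1 + (q%:R - 1) * z) / q%:R.
have xin (z : R) : - m^-1 < z < 1 -> 0 < x z < 1.
  move=> /andP[z0 z1]; rewrite /x qE addrK divr_gt0 -?qE//=; last first.
    by rewrite -ltrBlDl sub0r -ltr_pdivrMl// mulrN1.
  by rewrite ltr_pdivrMr// mul1r qE addrC ltrD2r gtr_pMr.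
have dx (z : R) : is_derive z 1 x (m / q%:R).
  have -> : x = cst q%:R^-1 + (m / q%:R) \*: (@id R).
    by apply/funext => u; rewrite !fctE /GRing.scale/= /x qE addrK -[_ *: u]/(_ * u); ring.
  apply: (is_derive_eq (is_deriveD (is_derive_cst (q%:R^-1 : R) z 1)
    (is_deriveZ _ (is_derive_id z 1)))).
  by rewrite /GRing.scale/= mulr1 add0r.
have step k : forall z, - m^-1 < z < 1 ->
    derive1n k (f p q_gt1 beta h) z = (m / q%:R) ^+ k * F k (x z).
  elim: k => [|k IH] z zin.
    rewrite /= expr0 mul1r /f; apply: Hfun_segment; first by rewrite mxE eqxx.
    move=> r /negPf rc; rewrite mxE rc /x qE addrK; field.
    by rewrite -qE !gt_eqF.
  have D := @is_derive1_comp R (F k) x z _ _ (is_derive_segment p q_gt1 beta h k (xin z zin)) (dx z).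
  have {}D := is_deriveZ ((m / q%:R) ^+ k) D.
  rewrite derive1nS derive1E exprS.
  have -> : 'D_1 (derive1n k (f p q_gt1 beta h)) z =
     'D_1 ((m / q%:R) ^+ k \*: (F k \o x)) z.
    apply: near_eq_derive.
    case/andP: zin => z0 z1; near=> u; apply: IH; apply/andP; split.
      by near: u; exact: lt_nbhsr.
    by near: u; exact: lt_nbhsl.
  rewrite (@derive_val _ _ _ _ _ _ _ D) /GRing.scale/=; ring.
rewrite /f4 step//; case/andP: s01 => s0 ->; rewrite andbT.
by apply: lt_le_trans s0; rewrite oppr_lt0 invr_gt0.
Unshelve. all: by end_near. Qed.

End second_order.

Lemma segment_deriv56_half (R : realType) (h : R) :
  segment_deriv 4 2 (2 / 3) h 5 (1 / 2) = 0 /\ segment_deriv 4 2 (2 / 3) h 6 (1 / 2) = - 1536.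
Proof.
have e : ((1 - 1 / 2) / (2.-1)%:R : R) = 1 / 2 by rewrite /=; lra.
split; rewrite /segment_deriv e /etad/= !ffact_small// !factS fact0; by field.
Qed.
(** * Convergence in distribution of the estimate *)

Section limit_theorem.
Context {R : realType} (p q : nat) (p_gt1 : (1 < p)%N) (q_gt1 : (1 < q)%N).
Variables (beta h : R).
Hypotheses (beta_gt0 : 0 < beta).
Local Notation c1 := (color1 q_gt1).
Local Notation m := (q.-1%:R : R).
Local Notation F := (segment_deriv p q beta h).
Local Notation count_weight := (count_weight p q_gt1 beta h).
Local Notation mu := (@lebesgue_measure R).

Variables (v : 'rV[R]_q) (a b : R).
Hypotheses (va : v 0 c1 = a) (vb : forall r, r != c1 -> v 0 r = b).
Hypotheses (a_gt0 : 0 < a) (b_gt0 : 0 < b) (ab1 : a + q.-1%:R * b = 1).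
Hypothesis crit : beta * p%:R * a ^+ p.-1 + h - ln a = beta * p%:R * b ^+ p.-1 - ln b.
Hypothesis vmax : unique_maximizer p q_gt1 beta h v.
Hypothesis stab : q = 2%N \/ beta * p%:R * p.-1%:R * b ^+ p.-1 < 1.

Variable d : nat.
Hypotheses (d_ge4 : (4 <= d)%N) (d_even : ~~ odd d).
Hypothesis F_flat : forall i, (0 < i < d)%N -> F i a = 0.
Hypothesis F_top : F d a < 0.

Let m_gt0 : 0 < m. Proof. by rewrite ltr0n -subn1 subn_gt0. Qed.
Let a01 : 0 < a < 1.
Proof. by rewrite a_gt0 -[X in _ < X]ab1 ltrDl mulr_gt0. Qed.

Let c0 : R := F d a / d`!%:R.
Let c : R := c0 * m ^+ d.

Let c0_lt0 : c0 < 0.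
Proof. by rewrite pmulr_llt0 ?invr_gt0 ?ltr0n ?fact_gt0. Qed.
Let c_lt0 : c < 0.
Proof. by rewrite pmulr_llt0// exprn_gt0. Qed.

Let taylorF e : 0 < e -> \forall x \near a,
  `|F 0 x - F 0 a - c0 * (x - a) ^+ d| <= e * `|x - a| ^+ d.
Proof.
apply: (taylor_at a01 (leq_trans (isT : (0 < 4)%N) d_ge4)) => //.
- by move=> i z _ z01; exact: is_derive_segment.
- apply: differentiable_continuous; apply/derivable1_diffP.
  by have [] := is_derive_segment p q_gt1 beta h d a01.
Qed.

Let profile : exists C e, [/\ 0 <= C, 0 < e &
  \forall N \near \oo, forall k l, near_a a e N k -> near_a a e N l ->
    `|(ln (count_weight N k) - N%:R * F 0 (k%:R / N%:R)) -
      (ln (count_weight N l) - N%:R * F 0 (l%:R / N%:R))| <= C / N%:R * `|k%:R - l%:R|].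
Proof.
have [C [e [C0 e0 _ H]]] :=
  count_weight_profile p_gt1 beta_gt0 va vb a_gt0 b_gt0 ab1 crit vmax stab.
by exists C, e.
Qed.

Let tail := count_weight_far p_gt1 beta_gt0 va vb a_gt0 b_gt0 ab1 crit vmax.

Let ratio N k := count_weight N k / count_weight N (center a N).
Let pos N k := position d a m N k.

Let laplace := @laplace_sum R d a m c0 (F 0) count_weight (center a) d_ge4 d_even a01 m_gt0 c0_lt0
  (fun N k => @count_weight_gt0 R p q q_gt1 beta h N k) taylorF (center_near a_gt0) profile tail.

Let laplace_cont (g : R -> R) (K : R) : 0 <= K -> continuous g ->
  (forall x, `|g x| <= K * expR (K * `|x|)) ->
  mesh d m N * \sum_(k < N.+1) g (pos N k) * ratio N k @[N --> \oo] -->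
    \int[mu]_x (g x * expR (c * x ^+ d)).
Proof.
move=> K0 cg gK; have [|||_ //] := @laplace (fun=> g) g K 0 K0.
- by near=> N.
- exact: continuous_measurable_fun.
- by move=> x _ u ux; exact: (cvg_comp _ _ ux (cg x)).
Unshelve. all: by end_near. Qed.

Variable t : R.
Let l := m * t.

Definition tilt_mass N : R := \sum_(k < N.+1) expR (l * pos N k) * ratio N k.
Definition tilt_moment N : R := \sum_(k < N.+1) (pos N k * expR (l * pos N k)) * ratio N k.

Let cexp : continuous (fun x : R => expR (l * x)).
Proof.
move=> x; apply: continuous_comp; last exact: continuous_expR.
by apply: cvgM; [exact: cvg_cst|exact: cvg_id].
Qed.

Let Kl := 1 + `|l|.
Let Kl_ge1 : 1 <= Kl. Proof. by rewrite lerDl. Qed.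
Let Kl_ge0 : 0 <= Kl. Proof. exact: le_trans ler01 Kl_ge1. Qed.

Let exp_le x : expR (l * x) <= expR (`|l| * `|x|).
Proof. by rewrite ler_expR -normrM ler_norm. Qed.

Let tilt_mass_cvg : mesh d m N * tilt_mass N @[N --> \oo] --> mass d c l.
Proof.
have -> : mass d c l = \int[mu]_x (expR (l * x) * expR (c * x ^+ d)).
  by apply: eq_Rintegral => x _; rewrite mul1r.
apply: (laplace_cont Kl_ge0 cexp) => x.
rewrite ger0_norm ?expR_ge0//; apply: (le_trans (exp_le x)).
apply: (@le_trans _ _ (expR (Kl * `|x|))).
  by rewrite ler_expR ler_wpM2r// lerDr.
by rewrite ler_peMl// expR_ge0.
Qed.

Let tilt_moment_cvg : mesh d m N * tilt_moment N @[N --> \oo] --> moment1 d c l.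
Proof.
have -> : moment1 d c l = \int[mu]_x (x * expR (l * x) * expR (c * x ^+ d)).
  by apply: eq_Rintegral => x _; rewrite mulrA.
apply: (laplace_cont Kl_ge0) => x; first by apply: cvgM; [exact: cvg_id|exact: cexp].
rewrite normrM (ger0_norm (expR_ge0 _)).
apply: (@le_trans _ _ (expR (Kl * `|x|))); last by rewrite ler_peMl// expR_ge0.
rewrite /Kl mulrDl mul1r expRD ler_pM ?expR_ge0//.
by apply: le_trans (expR_ge1Dx _); rewrite lerDr.
Qed.

Let mesh_neq0 N : (0 < N)%N -> mesh d m N != 0.
Proof.
move=> N0; rewrite /mesh gt_eqF// divr_gt0 ?scale_gt0// mulr_gt0// ltr0n//.
Qed.

(** The mean of the rescaled count under the tilted weights, with which the
    observed rescaled count is compared. *)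
Definition threshold N : R := tilt_moment N / tilt_mass N.

Lemma threshold_cvg : threshold N @[N --> \oo] --> tilted_mean d c l.
Proof.
have H : (mesh d m N * tilt_moment N) / (mesh d m N * tilt_mass N) @[N --> \oo] -->
    tilted_mean d c l.
  apply: cvgM; first exact: tilt_moment_cvg.
  by apply: cvgV; [rewrite gt_eqF// mass_gt0|exact: tilt_mass_cvg].
apply: cvg_trans H; apply: near_eq_cvg; near=> N.
have N0 : (0 < N)%N by near: N; exact: nbhs_infty_gt.
by rewrite -mulf_div divff ?mul1r// mesh_neq0.
Unshelve. all: by end_near. Qed.

(** The half-line below [threshold N] moves with [N]; its indicator still converges
    at every point other than the limit of the thresholds. *)
Lemma fraction_cvg :
  (\sum_(k < N.+1) (pos N k <= threshold N)%R%:R * ratio N k) /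
  (\sum_(k < N.+1) 1 * ratio N k) @[N --> \oo] --> limit_cdf d c m t.
Proof.
set x0 := tilted_mean d c l.
have b1 (x : R) : `|1 : R| <= 1 * expR (1 * `|x|).
  by rewrite normr1 !mul1r -expR0 ler_expR.
have H1 : mesh d m N * \sum_(k < N.+1) 1 * ratio N k @[N --> \oo] --> mass d c 0.
  have -> : mass d c 0 = \int[mu]_x (1 * expR (c * x ^+ d)).
    by apply: eq_Rintegral => x _; rewrite /dens mul0r expR0 !mul1r.
  by apply: (@laplace_cont (fun=> 1) 1) => // x; exact: cvg_cst.
have H2 : mesh d m N * \sum_(k < N.+1) (pos N k <= threshold N)%R%:R * ratio N k
    @[N --> \oo] --> below d c 0 x0.
  have -> : below d c 0 x0 = \int[mu]_x ((x <= x0)%R%:R * expR (c * x ^+ d)).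
    by apply: eq_Rintegral => x _; rewrite /dens mul0r expR0 mul1r.
  have [||||_ //] := @laplace (fun N x => (x <= threshold N)%R%:R)
    (fun x => (x <= x0)%R%:R) 1 x0 => //.
  - near=> N => x; apply: le_trans (b1 x).
    by rewrite normr1 ger0_norm ?ler0n// lern1 leq_b1.
  - have -> : (fun x : R => (x <= x0)%R%:R) = \1_(`]-oo, x0]%classic) :> (R -> R).
      by apply/funext => x; rewrite indicE mem_setE in_itv.
    exact: measurable_indic.
  - move=> x xx0 u ux; apply: cvg_near_cst.
    have xu : threshold N - u N @[N --> \oo] --> x0 - x by exact: cvgB threshold_cvg ux.
    move: xx0; rewrite neq_lt => /orP[lt|gt].
      have xu0 : 0 < x0 - x by rewrite subr_gt0.
      near=> N; have : 0 < threshold N - u N by near: N; apply: (cvgr_gt (x0 - x)) => //.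
      by rewrite subr_gt0 => /ltW ->; rewrite (ltW lt).
    have xu0 : x0 - x < 0 by rewrite subr_lt0.
    near=> N; have : threshold N - u N < 0 by near: N; apply: (cvgr_lt (x0 - x)) => //.
    by rewrite subr_lt0 => /lt_geF ->; rewrite (lt_geF gt).
have H : (mesh d m N * \sum_(k < N.+1) (pos N k <= threshold N)%R%:R * ratio N k) /
    (mesh d m N * \sum_(k < N.+1) 1 * ratio N k) @[N --> \oo] --> limit_cdf d c m t.
  exact: (cvgM H2 (cvgV (lt0r_neq0 (mass_gt0 d_ge4 d_even c_lt0 0)) H1)).
apply: cvg_trans H; apply: near_eq_cvg; near=> N.
have N0 : (0 < N)%N by near: N; exact: nbhs_infty_gt.
by rewrite -mulf_div divff ?mul1r// mesh_neq0.
Unshelve. all: by end_near. Qed.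


Variable e : R.
Hypothesis eE : e = 1 - d%:R^-1.

Let rate_scale N : (0 < N)%N -> N%:R `^ e = N%:R / scale d N.
Proof.
move=> N0; have NR : (N%:R : R) != 0 by rewrite pnatr_eq0 -lt0n.
rewrite eE powRB; last by rewrite NR implybT.
by rewrite powRr1.
Qed.

Let count_weight_center_gt0 N : (0 < N)%N -> 0 < count_weight N (center a N).
Proof.
move=> N0; apply: count_weight_gt0; rewrite -(ler_nat R).
have aN : 0 <= a * N%:R by rewrite mulr_ge0// ltW.
have /andP[/le_trans -> //] := truncn_itv aN.
by rewrite -[leRHS]mul1r ltW// ltr_pM2r ?ltr0n//; case/andP: a01.
Qed.

(** The tilt by [t / N^e] of the field multiplies the weight of a count by
    [expR (l * position)], up to a constant. *)
Lemma mean_count1_threshold N : (0 < N)%N ->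
  mean_count1 p q_gt1 beta N (h + t / N%:R `^ e) = a + m / scale d N * threshold N.
Proof.
move=> N0; have NR : 0 < (N%:R : R) by rewrite ltr0n.
have g0 : 0 < scale d N :> R by rewrite scale_gt0.
have w0 := count_weight_center_gt0 N0.
pose K := expR (t * scale d N * a) * count_weight N (center a N).
have K0 : 0 < K by rewrite mulr_gt0// expR_gt0.
have kN k : k%:R / N%:R = a + m / scale d N * pos N k.
  by rewrite /pos /position; field; rewrite !gt_eqF.
have tilt k : count_weight N k * expR (t / N%:R `^ e * k%:R) = K * (expR (l * pos N k) * ratio N k).
  rewrite rate_scale// (_ : _ * k%:R = t * scale d N * a + l * pos N k); last first.
    by rewrite /l /pos /position; field; rewrite !gt_eqF.
  by rewrite expRD /K /ratio; field; rewrite gt_eqF.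
have wE (Y : {ffun 'I_N -> 'I_q}) : potts_weight p q_gt1 beta (h + t / N%:R `^ e) Y =
    potts_weight p q_gt1 beta h Y * expR (t / N%:R `^ e * (cnt Y c1)%:R).
  by rewrite (weight_tilt p q_gt1 beta N0 h) addrAC subrr add0r.
have Z : \sum_(Y : {ffun 'I_N -> 'I_q}) potts_weight p q_gt1 beta (h + t / N%:R `^ e) Y =
    K * tilt_mass N.
  under eq_bigr do rewrite wE.
  rewrite (sum_count_weight p q_gt1 beta h N (fun k => expR (t / N%:R `^ e * k%:R))) /tilt_mass mulr_sumr.
  by apply: eq_bigr => k _; rewrite tilt.
have M : \sum_(Y : {ffun 'I_N -> 'I_q}) potts_weight p q_gt1 beta (h + t / N%:R `^ e) Y *
    xbar Y 0 c1 = K * (a * tilt_mass N + m / scale d N * tilt_moment N).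
  under eq_bigr do rewrite wE xbarE -mulrA.
  rewrite (sum_count_weight p q_gt1 beta h N (fun k => expR (t / N%:R `^ e * k%:R) * (k%:R / N%:R))).
  rewrite /tilt_mass /tilt_moment !mulr_sumr -big_split mulr_sumr.
  by apply: eq_bigr => k _; rewrite mulrA tilt kN /=; ring.
have TM : 0 < tilt_mass N.
  have : 0 < K * tilt_mass N.
    rewrite -Z (bigD1 [ffun=> c1])//= ltr_pwDl ?weight_gt0// sumr_ge0// => X _.
    by rewrite ltW// weight_gt0.
  by rewrite pmulr_rgt0.
by rewrite /mean_count1 M Z /threshold; field; rewrite !gt_eqF.
Qed.

Lemma mle_distr_fun_fraction N : (0 < N)%N ->
  mle_distr_fun p q_gt1 beta h e N t =
  (\sum_(k < N.+1) (pos N k <= threshold N)%R%:R * ratio N k) /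
  (\sum_(k < N.+1) 1 * ratio N k).
Proof.
move=> N0; have NR : 0 < (N%:R : R) by rewrite ltr0n.
have g0 : 0 < scale d N :> R by rewrite scale_gt0.
have w0 := count_weight_center_gt0 N0.
have r0 : 0 < N%:R `^ e by rewrite powR_gt0.
have event (X : {ffun 'I_N -> 'I_q}) :
    ((N%:R `^ e)%:E * (mle p q_gt1 beta X - h%:E) <= t%:E)%E =
    (pos N (cnt X c1) <= threshold N).
  rewrite muleC -lee_pdivlMr// -EFinM leeBlDl// -EFinD mle_le//.
  rewrite mean_count1_threshold// xbarE -lerBlDl [X in _ <= X]mulrC -ler_pdivrMr ?divr_gt0//.
  have -> // : pos N (cnt X c1) = ((cnt X c1)%:R / N%:R - a) / (m / scale d N).
  by rewrite /pos /position; field; rewrite !gt_eqF.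
have -> : mle_distr_fun p q_gt1 beta h e N t =
    (\sum_(X : {ffun 'I_N -> 'I_q} | pos N (cnt X c1) <= threshold N)
      potts_weight p q_gt1 beta h X) /
    \sum_(X : {ffun 'I_N -> 'I_q}) potts_weight p q_gt1 beta h X.
  by rewrite mulr_suml; apply: eq_bigl => X; exact: event.
have Z : \sum_(Y : {ffun 'I_N -> 'I_q}) potts_weight p q_gt1 beta h Y =
    count_weight N (center a N) * \sum_(k < N.+1) 1 * ratio N k.
  under eq_bigr do rewrite -[potts_weight _ _ _ _ _]mulr1.
  rewrite (sum_count_weight p q_gt1 beta h N (fun=> 1)) mulr_sumr.
  by apply: eq_bigr => k _; rewrite mulr1 mul1r /ratio mulrC divfK// gt_eqF.
rewrite Z big_mkcond/=.
rewrite (eq_bigr (fun X => potts_weight p q_gt1 beta h X *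
  (pos N (cnt X c1) <= threshold N)%R%:R)) => [|X _]; last first.
  by case: ifP => _; rewrite ?mulr1 ?mulr0.
rewrite (sum_count_weight p q_gt1 beta h N (fun k => (pos N k <= threshold N)%R%:R)).
rewrite (_ : \sum_(k < N.+1) _ = count_weight N (center a N) *
  \sum_(k < N.+1) (pos N k <= threshold N)%R%:R * ratio N k); last first.
  by rewrite mulr_sumr; apply: eq_bigr => k _; rewrite /ratio; field; rewrite gt_eqF.
by rewrite -mulf_div divff ?mul1r// gt_eqF.
Qed.

Lemma mle_distr_fun_cvg :
  mle_distr_fun p q_gt1 beta h e N t @[N --> \oo] --> limit_cdf d c m t.
Proof.
apply: cvg_trans fraction_cvg; apply: near_eq_cvg; near=> N.
by rewrite mle_distr_fun_fraction//; near: N; exact: nbhs_infty_gt.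
Unshelve. all: by end_near. Qed.

End limit_theorem.

(** The linear term in the limit laws has the sign opposite to the tilt of the
    weights; the parity of [d] turns this into the sign in front of the mean. *)
Lemma limit_law (R : realType) (d : nat) (c m : R) : (4 <= d)%N -> ~~ odd d ->
  c < 0 -> 0 < m -> exists G : probability (measurableTypeR R) R,
    forall t, distr_fun G t = limit_cdf d c m t /\
      distr_fun G t = distr_fun (exp_poly_law (law_poly d c 0))
        (- law_mean (exp_poly_law (law_poly d c (- (m * t))))).
Proof.
move=> d4 de c0 m0; have [G GE] := limit_cdf_probability d4 de c0 m0.
exists G => t; split; first exact: GE.
by rewrite GE /limit_cdf law_mean_exp// tilted_mean_opp// opprK distr_fun_exp.
Qed.

Theorem theorem3p2 (R : realType) (p q : nat)
    (p_gt1 : (1 < p)%N) (q_gt1 : (1 < q)%N)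
    (beta h s : R) (beta_gt0 : 0 < beta) (h_ge0 : 0 <= h)
    (Hspecial : special p q_gt1 beta h s) :
  (typeI_special p q_gt1 beta h s ->
    exists G1 : probability (measurableTypeR R) R,
      (forall t, distr_fun G1 t =
         distr_fun (T_law p q_gt1 beta h s 0 0)
           (- law_mean (T_law p q_gt1 beta h s 0 t))) /\
      cvg_in_distribution (mle_distr_fun p q_gt1 beta h (3 / 4)) G1)
  /\
  (typeII_special p q_gt1 beta h s ->
    exists G2 : probability (measurableTypeR R) R,
      (forall t, distr_fun G2 t =
         distr_fun (F_law 0) (- law_mean (F_law t))) /\
      cvg_in_distribution (mle_distr_fun p q_gt1 beta h (5 / 6)) G2).
Proof.
have [s01 vmax sing] := Hspecial.
have va := xs_color1 q_gt1 s; have vb := @xs_other R q q_gt1 s.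
have b_gt0 := xs_other_gt0 q_gt1 s01; have a_gt0 := xs_color1_gt0 q_gt1 s01.
have ba := xs_order q_gt1 s01; have ab1 := xs_sum q_gt1 s.
have f4E := f4_F p q_gt1 beta h s01.
set a := (1 + (q%:R - 1) * s) / q%:R in va a_gt0 ba ab1 f4E *.
set b := (1 - s) / q%:R in vb b_gt0 ba ab1 *.
have crit := crit_eq va vb a_gt0 b_gt0 ab1 vmax.
have stab := transverse_stability p_gt1 beta_gt0 va vb a_gt0 b_gt0 ab1 ba vmax.
have F1 := F1_eq0 va vb a_gt0 b_gt0 ab1 vmax.
have F2 := F2_eq0 p_gt1 beta_gt0 va vb a_gt0 b_gt0 ab1 ba vmax sing.
have F3 := F3_eq0 p_gt1 beta_gt0 va vb a_gt0 b_gt0 ab1 ba vmax sing.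
have m_gt0 : 0 < (q.-1%:R : R) by rewrite ltr0n -subn1 subn_gt0.
have q_gt0 : 0 < (q%:R : R) by rewrite ltr0n ltnW.
have qm : 1 - q%:R = - (q.-1%:R : R).
  by rewrite -[in LHS](prednK (ltnW q_gt1)) -natr1; ring.
split=> [[_ f4_lt0]|[_ f4_0]].
  have F4 : segment_deriv p q beta h 4 a < 0.
    by move: f4_lt0; rewrite f4E pmulr_rlt0// exprn_gt0// divr_gt0.
  pose c : R := segment_deriv p q beta h 4 a / 4`!%:R * q.-1%:R ^+ 4.
  have c_lt0 : c < 0.
    by rewrite pmulr_llt0 ?exprn_gt0// pmulr_llt0// invr_gt0 ltr0n.
  have [//|//|G GE] := @limit_law R 4 c q.-1%:R _ _ c_lt0 m_gt0.
  have TE u : T_law p q_gt1 beta h s 0 u = exp_poly_law (law_poly 4 c (- (q.-1%:R * u))).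
    have cE : q%:R ^+ 4 * f4 p q_gt1 beta h s / 24 = c.
      by rewrite f4E /c (_ : 4`! = 24%N)//; field; rewrite gt_eqF.
    by rewrite /T_law /law_poly cE !mul0r add0r qm mulrN [u * _]mulrC.
  exists G; split=> [t|t _].
    by have [_ ->] := GE t; rewrite !TE mulr0 oppr0.
  have [-> _] := GE t.
  apply: (mle_distr_fun_cvg p_gt1 beta_gt0 va vb a_gt0 b_gt0 ab1 crit vmax stab) => //.
    by case=> [|[|[|[|]]]].
  by field.
have F4 : segment_deriv p q beta h 4 a = 0.
  move/eqP: f4_0; rewrite f4E mulf_eq0 gt_eqF ?exprn_gt0 ?divr_gt0//=.
  by move/eqP.
have [q2 p4 a2 _ b23] := F4_eq0 p_gt1 beta_gt0 va vb a_gt0 b_gt0 ab1 ba vmax sing F4.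
have [F5 F6] : segment_deriv p q beta h 5 a = 0 /\ segment_deriv p q beta h 6 a = - 1536.
  by rewrite p4 q2 a2 b23; exact: segment_deriv56_half.
have m1 : (q.-1%:R : R) = 1 by rewrite q2.
pose c : R := segment_deriv p q beta h 6 a / 6`!%:R * q.-1%:R ^+ 6.
have cE : c = - (32 / 15).
  by rewrite /c F6 m1 (_ : 6`! = 720%N)//; field.
have c_lt0 : c < 0 by rewrite cE oppr_lt0 divr_gt0.
have [//|//|G GE] := @limit_law R 6 c q.-1%:R _ _ c_lt0 m_gt0.
have FE u : F_law u = exp_poly_law (law_poly 6 c (- (q.-1%:R * u))).
  by rewrite /F_law /law_poly cE m1 mul1r !scaleNr.
exists G; split=> [t|t _].
  by have [_ ->] := GE t; rewrite !FE mulr0 oppr0.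
have [-> _] := GE t.
apply: (mle_distr_fun_cvg p_gt1 beta_gt0 va vb a_gt0 b_gt0 ab1 crit vmax stab) => //.
- by case=> [|[|[|[|[|[|]]]]]].
- by rewrite F6 oppr_lt0 (ltr_nat R 0).
- by field.
Qed.
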